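(* Let $(\tau_A:A\to M,\tau_V:V\to M)$ be a Lie affgebroid, $L:A\to\mathbb R$ a Lagrangian function and $S_L=(A_A^{-1}\circ d^{\mathcal L^{\tau_A}V}L)(A)\subseteq\rho_A^*(TV^* )$. Under the bijection $\Psi_L$ between the set of curves $\gamma$ in $S_L$ and the set of curves $c$ in $A$, given by $A_A(\gamma(t))=(d^{\mathcal L^{\tau_A}V}L)(c(t))$ for all $t$, the admissible curves in the Lagrangian submanifold $S_L$ correspond with the solutions of the Euler–Lagrange equations for $L$.
   Context: Everything is smooth. A Lie algebroid $(E,[\cdot,\cdot],\rho)$ over $M$ is a vector bundle $\tau:E\to M$ with a Lie bracket on $\Gamma(E)$ and an anchor $\rho:E\to TM$ with $[X,fY]=f[X,Y]+\rho(X)(f)Y$; $d^E$ is its differential and $\mathcal L^E_X=i_Xd^E+d^Ei_X$. Sections of $E^*$ are identified with fibrewise linear functions on $E$. **Lie affgebroids.** Let $\tau_A:A\to M$ be an affine bundle modelled on $\tau_V:V\to M$. $A^+=\mathrm{Aff}(A,\mathbb R)\to M$ (fibrewise affine functions), $1_A\in\Gamma(A^+)$ the constant function $1$, $\tilde A=(A^+)^*$, with inclusions $i_A:A\to\tilde A$, $i_A(a)(\varphi)=\varphi(a)$, and its linear part $i_V:V\to\tilde A$. A Lie affgebroid structure on $A$ is a Lie bracket $[\cdot,\cdot]_V$ on $\Gamma(V)$, an $\mathbb R$-linear action $D:\Gamma(A)\times\Gamma(V)\to\Gamma(V)$ and an affine map $\rho_A:A\to TM$ with $D_X[\bar Y,\bar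 Z]_V=[D_X\bar Y,\bar Z]_V+[\bar Y,D_X\bar Z]_V$, $D_{X+\bar Y}\bar Z=D_X\bar Z+[\bar Y,\bar Z]_V$, $D_X(f\bar Y)=fD_X\bar Y+\rho_A(X)(f)\bar Y$; $V$ is then a Lie algebroid with anchor the linear part $\rho_V$ of $\rho_A$. It is equivalent to a Lie algebroid structure on $\tilde A$ with $1_A$ a 1-cocycle, via $[i_V\bar Y,i_V\bar Z]_{\tilde A}=i_V[\bar Y,\bar Z]_V$, $[i_AX,i_V\bar Y]_{\tilde A}=i_V(D_X\bar Y)$, $\rho_{\tilde A}\circ i_A=\rho_A$. More generally, a Lie algebroid $U$ with a 1-cocycle $\phi$ nonzero on every fibre makes $\phi^{-1}\{1\}$ a Lie affgebroid modelled on $\phi^{-1}\{0\}$ (structure restricted from $U$), with bidual Lie algebroid $U$. A symplectic section of a Lie algebroid $W$ is a fibrewise nondegenerate $\Omega\in\Gamma(\wedge^2W^* )$ with $d^W\Omega=0$; a Lie affgebroid modelled on such a $W$ is called symplectic. **Local data.** $(x^i)$ local coordinates on $M$, $\{e_0,e_\alpha\}$ a local basis of $\Gamma(\tilde A)$ with $1_A(e_0)=1$, $1_A(e_\alpha)=0$; $[e_0,e_\alpha]=C_{0\alpha}^\gamma e_\gamma$, $[e_\alpha,e_\beta]=C_{\alpha\beta}^\gamma e_\gamma$, $\rho_{\tilde A}(e_0)=\rho_0^i\partial_{x^i}$, $\rho_{\tilde A}(e_\alpha)=\rho_\alpha^i\partial_{x^i}$; $(x^i,y^\alpha)$ coordinates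 on $A$ (a point being $e_0+y^\alpha e_\alpha$) and on $V$; $(x^i,y_\alpha)$ coordinates on $V^*$. **Prolongations.** For a Lie algebroid $E$ over $M$ and $f:M'\to M$ with $\rho(E_{f(x')})+T_{x'}f(T_{x'}M')=T_{f(x')}M$ for all $x'$, $\mathcal L^fE=\{(b,v')\in E\times TM':\rho(b)=Tf(v')\}$ is a Lie algebroid over $M'$ with anchor $(b,v')\mapsto v'$ and bracket determined by $[(X\circ f,U'),(Y\circ f,W')]=([X,Y]\circ f,[U',W'])$, $U',W'$ being $f$-projectable onto $\rho(X),\rho(Y)$. **The affgebroid $\rho_A^*(TV^* )$.** $\rho_A^*(TV^* )=\{(a,X)\in A\times TV^*:\rho_A(a)=T\tau_V^*(X)\}$, with projection $\widetilde{\pi_{V^*}}(a,X)=\pi_{V^*}(X)$ to $V^*$, equals $\eta^{-1}\{1\}$ for the 1-cocycle $\eta(\tilde a,X)=1_A(\tilde a)$ of $\mathcal L^{\tau_V^*}\tilde A$, hence is a Lie affgebroid modelled on $\eta^{-1}\{0\}=\mathcal L^{\tau_V^*}V$, with anchor $(a,X)\mapsto X$. It is symplectic with $\Omega_V=-d\lambda_V$, $\lambda_V(\alpha)(u,X)=\alpha(u)$. It is also a vector bundle over $A$ via $pr_1(a,X)=a$ (pull-back of $T\tau_V^*:TV^*\to TM$ by $\rho_A$). It is already known that $S_L$ is a Lagrangian submanifold (in the sense defined below) of the symplectic Lie affgebroid $\rho_A^*(TV^* )\to V^*$. **The isomorphism $A_A$.** For $(u,Y_b)\in(\mathcal L^{\tau_A}V)_b$,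 let $\sigma_A^l(u,Y_b)=(b,U_u)$, where $U_u\in T_uV$ is the unique vector such that, viewed in $T_u\tilde A$, $U_u(f\circ\tau_{\tilde A})=\rho_A(b)(f)$ and $U_u(\theta)=Y_b(\theta)+(d^{\tilde A}\theta)(b,u)$ for $f\in C^\infty(M)$, $\theta\in\Gamma(A^+)$. $A_A:\rho_A^*(TV^* )\to(\mathcal L^{\tau_A}V)^*$ is the vector bundle isomorphism over $\mathrm{Id}_A$ with $A_A(b,X_\alpha)(u,Y_b)=T\langle\cdot,\cdot\rangle(U_u,X_\alpha)\in\mathbb R$, the derivative of the pairing $\langle\cdot,\cdot\rangle:V\times_MV^*\to\mathbb R$. In coordinates $(x^i,y_\alpha;z^\alpha,v_\alpha)$ on $\rho_A^*(TV^* )$ (the point $(e_0+z^\alpha e_\alpha,\ (\rho_0^i+z^\alpha\rho_\alpha^i)\partial_{x^i}+v_\alpha\partial_{y_\alpha})$ at $(x^i,y_\alpha)\in V^*$) and the coordinates on $(\mathcal L^{\tau_A}V)^*$ dual to the basis $(e_\alpha,\rho_\alpha^i\partial_{x^i}),(0,\partial_{y^\alpha})$: $$A_A(x^i,y_\alpha;z^\alpha,v_\alpha)=(x^i,z^\gamma;\,v_\gamma-C_{0\gamma}^\beta y_\beta-C_{\alpha\gamma}^\beta z^\alpha y_\beta,\,y_\gamma).$$ **Bijection and admissible curves.** For $\gamma$ in $S_L$, the corresponding curve is $c=\Psi_L(\gamma)=pr_1\circ\gamma$, so $\gamma=(c,\gamma_2)\in A\times TV^*$. $\gamma$ is admissible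 if $\gamma_2(t)=\dot c^*(t)$ for all $t$, where $c^*=\pi_{V^*}\circ\gamma_2$ and $\pi_{V^*}:TV^*\to V^*$ is the canonical projection. **Euler–Lagrange equations.** A curve $c(t)=(x^i(t),y^\alpha(t))$ in $A$ is a solution if (a globally meaningful condition) $$\frac{dx^i}{dt}=\rho_0^i+\rho_\alpha^iy^\alpha,\qquad\frac{d}{dt}\Big(\frac{\partial L}{\partial y^\alpha}\Big)=\rho_\alpha^i\frac{\partial L}{\partial x^i}+(C_{0\alpha}^\gamma+C_{\beta\alpha}^\gamma y^\beta)\frac{\partial L}{\partial y^\gamma}.$$ **Complete lift and Lagrangian submanifolds.** Let $\tau_B:B\to N$ be a symplectic Lie affgebroid modelled on $\tau_W:W\to N$ with symplectic section $\Omega$. For $f\in C^\infty(N)$ put $f^c(b)=\rho_B(b)(f)$, $f^v=f\circ\tau_B$. For $X\in\Gamma(W)$, let $(i_W\circ X)^v$ be the vertical lift to $\tilde B$ and $(i_W\circ X)^c$ the complete lift (the unique vector field on $\tilde B$ projectable on $\rho_W(X)$ with $(i_W\circ X)^c(\theta)=\mathcal L^{\tilde B}_{i_W\circ X}\theta$ for $\theta\in\Gamma(B^+)$); both are tangent to $B$, and one sets $X^{\mathbf v}(b)=(0,(i_W\circ X)^v(b))$, $X^{\mathbf c}(b)=(X(\tau_B(b)),(i_W\circ X)^c(b))$ in $\mathcal L^{\tau_B}W$. $\Omega^{\mathbf c}$ is the unique section of $\wedge^2(\mathcal L^{\tau_B}W)^*\to B$ with $\Omega^{\mathbf c}(X^{\mathbf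 c},Y^{\mathbf c})=\Omega(X,Y)^c$, $\Omega^{\mathbf c}(X^{\mathbf v},Y^{\mathbf c})=\Omega(X,Y)^v$, $\Omega^{\mathbf c}(X^{\mathbf v},Y^{\mathbf v})=0$; it is a symplectic section of $\mathcal L^{\tau_B}W$. Let $S\subseteq B$ be a submanifold with inclusion $i$ and $\tau^S=\tau_B\circ i$, such that $\rho_W(W_{\tau^S(s)})+T_s\tau^S(T_sS)=T_{\tau^S(s)}N$ for all $s\in S$. $S$ is Lagrangian if for every $s\in S$ the image of $(\mathcal L^{\tau^S}W)_s$ under $(w,v)\mapsto(w,Ti(v))$ is a Lagrangian subspace of $((\mathcal L^{\tau_B}W)_{i(s)},\Omega^{\mathbf c}(i(s)))$. *)

(* Defs.v *)
From HB Require Import structures.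
From mathcomp Require Import all_boot all_order all_algebra.
From mathcomp Require Import all_classical all_reals all_analysis.
Set Implicit Arguments.
Unset Strict Implicit.
Unset Printing Implicit Defensive.
Import Order.TTheory GRing.Theory Num.Theory.
Import numFieldNormedType.Exports.
Local Open Scope classical_set_scope.
Local Open Scope ring_scope.

(* [Ck k U f]: f is k times (Frechet) differentiable at the points of U, the
   k-th derivatives being continuous. *)
Fixpoint Ck (R : realType) (E : normedModType R) (k : nat) (U : set E)
    (f : E -> R) : Prop :=
  match k with
  | 0%N => forall x, U x -> {for x, continuous f}
  | k'.+1 => (forall x, U x -> differentiable f x) /\
             (forall v : E, Ck k' U (fun x => 'd f x v))
  end.

Definition smooth_on (R : realType) (E : normedModType R) (U : set E)
  (f : E -> R) : Prop := forall k, Ck k U f.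

Definition smooth_at (R : realType) (E : normedModType R) (f : E -> R)
  (x : E) : Prop := exists U : set E, [/\ open U, U x & smooth_on U f].

(* A chart is only meaningful on [cdom]; [cinv] is only meaningful on the
   image of [cdom]. *)
Record chart (R : realType) (T : Type) (n : nat) := Chart {
  cdom : set T;
  cmap : T -> 'rV[R]_n;
  cinv : 'rV[R]_n -> T }.

(* A set with a family of charts, without axioms.  The axioms of a manifold
   are imposed on the base M below; the total spaces of bundles over M carry
   the charts induced by those of M and by the local trivializations. *)
Record smooth_space (R : realType) := SmoothSpace {
  points :> Type;
  sdim : nat;
  charts : set (chart R points sdim) }.

Definition chart_coord (R : realType) (T : Type) (n : nat) (k : chart R T n)
  (i : 'I_n) : T -> R := fun p => cmap k p 0 i.

Definition smooth_near (R : realType) (S : smooth_space R) (f : S -> R)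
  (p : S) : Prop :=
  forall k, charts k -> cdom k p -> smooth_at (fun z => f (cinv k z)) (cmap k p).

Definition smooth_fun (R : realType) (S : smooth_space R) (f : S -> R) : Prop :=
  forall p, smooth_near f p.

Definition smooth_curve_at (R : realType) (S : smooth_space R) (c : R -> S)
  (t : R) : Prop :=
  forall k, charts k -> cdom k (c t) ->
    (\forall s \near t, cdom k (c s)) /\
    (forall i, smooth_at (fun s : R => chart_coord k i (c s)) t).

Definition smooth_curve (R : realType) (S : smooth_space R) (I : set R)
  (c : R -> S) : Prop := forall t, I t -> smooth_curve_at c t.

Record manifold (R : realType) := Manifold {
  mtop : topologicalType;
  mdim : nat;
  matlas : set (chart R mtop mdim);
  mhausdorff : hausdorff_space mtop;
  mcountable : @second_countable mtop;
  matlas_cover : forall p, exists2 k, matlas k & cdom k p;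
  matlas_dom : forall k, matlas k -> open (cdom k);
  matlas_img : forall k, matlas k -> open (cmap k @` cdom k);
  matlas_inv : forall k p, matlas k -> cdom k p -> cinv k (cmap k p) = p;
  matlas_cmap : forall k p, matlas k -> cdom k p ->
    {for p, continuous (cmap k)};
  matlas_cinv : forall k p, matlas k -> cdom k p ->
    {for cmap k p, continuous (cinv k)};
  matlas_compat : forall k k', matlas k -> matlas k' -> forall i,
    smooth_on (cmap k @` (cdom k `&` cdom k'))
              (fun z => chart_coord k' i (cinv k z)) }.

Coercion manifold_space (R : realType) (M : manifold R) : smooth_space R :=
  SmoothSpace (@matlas R M).

(* The velocity of a curve, as a derivation of the functions which are smooth
   near c t; it is set to 0 on the other functions, so that two tangent
   vectors are equal as soon as they agree on smooth functions. *)
Definition velocity (R : realType) (S : smooth_space R) (c : R -> S) (t : R) :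
    (S -> R) -> R :=
  fun f => if `[< smooth_near f (c t) >] then derive1 (fun s : R => f (c s)) t
           else 0.

Record tangent (R : realType) (S : smooth_space R) (p : S) := Tangent {
  tan_fun :> (S -> R) -> R;
  tan_velocity : exists c : R -> S,
    [/\ smooth_curve_at c 0, c 0 = p & tan_fun = velocity c 0] }.

Definition tbundle (R : realType) (S : smooth_space R) : Type :=
  {p : S & tangent p}.

(* The tangent map of g at p, in the same normal form as [velocity]. *)
Definition push (R : realType) (S S' : smooth_space R) (g : S -> S') (p : S)
    (X : tangent p) : (S' -> R) -> R :=
  fun f => if `[< smooth_near f (g p) >] then X (fun q => f (g q)) else 0.

(* Smooth curves in TS: the coordinates of TS induced by a chart k of S are
   those of the base point and X (x^i), where x^i are the coordinates of k. *)
Definition smooth_tcurve (R : realType) (S : smooth_space R) (I : set R)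
  (X : R -> tbundle S) : Prop :=
  smooth_curve I (fun t => tag (X t)) /\
  forall t, I t -> forall k, charts k -> cdom k (tag (X t)) -> forall i,
    smooth_at (fun s : R => tagged (X s) (chart_coord k i)) t.

(* A local trivialization, over [fdom], of an affine bundle A and of its model
   vector bundle V: a local section e_0 = [forg] of A, and a linear
   isomorphism R^r -> V_x, inverse to [fcoord], whose values on the canonical
   basis are the e_alpha.  Outside [fdom] the data are meaningless. *)
Record frame (R : realType) (T : Type) (A : T -> Type) (V : T -> lmodType R)
    (r : nat) := Frame {
  fdom : set T;
  forg : forall x, A x;
  fvec : forall x, {linear 'rV[R]_r -> V x};
  fcoord : forall x, {linear V x -> 'rV[R]_r} }.

Record affine_bundle (R : realType) (M : manifold R) := AffineBundle {
  afib : M -> Type;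
  vfib : M -> lmodType R;
  rank : nat;
  aadd : forall x, afib x -> vfib x -> afib x;
  asub : forall x, afib x -> afib x -> vfib x;
  aadd0 : forall x (a : afib x), aadd a 0 = a;
  aaddA : forall x (a : afib x) u v, aadd (aadd a u) v = aadd a (u + v);
  aaddK : forall x (a : afib x) v, asub (aadd a v) a = v;
  asubK : forall x (a b : afib x), aadd a (asub b a) = b;
  frames : set (frame afib vfib rank);
  frames_cover : forall x, exists2 e, frames e & fdom e x;
  frames_open : forall e, frames e -> @open (mtop M) (fdom e);
  frames_vecK : forall e x, frames e -> fdom e x -> cancel (fvec e x) (fcoord e x);
  frames_coordK : forall e x, frames e -> fdom e x -> cancel (fcoord e x) (fvec e x);
  frames_compat_vec : forall e e' x, frames e -> frames e' ->
    fdom e x -> fdom e' x -> forall (y : 'rV[R]_rank) i,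
    smooth_near (fun x' : M => fcoord e' x' (fvec e x' y) 0 i) x;
  frames_compat_org : forall e e' x, frames e -> frames e' ->
    fdom e x -> fdom e' x -> forall i,
    smooth_near
      (fun x' : M => fcoord e' x' (asub (forg e x') (forg e' x')) 0 i) x }.

Arguments afib {R M} A x : rename.
Arguments vfib {R M} A x : rename.
Arguments frames {R M} A : rename.
Arguments aadd {R M A x} a v : rename.
Arguments asub {R M A x} a b : rename.

(* The linear form on V_x with coordinates y in the frame dual to e. *)
Section DualVector.
Variables (R : realType) (T : Type) (A : T -> Type) (V : T -> lmodType R).
Variables (r : nat) (e : frame A V r) (x : T) (y : 'rV[R]_r).

Definition dual_vec (v : V x) : R := \sum_i y 0 i * fcoord e x v 0 i.

Lemma dual_vec_is_scalar : scalar dual_vec.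
Proof.
move=> k u v; rewrite /dual_vec mulr_sumr -big_split; apply: eq_bigr => i _ /=.
by rewrite linearP !mxE mulrDr mulrCA.
Qed.

HB.instance Definition _ :=
  GRing.isLinear.Build R (V x) R *%R dual_vec dual_vec_is_scalar.
End DualVector.

Arguments dual_vec {R T A V r} e x y v.

Section Bundles.
Variables (R : realType) (M : manifold R) (A : affine_bundle M).

Notation dimM := (mdim M).
Notation rk := (rank A).
Notation atlasM := (@matlas R M).

Definition basis_vec (e : frame (afib A) (vfib A) rk) (i : 'I_rk) (x : M) :
  vfib A x := fvec e x (delta_mx 0 i).

(* Each of the total spaces A, V, V^* gets the charts (x^i, y) induced by a
   chart of M and a frame of (A, V). *)
Definition totA_chart (k : chart R M dimM) (e : frame (afib A) (vfib A) rk) :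
    chart R {x : M & afib A x} (dimM + rk) :=
  Chart [set a | cdom k (tag a) /\ fdom e (tag a)]
    (fun a => row_mx (cmap k (tag a))
                     (fcoord e (tag a) (asub (tagged a) (forg e (tag a)))))
    (fun z => let x := cinv k (lsubmx z) in
              Tagged (afib A) (aadd (forg e x) (fvec e x (rsubmx z)))).

Definition totA : smooth_space R :=
  SmoothSpace [set c | exists k e,
    [/\ atlasM k, frames A e & c = totA_chart k e]].

Definition totV_chart (k : chart R M dimM) (e : frame (afib A) (vfib A) rk) :
    chart R {x : M & vfib A x} (dimM + rk) :=
  Chart [set u | cdom k (tag u) /\ fdom e (tag u)]
    (fun u => row_mx (cmap k (tag u)) (fcoord e (tag u) (tagged u)))
    (fun z => let x := cinv k (lsubmx z) in
              Tagged (fun x => vfib A x : Type) (fvec e x (rsubmx z))).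

Definition totV : smooth_space R :=
  SmoothSpace [set c | exists k e,
    [/\ atlasM k, frames A e & c = totV_chart k e]].

Definition dual_fib (x : M) : Type := {scalar vfib A x}.

Definition totVd_chart (k : chart R M dimM) (e : frame (afib A) (vfib A) rk) :
    chart R {x : M & dual_fib x} (dimM + rk) :=
  Chart [set al | cdom k (tag al) /\ fdom e (tag al)]
    (fun al => row_mx (cmap k (tag al))
                      (\row_i (tagged al : {scalar _}) (basis_vec e i (tag al))))
    (fun z => let x := cinv k (lsubmx z) in
              Tagged dual_fib (dual_vec e x (rsubmx z) : {scalar vfib A x})).

Definition totVd : smooth_space R :=
  SmoothSpace [set c | exists k e,
    [/\ atlasM k, frames A e & c = totVd_chart k e]].

Definition ptA (x : M) (a : afib A x) : totA := Tagged (afib A) a.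
Definition ptV (x : M) (u : vfib A x) : totV :=
  Tagged (fun x => vfib A x : Type) u.
Definition ptVd (x : M) (al : dual_fib x) : totVd := Tagged dual_fib al.

Definition tauA : totA -> M := fun a => tag a.
Definition tauV : totV -> M := fun u => tag u.
Definition tauVd : totVd -> M := fun al => tag al.

Definition sectionV : Type := forall x, vfib A x.
Definition sectionA : Type := forall x, afib A x.

Definition smooth_sectionV (s : sectionV) : Prop :=
  forall e x, frames A e -> fdom e x -> forall i,
    smooth_near (fun x' : M => fcoord e x' (s x') 0 i) x.

Definition smooth_sectionA (s : sectionA) : Prop :=
  forall e x, frames A e -> fdom e x -> forall i,
    smooth_near (fun x' : M => fcoord e x' (asub (s x') (forg e x')) 0 i) x.

(* The fibre A^+_x = Aff(A_x, R); [aff_lin] is the linear part, i.e. the value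
   of the form, seen as a linear form on the bidual of A_x, on the vectors
   i_V u. *)
Record aff_form (x : M) := AffForm {
  aff_val :> afib A x -> R;
  aff_lin : {scalar vfib A x};
  aff_valD : forall a v, aff_val (aadd a v) = aff_val a + aff_lin v }.

Definition aff_fun (th : forall x, aff_form x) : totA -> R :=
  fun a => th (tag a) (tagged a).
Definition aff_lin_fun (th : forall x, aff_form x) : totV -> R :=
  fun u => aff_lin (th (tag u)) (tagged u).

(* A section of A^+ is smooth iff it is so as a fibrewise affine function on A. *)
Definition smooth_aff (th : forall x, aff_form x) : Prop :=
  smooth_fun (aff_fun th).

Definition addS (s t : sectionV) : sectionV := fun x => s x + t x.
Definition scaleS (f : M -> R) (s : sectionV) : sectionV := fun x => f x *: s x.
Definition shiftS (X : sectionA) (s : sectionV) : sectionA := fun x => aadd (X x) (s x).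

(* [br] and [D] are only meaningful on smooth sections. *)
Record lie_affgebroid := LieAffgebroid {
  br : sectionV -> sectionV -> sectionV;
  D : sectionA -> sectionV -> sectionV;
  rhoA : forall x, afib A x -> tangent (x : M);
  rhoV : forall x, vfib A x -> tangent (x : M);
  br_smooth : forall s t, smooth_sectionV s -> smooth_sectionV t ->
    smooth_sectionV (br s t);
  D_smooth : forall X s, smooth_sectionA X -> smooth_sectionV s ->
    smooth_sectionV (D X s);
  (* the anchor is a smooth affine bundle map A -> TM with linear part rhoV *)
  rhoA_smooth : forall (a : totA) k, atlasM k -> cdom k (tag a) -> forall i,
    smooth_near (fun a' : totA =>
      rhoA (tagged a') (chart_coord k i)) a;
  rhoA_affine : forall x (a : afib A x) u (f : M -> R),
    rhoA (aadd a u) f = rhoA a f + rhoV u f;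
  rhoV_linear : forall x (c : R) (u v : vfib A x) (f : M -> R),
    rhoV (c *: u + v) f = c * rhoV u f + rhoV v f;
  br_linear : forall (c : R) s s' t,
    smooth_sectionV s -> smooth_sectionV s' -> smooth_sectionV t ->
    br (addS (scaleS (fun=> c) s) s') t =
    addS (scaleS (fun=> c) (br s t)) (br s' t);
  br_antisym : forall s t, smooth_sectionV s -> smooth_sectionV t ->
    br s t = scaleS (fun=> -1) (br t s);
  br_jacobi : forall s t u,
    smooth_sectionV s -> smooth_sectionV t -> smooth_sectionV u ->
    addS (br s (br t u)) (addS (br t (br u s)) (br u (br s t))) = (fun=> 0);
  D_linear : forall X (c : R) s t,
    smooth_sectionA X -> smooth_sectionV s -> smooth_sectionV t ->
    D X (addS (scaleS (fun=> c) s) t) =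
    addS (scaleS (fun=> c) (D X s)) (D X t);
  D_bracket : forall X s t,
    smooth_sectionA X -> smooth_sectionV s -> smooth_sectionV t ->
    D X (br s t) = addS (br (D X s) t) (br s (D X t));
  D_shift : forall X s t,
    smooth_sectionA X -> smooth_sectionV s -> smooth_sectionV t ->
    D (shiftS X s) t = addS (D X t) (br s t);
  D_leibniz : forall X (f : M -> R) s,
    smooth_sectionA X -> smooth_fun f -> smooth_sectionV s ->
    D X (scaleS f s) =
    addS (scaleS f (D X s)) (scaleS (fun x => rhoA (X x) f) s) }.

Variable G : lie_affgebroid.

Record prolV (b : totA) := ProlV {
  prol_vec : vfib A (tag b);
  prol_tan : tangent b;
  prol_eq : tan_fun (rhoV G prol_vec) = push tauA prol_tan }.

(* Elements of the dual of the prolongation, with their base point.  The forms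
   in use are linear, and two of them are equal iff they are so as functions. *)
Definition prolV_dual : Type := {b : totA & prolV b -> R}.

(* The section d L: since the anchor of the prolongation is (u, Y) |-> Y,
   (d L)(b)(u, Y) = Y(L). *)
Definition dprol (L : totA -> R) : totA -> prolV_dual := fun b =>
  existT (fun b => prolV b -> R) b (fun w => prol_tan w L).

Record rhoTVd := RhoTVd {
  rt_base : M;
  rt_a : afib A rt_base;
  rt_al : dual_fib rt_base;
  rt_X : tangent (ptVd rt_al);
  rt_eq : tan_fun (rhoA G rt_a) = push tauVd rt_X }.

Definition rt_pr1 (p : rhoTVd) : totA := ptA (rt_a p).
Definition rt_pr2 (p : rhoTVd) : tbundle totVd :=
  existT (fun al : totVd => tangent al) (ptVd (rt_al p)) (rt_X p).

(* (d theta)(i_A b, i_V u), where d is the differential of the Lie algebroid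
   structure on the bidual of A.  With sections X of A through b and s of V
   through u, the usual formula
     (d theta)(i_A X, i_V s) = rho(i_A X)(theta(i_V s))
        - rho(i_V s)(theta(i_A X)) - theta([i_A X, i_V s])
   reads as below, since [i_A X, i_V s] = i_V (D_X s). *)
Definition dbidual (th : forall x, aff_form x) (x : M) (b : afib A x)
    (u : vfib A x) : R :=
  xget 0 [set r | exists X s,
    [/\ smooth_sectionA X, smooth_sectionV s, X x = b, s x = u &
        r = rhoA G b (fun x' => aff_lin (th x') (s x'))
            - rhoV G u (fun x' => th x' (X x'))
            - aff_lin (th x) (D G X s x)]].

(* U is the vector U_u with sigma_A^l (u, Y_b) = (b, U_u). *)
Definition is_sigma (x : M) (b : afib A x) (w : prolV (ptA b))
    (U : tangent (ptV (prol_vec w : vfib A x))) : Prop :=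
  (forall f : M -> R, smooth_fun f -> U (fun v => f (tauV v)) = rhoA G b f) /\
  (forall th : forall x, aff_form x, smooth_aff th ->
     U (aff_lin_fun th) =
     prol_tan w (aff_fun th) + dbidual th b (prol_vec w)).

(* The derivative of the pairing V x_M V^* -> R at (u, al) on the pair (U, X):
   differentiate along a curve in V x_M V^* whose components have velocities
   U and X. *)
Definition tpairing (x : M) (u : vfib A x) (al : dual_fib x)
    (U : tangent (ptV u)) (X : tangent (ptVd al)) : R :=
  xget 0 [set r | exists w : R -> {x : M & (vfib A x * dual_fib x)%type},
    let wV := fun s => ptV (tagged (w s)).1 in
    let wVd := fun s => ptVd (tagged (w s)).2 in
    [/\ smooth_curve_at wV 0 /\ smooth_curve_at wVd 0,
        wV 0 = ptV u /\ wVd 0 = ptVd al,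
        tan_fun U = velocity wV 0 /\ tan_fun X = velocity wVd 0 &
        r = derive1 (fun s : R => ((tagged (w s)).2 : {scalar _}) (tagged (w s)).1) 0]].

Definition A_A (p : rhoTVd) : prolV_dual :=
  existT (fun b => prolV b -> R) (rt_pr1 p)
    (fun w => xget 0 [set r | exists U,
       is_sigma (b := rt_a p) (w := w) U /\ r = tpairing U (rt_X p)]).

(* The image of A under A_A^{-1} o d L, A_A being a bijection. *)
Definition S_L (L : totA -> R) : set rhoTVd :=
  [set p | exists b : totA, A_A p = dprol L b].

(* Curves are defined on an open interval I of R; the values outside I of the
   functions representing them are irrelevant. *)
Definition curve_in_rhoTVd (I : set R) (g : R -> rhoTVd) : Prop :=
  smooth_curve I (fun t => rt_pr1 (g t)) /\ smooth_tcurve I (fun t => rt_pr2 (g t)).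

Definition curve_in_S_L (L : totA -> R) (I : set R) (g : R -> rhoTVd) : Prop :=
  curve_in_rhoTVd I g /\ (forall t, I t -> S_L L (g t)).

Definition Psi (g : R -> rhoTVd) : R -> totA := fun t => rt_pr1 (g t).

Definition admissible (I : set R) (g : R -> rhoTVd) : Prop :=
  let cstar := fun t => tag (rt_pr2 (g t)) in
  forall t, I t -> tan_fun (rt_X (g t)) = velocity cstar t.

(* Local coordinates x^i = chart_coord k i on U and a local basis of sections
   (e_0, e_alpha) of the bidual of A over U, adapted in the sense that
   1_A(e_0) = 1 and 1_A(e_alpha) = 0, with its structure functions
   C_{0 alpha}^gamma = C0 alpha gamma and
   C_{alpha beta}^gamma = C alpha beta gamma on U.
   As brackets are defined on global sections, the basis is given by sections
   over M restricted to U; every local basis is of this form near a given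
   point, and the bracket is a local operator. *)
Record local_data := LocalData {
  ld_chart : chart R M dimM;
  ld_dom : set M;
  ld_e0 : sectionA;
  ld_e : 'I_rk -> sectionV;
  ld_C0 : 'I_rk -> 'I_rk -> M -> R;
  ld_C : 'I_rk -> 'I_rk -> 'I_rk -> M -> R;
  ld_atlas : atlasM ld_chart;
  ld_open : @open (mtop M) ld_dom;
  ld_sub : ld_dom `<=` cdom ld_chart;
  ld_e0_smooth : smooth_sectionA ld_e0;
  ld_e_smooth : forall al, smooth_sectionV (ld_e al);
  ld_basis : forall x, ld_dom x -> forall v : vfib A x,
    exists! y : 'rV[R]_rk, v = \sum_al y 0 al *: ld_e al x;
  ld_C0E : forall x al, ld_dom x ->
    D G ld_e0 (ld_e al) x = \sum_ga ld_C0 al ga x *: ld_e ga x;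
  ld_CE : forall x al be, ld_dom x ->
    br G (ld_e al) (ld_e be) x = \sum_ga ld_C al be ga x *: ld_e ga x }.

Definition ld_point (l : local_data) (x : M) (y : 'rV[R]_rk) : totA :=
  ptA (aadd (ld_e0 l x) (\sum_al y 0 al *: ld_e l al x)).

Definition ld_rho0 (l : local_data) (i : 'I_dimM) (x : M) : R :=
  rhoA G (ld_e0 l x) (chart_coord (ld_chart l) i).
Definition ld_rho (l : local_data) (al : 'I_rk) (i : 'I_dimM) (x : M) : R :=
  rhoV G (ld_e l al x) (chart_coord (ld_chart l) i).

Definition ld_L (l : local_data) (L : totA -> R) (z : 'rV[R]_dimM)
  (y : 'rV[R]_rk) : R := L (ld_point l (cinv (ld_chart l) z) y).

Definition dLdx (l : local_data) (L : totA -> R) (i : 'I_dimM)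
    (z : 'rV[R]_dimM) (y : 'rV[R]_rk) : R :=
  'D_(delta_mx 0 i) (fun z' => ld_L l L z' y) z.
Definition dLdy (l : local_data) (L : totA -> R) (al : 'I_rk)
    (z : 'rV[R]_dimM) (y : 'rV[R]_rk) : R :=
  'D_(delta_mx 0 al) (fun y' => ld_L l L z y') y.

Definition EL_solution (L : totA -> R) (I : set R) (c : R -> totA) : Prop :=
  forall t, I t -> forall (l : local_data) (y : R -> 'rV[R]_rk),
    let x := fun s => tauA (c s) in
    let z := fun s => cmap (ld_chart l) (x s) in
    ld_dom l (x t) ->
    (\forall s \near t, c s = ld_point l (x s) (y s)) ->
    (forall i, derive1 (fun s : R => z s 0 i) t =
       ld_rho0 l i (x t) + \sum_al ld_rho l al i (x t) * y t 0 al) /\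
    (forall al, derive1 (fun s : R => dLdy l L al (z s) (y s)) t =
       \sum_i ld_rho l al i (x t) * dLdx l L i (z t) (y t) +
       \sum_ga (ld_C0 l al ga (x t)
                + \sum_be ld_C l be al ga (x t) * y t 0 be)
               * dLdy l L ga (z t) (y t)).

End Bundles.

(* Main.v *)
(* Everything is computed in the coordinates given by local data
   (e_0, e_alpha), with x^i, y^alpha on A, v^alpha on V and eta_alpha on V^*.
   Since (d theta)(b, u) is C^oo(M)-linear, it only depends on b and u, and the
   vector U = U_u of sigma_A^l(u, Y) has the coordinates
     U(x^i) = rho_A(b)(x^i),   U(v^g) = Y(y^g) - K_a^g u^a,
   where K_a^g = C_{0a}^g + C_{ca}^g y^c.  Differentiating the pairing gives
     A_A(b, X)(u, Y) = (Y(y^g) - K_a^g u^a) eta_g + u^g X(eta_g),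
   and comparing with (d L)(u, Y) = u^a rho_a^i dL/dx^i + Y(y^g) dL/dy^g for
   all u and Y(y) shows that (b, X) lies in S_L if and only if
     eta_g = dL/dy^g,   X(eta_g) = rho_g^i dL/dx^i + K_g^a dL/dy^a.
   As X(x^i) = rho_A(b)(x^i), such an X is determined by b, and it is the
   velocity of the curve (x, eta) exactly when the Euler-Lagrange equations
   hold.  The brackets are only defined on global sections, so bump functions
   and partitions of unity are needed to produce local data at every point. *)
From HB Require Import structures.
Require Import Defs.
From mathcomp Require Import all_boot all_order all_algebra.
From mathcomp Require Import all_classical all_reals all_analysis.
From mathcomp Require Import ring lra.
Set Implicit Arguments.
Unset Strict Implicit.
Unset Printing Implicit Defensive.
Import Order.TTheory GRing.Theory Num.Theory.
Import numFieldNormedType.Exports.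
Local Open Scope classical_set_scope.
Local Open Scope ring_scope.

(** * Smooth functions on normed spaces *)

(** Three values are defined by choice: [dbidual] picks sections, [tpairing] picks a curve, [A_A]
    picks a vector U. Each falls back to 0 when nothing can be picked, so each calls for a witness
    and for a proof that all witnesses give the same coordinate expression. The spaces A, V and V^*
    have charts but no topology: nearness makes sense for points of M and for coordinate vectors
    only, and the openness that replaces a topology is that of the coordinate images of chart
    overlaps. The frame formed by local data need not be one of the given frames; smoothness and
    tangent vectors must therefore be computable in every chart compatible with the given ones.
    Since a tangent vector vanishes on the functions not smooth near its point, it is determined, as
    a function, by its values on coordinates, and equalities of vectors become finitely many scalar
    equations. Sections of A cannot be extended by zero, A being affine: a cut-off interpolates
    between a local section and a global one, and the global one has to be glued from local
    sections. *)

Lemma continuous_near (T U : topologicalType) (f : T -> U) (x : T)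
  (P : U -> Prop) : {for x, continuous f} ->
  (\forall z \near f x, P z) -> \forall y \near x, P (f y).
Proof. by move=> cf; exact: cf. Qed.

Section Calculus.
Variable R : realType.
Implicit Types E F : normedModType R.

(** Differentiability is an estimate on the germ: the first-order expansion of f serves for g, and
    uniqueness of the differential identifies ['d g x]. *)
Lemma near_eq_is_diff E F (f g : E -> F) (x : E) :
  (\forall y \near x, f y = g y) -> differentiable f x ->
  differentiable g x /\ 'd g x = 'd f x :> (E -> F).
Proof.
move=> fg df.
have fgx : f x = g x := nbhs_singleton fg.
have dg : g \o shift x = cst (g x) + 'd f x +o_ 0 id.
  apply/eqaddoP => e e0.
  have := diff_locally df; move/eqaddoP => /(_ _ e0) H.
  have fg0 : \forall h \near (0 : E), f (h + x) = g (h + x).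
    by move: fg; rewrite (near_shift 0)/=; apply: filterS => h /=; rewrite subr0.
  near=> h; have Hh : (f \o shift x - (cst (f x) + 'd f x)) h =
     (g \o shift x - (cst (g x) + 'd f x)) h.
    have := near fg0 h; rewrite !fctE /= => ->//; first by rewrite fgx.
  by rewrite -Hh; near: h.
have dE : 'd g x = 'd f x :> (E -> F).
  by apply: diff_unique => //; exact: diff_continuous.
split=> //; apply/diff_locallyP; rewrite dE; split=> //.
exact: diff_continuous.
Unshelve. all: by end_near. Qed.

Let diffDE E (f g : E -> R) x v : differentiable f x -> differentiable g x ->
  'd (fun y => f y + g y) x v = 'd f x v + 'd g x v.
Proof. by move=> df dg; exact: (congr1 (fun h : E -> R => h v) (diffD df dg)). Qed.

Let diffME E (f g : E -> R) x v : differentiable f x -> differentiable g x ->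
  'd (fun y => f y * g y) x v = f x * 'd g x v + g x * 'd f x v.
Proof. by move=> df dg; exact: (congr1 (fun h : E -> R => h v) (diffM df dg)). Qed.

Let diffVE E (f : E -> R) x v : differentiable f x -> f x != 0 ->
  'd (fun y => (f y)^-1) x v = - (f x) ^- 2 * 'd f x v.
Proof. by move=> df f0; exact: (congr1 (fun h : E -> R => h v) (diffV df f0)). Qed.

Lemma Ck_ext E k (U : set E) (f g : E -> R) : open U ->
  (forall x, U x -> f x = g x) -> Ck k U f -> Ck k U g.
Proof.
move=> oU; elim: k f g => [|k IH] f g fg /=.
  move=> cf x Ux.
  have fgx : \forall y \near x, f y = g y.
    by near do apply: fg; exact: open_nbhs_nbhs.
  have := cf _ Ux; rewrite /prop_for /continuous_at (fg _ Ux).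
  by apply: cvg_trans; apply: near_eq_cvg.
case=> df Cf; have fgx x : U x -> \forall y \near x, f y = g y.
  by move=> Ux; near do apply: fg; exact: open_nbhs_nbhs.
split=> [x Ux|v]; first by have [] := near_eq_is_diff (fgx _ Ux) (df _ Ux).
apply: (IH (fun x => 'd f x v)) (Cf v) => x Ux.
exact/esym/(congr1 (fun h : E -> R => h v))/(near_eq_is_diff (fgx _ Ux) (df _ Ux)).2.
Unshelve. all: by end_near. Qed.

Lemma CkS E k (U : set E) (f : E -> R) : Ck k.+1 U f -> Ck k U f.
Proof.
elim: k f => [|k IH] f [df Cf].
  by move=> x Ux; exact/differentiable_continuous/df.
by split=> // v; exact: IH.
Qed.

Lemma Ck_cst E k (U : set E) (a : R) : Ck k U (cst a : E -> R).
Proof.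
elim: k a => [|k IH] a; first by move=> x _; exact: cst_continuous.
split=> [x _|v]; first exact: differentiable_cst.
rewrite (_ : (fun x => _) = cst 0) //.
by apply/funext => x; rewrite diff_cst.
Qed.

Lemma CkD E k (U : set E) (f g : E -> R) : open U ->
  Ck k U f -> Ck k U g -> Ck k U (fun x => f x + g x).
Proof.
move=> oU; elim: k f g => [|k IH] f g.
  by move=> cf cg x Ux; exact: (continuousD (cf _ Ux) (cg _ Ux)).
move=> [df Cf] [dg Cg]; split=> [x Ux|v].
  by apply: differentiableD; [exact: df|exact: dg].
apply: (Ck_ext oU) (IH _ _ (Cf v) (Cg v)) => x Ux.
by rewrite -(diffDE v (df _ Ux) (dg _ Ux)).
Qed.

(** The Leibniz rule involves f and g besides their differentials, so the induction lowers both to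
    order k by [CkS]. *)
Lemma CkM E k (U : set E) (f g : E -> R) : open U ->
  Ck k U f -> Ck k U g -> Ck k U (fun x => f x * g x).
Proof.
move=> oU; elim: k f g => [|k IH] f g.
  by move=> cf cg x Ux; apply: continuousM; [exact: cf|exact: cg].
move=> Cf1 Cg1; have [[df Cf] [dg Cg]] := (Cf1, Cg1); split=> [x Ux|v].
  by apply: differentiableM; [exact: df|exact: dg].
have := CkD oU (IH _ _ (CkS Cf1) (Cg v)) (IH _ _ (CkS Cg1) (Cf v)).
apply: (Ck_ext oU) => x Ux.
by rewrite -(diffME v (df _ Ux) (dg _ Ux)).
Qed.

Lemma Ck_sum E k (U : set E) (I : Type) (r : seq I) (P : pred I) (f : I -> E -> R) :
  open U -> (forall i, P i -> Ck k U (f i)) ->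
  Ck k U (fun x => \sum_(i <- r | P i) f i x).
Proof.
move=> oU Cf; elim: r => [|i r IH].
  rewrite (_ : (fun x => _) = cst 0); first exact: Ck_cst.
  by apply/funext => x; rewrite big_nil.
rewrite (_ : (fun x => _) = fun x => (if P i then f i x else 0) + \sum_(i <- r | P i) f i x).
  by apply: CkD => //; have := Cf i; case: (P i) => [|_]; [exact|exact: Ck_cst].
by apply/funext => x; rewrite big_cons; case: ifP => // _; rewrite add0r.
Qed.

Lemma Ck_prod E k (U : set E) (I : Type) (r : seq I) (P : pred I) (f : I -> E -> R) :
  open U -> (forall i, P i -> Ck k U (f i)) ->
  Ck k U (fun x => \prod_(i <- r | P i) f i x).
Proof.
move=> oU Cf; elim: r => [|i r IH].
  rewrite (_ : (fun x => _) = cst 1); first exact: Ck_cst.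
  by apply/funext => x; rewrite big_nil.
rewrite (_ : (fun x => _) = fun x => (if P i then f i x else 1) * \prod_(i <- r | P i) f i x).
  by apply: CkM => //; have := Cf i; case: (P i) => [|_]; [exact|exact: Ck_cst].
by apply/funext => x; rewrite big_cons; case: ifP => // _; rewrite mul1r.
Qed.

Lemma Ck_lin E k (U : set E) (f : {linear E -> R}) :
  continuous f -> Ck k U f.
Proof.
move=> cf; case: k => [|k]; first by move=> x _; exact: cf.
split=> [x _|v]; first exact: linear_differentiable.
rewrite (_ : (fun x => _) = cst (f v)); first exact: Ck_cst.
by apply/funext => x; rewrite diff_lin.
Qed.

(** In [- f^-2 * 'd f] the factor [f^-1] is of order k by induction, and ['d f] is so by
    hypothesis. *)
Lemma CkV E k (U : set E) (f : E -> R) : open U ->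
  (forall x, U x -> f x != 0) -> Ck k U f -> Ck k U (fun x => (f x)^-1).
Proof.
move=> oU f0; elim: k => [|k IH].
  by move=> Cf x Ux; exact: (cvgV (f0 _ Ux) (Cf _ Ux)).
move=> Cf1; have [df Cf] := Cf1; split=> [x Ux|v].
  by apply: differentiableV; [exact: df|exact: f0].
have Ci := IH (CkS Cf1).
have := CkM oU (Ck_cst k U (-1)) (CkM oU (CkM oU Ci Ci) (Cf v)).
apply: (Ck_ext oU) => x Ux.
by rewrite [RHS](diffVE v (df _ Ux) (f0 _ Ux)) expr2 invfM mulN1r mulNr.
Qed.

Lemma differentiable_span E F m (b : 'I_m -> F) (g : 'I_m -> E -> R) (x : E) :
  (forall i, differentiable (g i) x) ->
  differentiable (fun x => \sum_i g i x *: b i) x /\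
  'd (fun x => \sum_i g i x *: b i) x = (fun v => \sum_i 'd (g i) x v *: b i) :> (E -> F).
Proof.
move=> dg.
(* Reindexing by an arbitrary c lets the induction on the number of terms remove the last one. *)
suff H n (c : 'I_n -> 'I_m) : is_diff x (fun x => \sum_(i < n) g (c i) x *: b (c i))
   (fun v => \sum_(i < n) 'd (g (c i)) x v *: b (c i)).
  by have [] := H m id.
elim: n c => [|n IH] c.
  have -> : (fun x => \sum_(i < 0) g (c i) x *: b (c i)) = cst 0.
    by apply/funext => y; rewrite big_ord0.
  have -> : (fun v => \sum_(i < 0) 'd (g (c i)) x v *: b (c i)) = 0.
    by apply/funext => y; rewrite big_ord0.
  exact: is_diff_cst.
pose c' (i : 'I_n) := c (widen_ord (leqnSn n) i); have {}IH := IH c'.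
have -> : (fun x => \sum_(i < n.+1) g (c i) x *: b (c i)) =
  (fun x => \sum_(i < n) g (c' i) x *: b (c' i)) +
  (fun x => g (c ord_max) x *: b (c ord_max)).
  by apply/funext => y; rewrite big_ord_recr.
have -> : (fun v => \sum_(i < n.+1) 'd (g (c i)) x v *: b (c i)) =
  (fun v => \sum_(i < n) 'd (g (c' i)) x v *: b (c' i)) +
  (fun v => 'd (g (c ord_max)) x v *: b (c ord_max)).
  by apply/funext => y; rewrite big_ord_recr.
apply: is_diffD; split; first exact: differentiableZl.
by rewrite diffZl.
Qed.

(* Both R and 'rV_m are spanned by a finite family, so this covers composition
   into either of them. *)
Lemma Ck_comp_span E F k m (b : 'I_m -> F) (g : 'I_m -> E -> R) (U : set E)
  (V : set F) (f : F -> R) : open U ->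
  (forall x, U x -> V (\sum_i g i x *: b i)) ->
  (forall i, Ck k U (g i)) -> Ck k V f ->
  Ck k U (fun x => f (\sum_i g i x *: b i)).
Proof.
move=> oU UV; elim: k f => [|k IH] f Cg Cf.
  move=> x Ux.
  apply: (@continuous_comp _ _ _ (fun x => \sum_i g i x *: b i) f); last exact/Cf/UV.
  apply: cvg_big => [|i _]; first exact: add_continuous.
  apply: cvgZr_tmp.
  exact: Cg.
have Cg' i : Ck k U (g i) by exact: CkS.
have dg i x : U x -> differentiable (g i) x by move: x; case: (Cg i).
have [df Cdf] := Cf.
have dG x (Ux : U x) := differentiable_span b (fun i => dg i x Ux).
split=> [x Ux|v].
  apply: (@differentiable_comp _ _ _ _ (fun x => \sum_i g i x *: b i) f).
    by have [] := dG _ Ux.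
  exact/df/UV.
have H i : Ck k U (fun x => 'd (g i) x v * 'd f (\sum_i g i x *: b i) (b i)).
  by apply: CkM => //; [case: (Cg i) => _; apply|exact: (IH (fun y => 'd f y (b i)) Cg' (Cdf _))].
have := @Ck_sum _ k U _ (index_enum 'I_m) xpredT _ oU (fun i _ => H i).
apply: (Ck_ext oU) => x Ux; have [dGx dGE] := dG x Ux.
pose G x := \sum_i g i x *: b i.
have dfG : 'd (f \o G) x v = 'd f (G x) ('d G x v).
  exact: (congr1 (fun h : E -> R => h v) (diff_comp dGx (df _ (UV _ Ux)))).
have dGv : 'd G x v = \sum_i 'd (g i) x v *: b i.
  exact: (congr1 (fun h : E -> F => h v) dGE).
rewrite [RHS]dfG dGv linear_sum.
apply: eq_bigr => i _; by rewrite linearZ.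
Qed.

Lemma Ck_local E k (U : set E) (f : E -> R) :
  (forall x, U x -> exists V, [/\ open V, V x & Ck k V f]) -> Ck k U f.
Proof.
elim: k f => [|k IH] f Uf.
  by move=> x /Uf[V [_ Vx Vf]]; exact: (Vf _ Vx).
split=> [x /Uf[V [_ Vx [df _]]]|v]; first exact: df.
by apply: IH => x /Uf[V [oV Vx [_ Cf]]]; exists V; split=> //; exact: Cf.
Qed.

Lemma smooth_onP E (U : set E) (f : E -> R) : open U ->
  smooth_on U f <-> forall x, U x -> smooth_at f x.
Proof.
move=> oU; split=> [Uf x Ux|Uf k]; first by exists U.
by apply: Ck_local => x /Uf[V [oV Vx Vf]]; exists V; split => //; exact: Vf.
Qed.

Lemma smooth_at_near E (f : E -> R) (x : E) :
  smooth_at f x -> \forall y \near x, smooth_at f y.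
Proof.
move=> [U [oU Ux Uf]]; near=> y; exists U; split=> //.
by near: y; exact: open_nbhs_nbhs.
Unshelve. all: by end_near. Qed.

(** Finitely many smooth germs live on a common open set; this transfers the closure properties of
    [Ck] to [smooth_at]. *)
Lemma smooth_at_open E (f : E -> R) (Q : set E) (x : E) :
  (\forall y \near x, Q y) ->
  (forall U, open U -> U `<=` Q -> smooth_on U f) -> smooth_at f x.
Proof.
move=> xQ Uf; have : nbhs x Q := xQ.
by rewrite nbhsE => -[U [oU Ux] UQ]; exists U; split=> //; exact: Uf.
Qed.

Lemma smooth_at_ext E (f g : E -> R) (x : E) :
  (\forall y \near x, f y = g y) -> smooth_at f x -> smooth_at g x.
Proof.
move=> fg /smooth_at_near sf; apply: (smooth_at_open (filterI fg sf)) => U oU UQ k.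
apply: (Ck_ext (f := f) oU) => [y /UQ[]//|].
by move: k; apply/smooth_onP => // y /UQ[].
Qed.

Lemma smooth_at_cst E (a : R) (x : E) : smooth_at (fun=> a) x.
Proof. by exists setT; split=> //; [exact: openT|move=> k; exact: Ck_cst]. Qed.

Lemma smooth_at_sum E (I : finType) (P : pred I) (f : I -> E -> R) x :
  (forall i, smooth_at (f i) x) -> smooth_at (fun y => \sum_(i | P i) f i y) x.
Proof.
move=> sf; have fnear : \forall y \near x, forall i, smooth_at (f i) y.
  by apply: filter_forall => i; exact: smooth_at_near.
apply: (smooth_at_open fnear) => U oU UQ k; apply: Ck_sum => // i _.
by move: k; apply/smooth_onP => // y /UQ.
Qed.

Lemma smooth_at_prod E (I : finType) (P : pred I) (f : I -> E -> R) x :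
  (forall i, smooth_at (f i) x) -> smooth_at (fun y => \prod_(i | P i) f i y) x.
Proof.
move=> sf; have fnear : \forall y \near x, forall i, smooth_at (f i) y.
  by apply: filter_forall => i; exact: smooth_at_near.
apply: (smooth_at_open fnear) => U oU UQ k; apply: Ck_prod => // i _.
by move: k; apply/smooth_onP => // y /UQ.
Qed.

Lemma smooth_atD E (f g : E -> R) x : smooth_at f x -> smooth_at g x ->
  smooth_at (fun y => f y + g y) x.
Proof.
move=> /smooth_at_near sf /smooth_at_near sg.
apply: (smooth_at_open (filterI sf sg)) => U oU UQ k; apply: CkD => //;
  by move: k; apply/smooth_onP => // y /UQ[].
Qed.

Lemma smooth_atM E (f g : E -> R) x : smooth_at f x -> smooth_at g x ->
  smooth_at (fun y => f y * g y) x.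
Proof.
move=> /smooth_at_near sf /smooth_at_near sg.
apply: (smooth_at_open (filterI sf sg)) => U oU UQ k; apply: CkM => //;
  by move: k; apply/smooth_onP => // y /UQ[].
Qed.

Lemma smooth_atN E (f : E -> R) x : smooth_at f x -> smooth_at (fun y => - f y) x.
Proof.
move=> /(smooth_atM (smooth_at_cst (-1) x)); apply: smooth_at_ext.
by apply: nearW => y; rewrite mulN1r.
Qed.

Lemma smooth_atB E (f g : E -> R) x : smooth_at f x -> smooth_at g x ->
  smooth_at (fun y => f y - g y) x.
Proof. by move=> sf sg; apply: smooth_atD => //; exact: smooth_atN. Qed.

Lemma smooth_at_differentiable E (f : E -> R) x :
  smooth_at f x -> differentiable f x.
Proof. by move=> [U [_ Ux /(_ 1%N)[df _]]]; exact: df. Qed.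

Lemma smooth_at_continuous E (f : E -> R) x : smooth_at f x -> {for x, continuous f}.
Proof. by move=> /smooth_at_differentiable/differentiable_continuous. Qed.

Lemma smooth_atV E (f : E -> R) x : f x != 0 -> smooth_at f x ->
  smooth_at (fun y => (f y)^-1) x.
Proof.
move=> f0 sf; have f0' : \forall y \near x, f y != 0.
  apply: (continuous_near (P := fun z => z != 0) (smooth_at_continuous sf)).
  by apply: open_nbhs_nbhs; split=> //; exact: open_neq.
apply: (smooth_at_open (filterI (smooth_at_near sf) f0')) => U oU UQ k.
by apply: CkV => // [y /UQ[]//|]; move: k; apply/smooth_onP => // y /UQ[].
Qed.

Lemma smooth_at_d E (f : E -> R) x v : smooth_at f x ->
  smooth_at (fun y => 'd f y v) x.
Proof. by move=> [U [oU Ux Uf]]; exists U; split=> // k; have [_ Cf] := Uf k.+1; exact: Cf. Qed.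

Lemma smooth_at_derive E (f : E -> R) x v : smooth_at f x ->
  smooth_at ('D_v f) x.
Proof.
move=> sf; apply: smooth_at_ext (smooth_at_d v sf).
near=> y; rewrite deriveE //; apply: smooth_at_differentiable.
by near: y; exact: smooth_at_near.
Unshelve. all: by end_near. Qed.

Lemma smooth_at_comp_span E F m (b : 'I_m -> F) (g : 'I_m -> E -> R) f x :
  (forall i, smooth_at (g i) x) -> smooth_at f (\sum_i g i x *: b i) ->
  smooth_at (fun y => f (\sum_i g i y *: b i)) x.
Proof.
move=> sg /smooth_at_near sf.
have gnear : \forall y \near x, forall i, smooth_at (g i) y.
  by apply: filter_forall => i; exact: smooth_at_near.
have fnear : \forall y \near x, smooth_at f (\sum_i g i y *: b i).
  exact: (continuous_near (differentiable_continuous (differentiable_span b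
    (fun i => smooth_at_differentiable (sg i))).1) sf).
apply: (smooth_at_open (filterI gnear fnear)) => U oU UQ k.
have [V VQ oV] : exists2 V : set F, (forall y, U y -> V (\sum_i g i y *: b i)) &
    open V /\ forall z, V z -> smooth_at f z.
  (* The locus where f is smooth is open, and is large enough to contain the image of U. *)
  exists [set z | smooth_at f z]; first by move=> y /UQ[].
  split=> //; rewrite openE => z; exact: smooth_at_near.
case: oV => oV Vf.
apply: (@Ck_comp_span _ _ k m b g U V f) => //.
  by move=> i; move: k; apply/smooth_onP => // y /UQ[].
by move: k; apply/smooth_onP.
Qed.

Lemma smooth_at_comp E (f : R -> R) (g : E -> R) x :
  smooth_at g x -> smooth_at f (g x) -> smooth_at (fun y => f (g y)) x.
Proof.
(* The line R is spanned by the single vector 1. *)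
have gE y : g y = \sum_(i < 1) g y *: 1 by rewrite big_ord1 [RHS]mulr1.
move=> sg; rewrite gE => sf.
have := @smooth_at_comp_span E R 1 (fun=> 1) (fun=> g) f x (fun=> sg) sf.
by apply: smooth_at_ext; apply: nearW => y; rewrite -gE.
Qed.

Lemma smooth_at_comp_row E m (f : 'rV[R]_m -> R) (g : E -> 'rV[R]_m) x :
  (forall i, smooth_at (fun y => g y 0 i) x) -> smooth_at f (g x) ->
  smooth_at (fun y => f (g y)) x.
Proof.
move=> sg; rewrite [g x]row_sum_delta => sf.
have := smooth_at_comp_span sg sf.
by apply: smooth_at_ext; apply: nearW => y; rewrite -row_sum_delta.
Qed.

Lemma differentiable_row E m (g : E -> 'rV[R]_m) x :
  (forall i, smooth_at (fun y => g y 0 i) x) -> differentiable g x.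
Proof.
move=> sg.
have gE : g = fun y => \sum_i g y 0 i *: delta_mx 0 i.
  by apply/funext => y; rewrite -row_sum_delta.
rewrite gE; exact: (differentiable_span (delta_mx 0)
  (fun i => smooth_at_differentiable (sg i))).1.
Qed.

Lemma smooth_at_coord m (i : 'I_m) (x : 'rV[R]_m) : smooth_at (fun v : 'rV[R]_m => v 0 i) x.
Proof.
pose f := (fun v : 'rV[R]_m => v 0 i).
have flin : linear f by move=> a u v; rewrite /f !mxE.
pose fL := HB.pack_for {linear 'rV[R]_m -> R} f (GRing.isLinear.Build _ _ _ _ f flin).
exists setT; split; [exact: openT|by []|move=> k].
by apply: (@Ck_lin _ k _ fL); exact: coord_continuous.
Qed.

Lemma smooth_at_id (x : R) : smooth_at (fun y => y) x.
Proof.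
exists setT; split; [exact: openT|by []|case=> [|k]].
  by move=> y _; exact: cvg_id.
have did (y : R) : is_diff y (@id R) id := is_diff_id y.
split=> [y _|v]; first by have [] := did y.
rewrite (_ : (fun y : R => _) = cst v); first exact: Ck_cst.
by apply/funext => y; have [_ /(congr1 (fun h => h v))] := did y.
Qed.

Lemma derive1_chain m (f : 'rV[R]_m -> R) (g : R -> 'rV[R]_m) t :
  (forall i, smooth_at (fun s => g s 0 i) t) -> smooth_at f (g t) ->
  derive1 (fun s => f (g s)) t =
  \sum_i 'd f (g t) (delta_mx 0 i) * derive1 (fun s => g s 0 i) t.
Proof.
move=> sg sf; have df := smooth_at_differentiable sf.
have dgi i := smooth_at_differentiable (sg i).
have dg := differentiable_row sg.
rewrite derive1E deriveE; last exact: differentiable_comp.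
rewrite (diff_comp dg df) /=.
have gE : g = fun y => \sum_i g y 0 i *: delta_mx 0 i.
  by apply/funext => y; rewrite -row_sum_delta.
have dgE : 'd g t 1 = \sum_i 'd (fun s => g s 0 i) t 1 *: delta_mx 0 i.
  rewrite {1}gE.
  exact: (congr1 (fun h => h (1 : R)) (differentiable_span (delta_mx 0) dgi).2).
rewrite dgE linear_sum; apply: eq_bigr => i _.
by rewrite linearZ /= mulrC derive1E deriveE.
Qed.

Lemma smooth_at_derivable (f : R -> R) t : smooth_at f t -> derivable f t 1.
Proof. by move=> /smooth_at_differentiable/derivable1_diffP. Qed.

End Calculus.

(** * Charts, curves and tangent vectors *)

Section GoodSpaces.
Variables (R : realType) (S : smooth_space R).
Notation n := (sdim S).
Implicit Types (k : chart R S n) (p : S) (f : S -> R) (c : R -> S).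

Definition proper_chart k := forall p, cdom k p -> cinv k (cmap k p) = p.

Definition overlap k k' := cmap k @` (cdom k `&` cdom k').

Definition chart_compat k k' := open (overlap k k') /\
  forall i z, overlap k k' z -> smooth_at (fun z => chart_coord k' i (cinv k z)) z.

(* The total spaces A, V, V^* carry no topology: the manifold structure is
   expressed through the coordinate images of overlaps only. *)
Record good_space : Prop := GoodSpace {
  good_cover : forall p, exists2 k, charts k & cdom k p;
  good_proper : forall k, charts k -> proper_chart k;
  good_compat : forall k k', charts k -> charts k' -> chart_compat k k' }.

(* Charts induced by local data need not belong to the atlas; smoothness and
   tangent vectors may be computed in any chart compatible with it. *)
Definition adm_chart k := proper_chart k /\
  forall k', charts k' -> chart_compat k k' /\ chart_compat k' k.

Lemma adm_charts : good_space -> forall k, charts k -> adm_chart k.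
Proof.
move=> gS k ck; split; first exact: good_proper.
by move=> k' ck'; split; exact: good_compat.
Qed.

Lemma overlapP k k' p : cdom k p -> cdom k' p -> overlap k k' (cmap k p).
Proof. by move=> kp k'p; exists p. Qed.

Lemma overlap_inv k k' z : proper_chart k -> overlap k k' z ->
  [/\ cdom k (cinv k z), cdom k' (cinv k z) & cmap k (cinv k z) = z].
Proof. by move=> pk [p [kp k'p] <-]; rewrite pk. Qed.

Lemma overlap_near k k' z : chart_compat k k' -> overlap k k' z ->
  \forall w \near z, overlap k k' w.
Proof. by move=> [ok _] kz; exact: open_nbhs_nbhs. Qed.

Lemma transition_smooth k k' p i : chart_compat k k' -> cdom k p -> cdom k' p ->
  smooth_at (fun z => cmap k' (cinv k z) 0 i) (cmap k p).
Proof. by move=> [_ sk] kp k'p; apply: sk; exact: overlapP. Qed.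

Lemma smooth_transfer k k' p f : proper_chart k -> proper_chart k' ->
  chart_compat k k' -> cdom k p -> cdom k' p ->
  smooth_at (fun z => f (cinv k' z)) (cmap k' p) ->
  smooth_at (fun z => f (cinv k z)) (cmap k p).
Proof.
move=> pk pk' kk' kp k'p sf.
have := @smooth_at_comp_row R _ _ (fun z => f (cinv k' z))
  (fun z => cmap k' (cinv k z)) (cmap k p)
  (fun i => transition_smooth i kk' kp k'p).
rewrite pk // => /(_ sf); apply: smooth_at_ext.
have := overlap_near kk' (overlapP kp k'p); apply: filterS => z /(overlap_inv pk)[_ ? _].
by rewrite pk'.
Qed.

(** Continuity of c is only available in the coordinates of k; the openness of the overlap in these
    coordinates keeps c in the domain of k'. *)
Lemma curve_transfer k k' c t : proper_chart k -> proper_chart k' ->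
  chart_compat k k' -> cdom k (c t) -> cdom k' (c t) ->
  (\forall s \near t, cdom k (c s)) ->
  (forall i, smooth_at (fun s : R => chart_coord k i (c s)) t) ->
  (\forall s \near t, cdom k' (c s)) /\
  (forall i, smooth_at (fun s : R => chart_coord k' i (c s)) t).
Proof.
move=> pk pk' kk' kt k't kc sc.
have cc : {for t, continuous (fun s : R => cmap k (c s))}.
  by apply: differentiable_continuous; apply: differentiable_row => i; exact: sc.
have ov := continuous_near cc (overlap_near kk' (overlapP kt k't)).
have k'c : \forall s \near t, cdom k' (c s).
  apply: filterS2 kc ov => s ks /(overlap_inv pk)[_ + _].
  by rewrite pk.
split=> // i.
have := @smooth_at_comp_row R _ _ (fun z => chart_coord k' i (cinv k z))
  (fun s => cmap k (c s)) t sc (transition_smooth i kk' kt k't).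
by apply: smooth_at_ext; apply: filterS kc => s ks; rewrite pk.
Qed.

Hypothesis gS : good_space.

(** One chart suffices, even one outside the atlas: smoothness passes from it to an atlas chart and
    back through smooth transition maps. *)
Lemma smooth_near_chart k p f : adm_chart k -> cdom k p ->
  smooth_near f p <-> smooth_at (fun z => f (cinv k z)) (cmap k p).
Proof.
move=> [pk ak] kp; split=> [sf|sf k' ck' k'p].
  have [k' ck' k'p] := good_cover gS p.
  have [kk' k'k] := ak _ ck'.
  apply: (@smooth_transfer k k') => //; last exact: sf.
  exact: good_proper ck'.
have [kk' k'k] := ak _ ck'.
apply: (@smooth_transfer k' k) => //; exact: good_proper ck'.
Qed.

Lemma smooth_curve_chart k c t : adm_chart k -> cdom k (c t) ->
  smooth_curve_at c t <-> (\forall s \near t, cdom k (c s)) /\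
  (forall i, smooth_at (fun s : R => chart_coord k i (c s)) t).
Proof.
move=> [pk ak] kp; split=> [sf|[kc sc] k' ck' k'p].
  have [k' ck' k'p] := good_cover gS (c t).
  have [kk' k'k] := ak _ ck'; have [k'c k's] := sf _ ck' k'p.
  by apply: (@curve_transfer k' k) => //; exact: good_proper ck'.
have [kk' k'k] := ak _ ck'.
by apply: (@curve_transfer k k') => //; exact: good_proper ck'.
Qed.

Lemma smooth_near_coord k p i : adm_chart k -> cdom k p ->
  smooth_near (chart_coord k i) p.
Proof.
by move=> [pk ak] kp k' ck' k'p; have [_ k'k] := ak _ ck'; exact: transition_smooth.
Qed.

Lemma smooth_near_curve c t f : smooth_curve_at c t -> smooth_near f (c t) ->
  smooth_at (fun s => f (c s)) t.
Proof.
move=> sc sf; have [k ck kp] := good_cover gS (c t).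
have [kc sk] := sc _ ck kp; have pk := good_proper gS ck.
have := @smooth_at_comp_row R _ _ (fun z => f (cinv k z))
  (fun s => cmap k (c s)) t sk (sf _ ck kp).
by apply: smooth_at_ext; apply: filterS kc => s ks; rewrite pk.
Qed.

Lemma velocityE c t f : smooth_near f (c t) ->
  velocity c t f = derive1 (fun s => f (c s)) t.
Proof. by move=> sf; rewrite /velocity asboolT. Qed.

(** A [tangent] is bundled and based at time 0; the predicate allows any time, so that it also
    covers velocities along a curve and images under [push]. *)
Definition is_tangent p (X : (S -> R) -> R) :=
  exists c t, [/\ smooth_curve_at c t, c t = p & X = velocity c t].

Lemma is_tangent_velocity c t : smooth_curve_at c t -> is_tangent (c t) (velocity c t).
Proof. by exists c, t. Qed.

Lemma is_tangent_tangent p (X : tangent p) : is_tangent p X.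
Proof. by case: X => X [c [? ? ?]]; exists c, 0. Qed.

Lemma is_tangent0 p X f : is_tangent p X -> ~ smooth_near f p -> X f = 0.
Proof. by move=> [c [t [_ <- ->]]] nf; rewrite /velocity asboolF. Qed.

Definition partial k f i p := 'd (fun z => f (cinv k z)) (cmap k p) (delta_mx 0 i).

Lemma is_tangent_coord k p X f : adm_chart k -> cdom k p -> is_tangent p X ->
  smooth_near f p ->
  X f = \sum_i partial k f i p * X (chart_coord k i).
Proof.
move=> ak kp [c [t [sc cp ->]]] sf; subst p.
have [kc sk] := (smooth_curve_chart ak kp).1 sc.
rewrite velocityE //.
transitivity (derive1 (fun s => f (cinv k (cmap k (c s)))) t).
  rewrite !derive1E; apply: near_eq_derive; apply: filterS kc => s ks.
  by rewrite ak.1.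
rewrite (@derive1_chain R _ (fun z => f (cinv k z)) (fun s => cmap k (c s))) //.
  by apply: eq_bigr => i _; rewrite velocityE //; exact: smooth_near_coord.
exact/smooth_near_chart.
Qed.

(** On functions smooth near p the chain rule leaves only the coordinates; on the others both sides
    are 0 by the normal form of velocities. *)
Lemma is_tangent_ext k p X Y : adm_chart k -> cdom k p ->
  is_tangent p X -> is_tangent p Y ->
  (forall i, X (chart_coord k i) = Y (chart_coord k i)) -> X = Y.
Proof.
move=> ak kp tX tY XY; apply/funext => f.
have [sf|nf] := pselect (smooth_near f p); last by rewrite !(@is_tangent0 p).
rewrite (is_tangent_coord ak kp tX sf) (is_tangent_coord ak kp tY sf).
by apply: eq_bigr => i _; rewrite XY.
Qed.

Lemma coord_curve k p (z : R -> 'rV[R]_n) : adm_chart k -> cdom k p ->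
  (forall i, smooth_at (fun s => z s 0 i) 0) -> z 0 = cmap k p ->
  let c := fun s => cinv k (z s) in
  [/\ smooth_curve_at c 0, c 0 = p &
      \forall s \near 0, cdom k (c s) /\ cmap k (c s) = z s].
Proof.
move=> ak kp sz z0 c; have c0 : c 0 = p by rewrite /c z0 ak.1.
(* The image of [cdom k] is not assumed open; its overlap with an atlas chart is an open part of it
   around [cmap k p]. *)
have [k' ck' k'p] := good_cover gS p.
have ov := overlap_near (ak.2 _ ck').1 (overlapP kp k'p).
have cz : {for 0, continuous z}.
  by apply: differentiable_continuous; apply: differentiable_row.
have near0 : \forall s \near (0 : R), cdom k (c s) /\ cmap k (c s) = z s.
  rewrite -z0 in ov; have := continuous_near cz ov.
  by apply: filterS => s /(overlap_inv ak.1)[].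
split=> //; apply/(smooth_curve_chart ak); first by rewrite c0.
split; first by apply: filterS near0 => s [].
move=> i; apply: smooth_at_ext (sz i); apply: filterS near0 => s [_].
by rewrite /chart_coord => ->.
Qed.

Lemma coord_curve_velocity k p (z : R -> 'rV[R]_n) i : adm_chart k -> cdom k p ->
  (forall i, smooth_at (fun s => z s 0 i) 0) -> z 0 = cmap k p ->
  velocity (fun s => cinv k (z s) : S) 0 (chart_coord k i) =
  derive1 (fun s => z s 0 i) 0.
Proof.
move=> ak kp sz z0; have [sc c0 near0] := coord_curve ak kp sz z0.
rewrite velocityE; last by apply: smooth_near_coord => //; rewrite c0.
rewrite !derive1E; apply: near_eq_derive; apply: filterS near0 => s [_].
by rewrite /chart_coord => ->.
Qed.

Definition line_coord k p (v : 'rV[R]_n) : R -> 'rV[R]_n := fun s => cmap k p + s *: v.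

Lemma line_coord_smooth k p v i t : smooth_at (fun s => line_coord k p v s 0 i) t.
Proof.
under eq_fun do rewrite /line_coord !mxE.
apply: smooth_atD; first exact: smooth_at_cst.
by apply: smooth_atM; [exact: smooth_at_id|exact: smooth_at_cst].
Qed.

Lemma line_coord_derive k p v i t :
  derive1 (fun s => line_coord k p v s 0 i) t = v 0 i.
Proof.
under eq_fun do rewrite /line_coord !mxE.
rewrite derive1E deriveD // ?derive_cst ?add0r.
rewrite deriveM // derive_cst scaler0 add0r derive_id.
exact: mulr1.
Qed.

(** The vector is the velocity of the straight line in direction v in the coordinates of k. *)
Lemma tangent_exists k p (v : 'rV[R]_n) : adm_chart k -> cdom k p ->
  exists X : tangent p, forall i, X (chart_coord k i) = v 0 i.
Proof.
move=> ak kp; set z := line_coord k p v.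
have sz i : smooth_at (fun s => z s 0 i) 0 by exact: line_coord_smooth.
have z0 : z 0 = cmap k p by rewrite /z /line_coord scale0r addr0.
have [sc c0 _] := coord_curve ak kp sz z0.
have tX : exists c : R -> S, [/\ smooth_curve_at c 0, c 0 = p &
  velocity (fun s => cinv k (z s) : S) 0 = velocity c 0].
  by exists (fun s => cinv k (z s)).
exists (Tangent tX) => i /=.
by rewrite (coord_curve_velocity i ak kp sz z0) line_coord_derive.
Qed.

Lemma tangent_eq p (X Y : tangent p) : tan_fun X = tan_fun Y -> X = Y.
Proof.
case: X Y => [X hX] [Y hY] /= XY; subst Y; congr Tangent; exact: Prop_irrelevance.
Qed.

Lemma smooth_nearD f g p : smooth_near f p -> smooth_near g p ->
  smooth_near (fun q => f q + g q) p.
Proof. by move=> sf sg k ck kp; apply: smooth_atD; [exact: sf|exact: sg]. Qed.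

Lemma smooth_nearM f g p : smooth_near f p -> smooth_near g p ->
  smooth_near (fun q => f q * g q) p.
Proof. by move=> sf sg k ck kp; apply: smooth_atM; [exact: sf|exact: sg]. Qed.

Lemma smooth_near_cst a p : smooth_near (fun=> a : R) p.
Proof. by move=> k ck kp; exact: smooth_at_cst. Qed.

Lemma smooth_nearN f p : smooth_near f p -> smooth_near (fun q => - f q) p.
Proof. by move=> sf k ck kp; apply: smooth_atN; exact: sf. Qed.

Lemma smooth_nearB f g p : smooth_near f p -> smooth_near g p ->
  smooth_near (fun q => f q - g q) p.
Proof. by move=> sf sg k ck kp; apply: smooth_atB; [exact: sf|exact: sg]. Qed.

Lemma smooth_nearV f p : f p != 0 -> smooth_near f p ->
  smooth_near (fun q => (f q)^-1) p.
Proof.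
move=> f0 sf k ck kp; apply: smooth_atV; last exact: sf.
by rewrite (good_proper gS ck kp).
Qed.

Lemma smooth_near_sum (I : finType) (P : pred I) (f : I -> S -> R) p :
  (forall i, smooth_near (f i) p) -> smooth_near (fun q => \sum_(i | P i) f i q) p.
Proof. by move=> sf k ck kp; apply: smooth_at_sum => i; exact: sf. Qed.

Lemma smooth_near_prod (I : finType) (P : pred I) (f : I -> S -> R) p :
  (forall i, smooth_near (f i) p) -> smooth_near (fun q => \prod_(i | P i) f i q) p.
Proof. by move=> sf k ck kp; apply: smooth_at_prod => i; exact: sf. Qed.

Lemma is_tangentD p X f g : is_tangent p X -> smooth_near f p -> smooth_near g p ->
  X (fun q => f q + g q) = X f + X g.
Proof.
move=> [c [t [sc <- ->]]] sf sg; rewrite !velocityE //; last exact: smooth_nearD.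
rewrite !derive1E deriveD //; apply: smooth_at_derivable; exact: smooth_near_curve.
Qed.

Lemma is_tangentM p X f g : is_tangent p X -> smooth_near f p -> smooth_near g p ->
  X (fun q => f q * g q) = X f * g p + f p * X g.
Proof.
move=> [c [t [sc <- ->]]] sf sg; rewrite !velocityE //; last exact: smooth_nearM.
rewrite !derive1E deriveM; last 2 first.
- by apply: smooth_at_derivable; exact: smooth_near_curve.
- by apply: smooth_at_derivable; exact: smooth_near_curve.
by rewrite addrC /GRing.scale /= [g _ * _]mulrC.
Qed.

Lemma is_tangent_cst p X a : is_tangent p X -> X (fun=> a) = 0.
Proof.
move=> [c [t [_ _ ->]]]; rewrite velocityE; last exact: smooth_near_cst.
exact: derive1_cst.
Qed.

Lemma is_tangent_sum p X (I : finType) (f : I -> S -> R) : is_tangent p X ->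
  (forall i, smooth_near (f i) p) ->
  X (fun q => \sum_i f i q) = \sum_i X (f i).
Proof.
move=> tX sf.
suff H (r : seq I) : smooth_near (fun q => \sum_(i <- r) f i q) p /\
    X (fun q => \sum_(i <- r) f i q) = \sum_(i <- r) X (f i).
  by have [_ ->] := H (index_enum I).
elim: r => [|i r [sr IH]].
  split; last by rewrite big_nil; under eq_fun do rewrite big_nil; exact: is_tangent_cst tX.
  by under eq_fun do rewrite big_nil; exact: smooth_near_cst.
have -> : (fun q => \sum_(j <- i :: r) f j q) =
    (fun q => f i q + \sum_(j <- r) f j q).
  by apply/funext => q; rewrite big_cons.
by split; [exact: smooth_nearD|rewrite (is_tangentD tX) // IH big_cons].
Qed.

End GoodSpaces.

Arguments smooth_near_chart {R S} gS {k p} f.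
Arguments smooth_curve_chart {R S} gS {k} c {t}.

(** * Germs and curves on the base manifold *)

Section ManifoldTopology.
Variables (R : realType) (M : manifold R).
Implicit Types (x : mtop M) (f g : M -> R).

(** The openness of overlaps comes from the topology of M: chart images and domains are open, and
    [cinv] is continuous on the image. *)
Lemma good_manifold : good_space M.
Proof.
split; [exact: matlas_cover|by move=> k ck p; exact: matlas_inv|move=> k k' ck ck'].
have oov : open (overlap (S := M) k k').
  rewrite openE => z [x [kx k'x] <-].
  have imk : \forall w \near cmap k x, (cmap k @` cdom k) w.
    by apply: open_nbhs_nbhs; split; [exact: matlas_img|exists x].
  have domk' : \forall w \near cmap k x, cdom k' (cinv k w).
    apply: (continuous_near (matlas_cinv ck kx)).
    by rewrite (matlas_inv ck kx); apply: open_nbhs_nbhs; split => //; exact: matlas_dom.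
  apply: filterS2 imk domk' => _ [q kq <-]; rewrite (matlas_inv ck kq) => k'q.
  by exists q.
split=> // i z kz; have := matlas_compat ck ck' i.
by rewrite smooth_onP //; apply.
Qed.

Lemma matlas_adm k : @matlas R M k -> adm_chart (S := M) k.
Proof. exact: (adm_charts good_manifold). Qed.

Lemma smooth_curve_near (c : R -> M) t (P : M -> Prop) : smooth_curve_at c t ->
  (\forall x \near (c t : mtop M), P x) -> \forall s \near t, P (c s).
Proof.
move=> sc nP; have [k ck kp] := matlas_cover (c t).
have [kc sk] := sc _ ck kp.
have cc : {for t, continuous (fun s : R => cmap k (c s))}.
  by apply: differentiable_continuous; apply: differentiable_row => i; exact: sk.
have : \forall z \near cmap k (c t), P (cinv k z).
  by apply: (continuous_near (matlas_cinv ck kp)); rewrite (matlas_inv ck kp).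
move=> /(continuous_near cc) nP'; apply: filterS2 kc nP' => s ks.
by rewrite (matlas_inv ck ks).
Qed.

Lemma smooth_near_ext f g x : (\forall y \near x, f y = g y) ->
  smooth_near f x -> smooth_near g x.
Proof.
move=> fg sf k ck kx; apply: smooth_at_ext (sf _ ck kx).
apply: (continuous_near (P := fun y => f y = g y) (matlas_cinv ck kx)).
by rewrite (matlas_inv ck kx).
Qed.

Lemma is_tangent_near_eq f g x X : is_tangent (S := M) x X ->
  smooth_near f x -> (\forall y \near x, f y = g y) -> X f = X g.
Proof.
move=> [c [t [sc cx ->]]] sf fg; subst x.
rewrite !velocityE //; last exact: smooth_near_ext sf.
rewrite !derive1E; apply: near_eq_derive.
exact: (smooth_curve_near (P := fun y => f y = g y) sc).
Qed.

End ManifoldTopology.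

(** * Projection of block coordinates onto the base coordinates *)

Section BlockSmooth.
Variables (R : realType) (m r : nat).

Lemma smooth_at_lsubmx (f : 'rV[R]_m -> R) (z : 'rV[R]_(m + r)) :
  smooth_at f (lsubmx z) -> smooth_at (fun z => f (lsubmx z)) z.
Proof.
move=> sf; apply: smooth_at_comp_row => // i.
under eq_fun do rewrite mxE; exact: smooth_at_coord.
Qed.

Lemma lsubmx_continuous (z : 'rV[R]_(m + r)) : {for z, continuous (@lsubmx R 1 m r)}.
Proof.
apply: differentiable_continuous; apply: differentiable_row => i.
under eq_fun do rewrite mxE; exact: smooth_at_coord.
Qed.

End BlockSmooth.

(** * Total spaces described by local trivializations over M *)

Section FibreSpaces.
Variables (R : realType) (M : manifold R) (B : M -> Type) (r : nat).
Notation m := (mdim M).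

(* totA, totV and totVd are all convertible to instances of the spaces built
   here from such trivializations. *)
Record triv := Triv {
  tdom : set M;
  tco : forall x, B x -> 'rV[R]_r;
  tin : forall x, 'rV[R]_r -> B x }.

Definition bchart (k : chart R M m) (e : triv) : chart R {x : M & B x} (m + r) :=
  Chart [set b | cdom k (tag b) /\ tdom e (tag b)]
    (fun b => row_mx (cmap k (tag b)) (tco e (tagged b)))
    (fun z => let x := cinv k (lsubmx z) in Tagged B (tin e x (rsubmx z))).

Definition proper_triv (e : triv) := [/\ @open (mtop M) (tdom e),
  (forall x, tdom e x -> cancel (@tco e x) (@tin e x)) &
  (forall x, tdom e x -> cancel (@tin e x) (@tco e x))].

(** One notion serves A, V and V^*: [T] is the change of basis and [tau] the displacement of the
    origin, which is 0 for the two vector bundles. *)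
Definition affine_transition (e e' : triv) := forall x, tdom e x -> tdom e' x ->
  exists (tau : 'I_r -> M -> R) (T : 'I_r -> 'I_r -> M -> R),
  [/\ (forall i, smooth_near (tau i) x), (forall i j, smooth_near (T i j) x) &
    \forall x' \near (x : mtop M), forall y i,
      tco e' (tin e x' y) 0 i = tau i x' + \sum_j T i j x' * y 0 j].

Lemma bchart_proper k e : @matlas R M k -> proper_triv e ->
  forall b, cdom (bchart k e) b -> cinv (bchart k e) (cmap (bchart k e) b) = b.
Proof.
move=> ck [_ eK _] [x b] [/= kx ex].
by rewrite row_mxKl row_mxKr (matlas_inv ck kx) /= eK.
Qed.

Lemma cmap_bchart k e z : @matlas R M k -> proper_triv e ->
  (cmap k @` cdom k) (lsubmx z) -> tdom e (cinv k (lsubmx z)) ->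
  cmap (bchart k e) (cinv (bchart k e) z) = z.
Proof.
move=> ck [_ _ eK] [x kx xz] ez; rewrite /= eK //.
by rewrite -{1}xz (matlas_inv ck kx) xz hsubmxK.
Qed.

(** A property valid near a base point thus holds near the coordinates of every point of the fibre
    above it; this is how neighbourhoods in M are used on the total space. *)
Lemma bchart_base_near k x (P : M -> Prop) z : @matlas R M k -> cdom k x ->
  lsubmx z = cmap k x -> (\forall y \near (x : mtop M), P y) ->
  \forall w \near (z : 'rV[R]_(m + r)),
     (cmap k @` cdom k) (lsubmx w) /\ P (cinv k (lsubmx w)).
Proof.
move=> ck kx zx nP.
have := @continuous_near _ _ _ _ (fun v => (cmap k @` cdom k) v /\ P (cinv k v))
  (@lsubmx_continuous R m r z).
apply; rewrite zx; apply: filterI.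
  by apply: open_nbhs_nbhs; split; [exact: matlas_img|exists x].
by apply: (continuous_near (matlas_cinv ck kx)); rewrite (matlas_inv ck kx).
Qed.

Lemma smooth_at_base k x z f : @matlas R M k -> cdom k x -> lsubmx z = cmap k x ->
  smooth_near (S := M) f x ->
  smooth_at (fun w : 'rV[R]_(m + r) => f (cinv k (lsubmx w))) z.
Proof.
move=> ck kx zx sf.
by apply: (smooth_at_lsubmx (f := fun v => f (cinv k v))); rewrite zx; exact: sf.
Qed.

Variables (F : Type) (TT : set F) (tv : F -> triv).

Definition bspace : smooth_space R :=
  SmoothSpace [set c | exists k e, [/\ @matlas R M k, TT e & c = bchart k (tv e)]].

(** The base coordinates change as on M, and the fibre coordinates change affinely with coefficients
    smooth on the base. *)
Lemma bchart_compat k k' e e' : @matlas R M k -> @matlas R M k' ->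
  proper_triv e -> proper_triv e' -> affine_transition e e' ->
  chart_compat (S := bspace) (bchart k e) (bchart k' e').
Proof.
move=> ck ck' pe pe' ee'.
have [oe eK eK'] := pe; have [oe' _ _] := pe'.
have near_dom x : cdom k x -> cdom k' x -> tdom e x -> tdom e' x ->
    \forall y \near (x : mtop M), [/\ cdom k' y, tdom e y & tdom e' y].
  move=> kx k'x ex e'x; near=> y; split; near: y.
  - by apply: open_nbhs_nbhs; split=> //; exact: matlas_dom.
  - exact: open_nbhs_nbhs.
  - exact: open_nbhs_nbhs.
split.
  rewrite openE => _ [[x b] [[/= kx ex] [/= k'x e'x]] <-].
  have := bchart_base_near ck kx (row_mxKl _ (tco e b)) (near_dom _ kx k'x ex e'x).
  rewrite /interior; apply: filterS => w [imw [k'w ew e'w]].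
  exists (cinv (bchart k e) w); last by rewrite cmap_bchart.
  by split; split=> //=; case: imw => q kq <-; rewrite (matlas_inv ck kq).
move=> i _ [[x b] [[/= kx ex] [/= k'x e'x]] <-].
have zx := row_mxKl (cmap k x) (tco e b).
rewrite /chart_coord; case: (splitP i) => j ij.
  have -> : i = lshift r j by exact/val_inj.
  under eq_fun do rewrite /= row_mxEl.
  apply: (@smooth_at_base k x _ (fun y => cmap k' y 0 j)) => //.
  exact: (@smooth_near_coord R M k' x j (matlas_adm ck') k'x).
have -> : i = rshift m j by exact/val_inj.
under eq_fun do rewrite /= row_mxEr.
have [tau [T [stau sT near_tau]]] := ee' _ ex e'x.
apply: (@smooth_at_ext _ _ (fun w => tau j (cinv k (lsubmx w)) +
   \sum_i T j i (cinv k (lsubmx w)) * w 0 (rshift m i))).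
  have := bchart_base_near ck kx zx near_tau; apply: filterS => w [_ ->].
  by congr (_ + _); apply: eq_bigr => i' _; rewrite mxE.
apply: smooth_atD; first exact: (smooth_at_base ck kx).
apply: smooth_at_sum => i'; apply: smooth_atM; first exact: (smooth_at_base ck kx).
exact: smooth_at_coord.
Unshelve. all: by end_near. Qed.

Hypothesis TT_cover : forall x, exists2 e, TT e & tdom (tv e) x.
Hypothesis TT_proper : forall e, TT e -> proper_triv (tv e).
Hypothesis TT_affine : forall e e', TT e -> TT e' -> affine_transition (tv e) (tv e').

Lemma good_bspace : good_space bspace.
Proof.
split.
- move=> [x b]; have [k ck kx] := matlas_cover x; have [e ee ex] := TT_cover x.
  by exists (bchart k (tv e)) => //; exists k, e.
- by move=> _ [k [e [ck ee ->]]]; apply: bchart_proper => //; exact: TT_proper.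
- move=> _ _ [k [e [ck ee ->]]] [k' [e' [ck' ee' ->]]].
  by apply: bchart_compat => //; [exact: TT_proper|exact: TT_proper|exact: TT_affine].
Qed.

Definition adm_triv e := proper_triv e /\
  forall e', TT e' -> affine_transition e (tv e') /\ affine_transition (tv e') e.

Lemma adm_bchart k e : @matlas R M k -> adm_triv e ->
  adm_chart (S := bspace) (bchart k e).
Proof.
move=> ck [pe ae]; split; first exact: bchart_proper.
move=> _ [k' [e' [ck' ee' ->]]]; have [ee1 ee2] := ae _ ee'.
by split; apply: bchart_compat => //; exact: TT_proper.
Qed.

Lemma bchart_lcoord k e i (b : bspace) :
  chart_coord (bchart k e) (lshift r i) b = chart_coord k i (tag b).
Proof. by rewrite /chart_coord /= row_mxEl. Qed.

Lemma bchart_rcoord k e i (b : bspace) :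
  chart_coord (bchart k e) (rshift m i) b = tco e (tagged b) 0 i.
Proof. by rewrite /chart_coord /= row_mxEr. Qed.

Lemma smooth_near_tag f (b : bspace) : smooth_near (S := M) f (tag b) ->
  smooth_near (S := bspace) (fun q => f (tag q)) b.
Proof.
move=> sf _ [k [e [ck ee ->]]] [kb eb].
by apply: (smooth_at_base ck kb) => //=; rewrite row_mxKl.
Qed.

Lemma smooth_curve_tag (c : R -> bspace) t : smooth_curve_at c t ->
  smooth_curve_at (S := M) (fun s => tag (c s)) t.
Proof.
move=> sc; have [e ee et] := TT_cover (tag (c t)).
move=> k ck kt; have [kc sk] := sc _ (ex_intro _ k (ex_intro _ e (And3 ck ee erefl))) (conj kt et).
split; first by apply: filterS kc => s [].
by move=> i; have := sk (lshift r i); under eq_fun do rewrite bchart_lcoord.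
Qed.

(** The projection of a velocity is the velocity of the projected curve, and [push] and [velocity]
    share the convention of being 0 on non-smooth functions. *)
Lemma is_tangent_push_tag (b : bspace) (X : tangent b) :
  is_tangent (S := M) (tag b) (push (fun q : bspace => tag q : M) X).
Proof.
case: X => X [c [sc c0 XE]]; subst b.
exists (fun s => tag (c s)), 0; split=> //; first exact: smooth_curve_tag.
apply/funext => f; rewrite /push /velocity /= XE.
case: ifPn => // /asboolP sf; rewrite velocityE //; exact: smooth_near_tag.
Qed.

Lemma push_tagE (b : bspace) (X : tangent b) f : smooth_near (S := M) f (tag b) ->
  push (fun q : bspace => tag q : M) X f = X (fun q => f (tag q)).
Proof. by move=> sf; rewrite /push asboolT. Qed.

(** Agreement on whole fibres over a neighbourhood of the base point replaces agreement of germs on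
    a space without topology. *)
Lemma smooth_near_fext (f g : bspace -> R) b :
  (\forall x \near (tag b : mtop M), forall u : B x, f (Tagged B u) = g (Tagged B u)) ->
  smooth_near f b -> smooth_near g b.
Proof.
move=> fg sf _ [k [e [ck ee ->]]] [kb eb].
have := sf _ (ex_intro _ k (ex_intro _ e (And3 ck ee erefl))) (conj kb eb).
apply: smooth_at_ext.
have := bchart_base_near ck kb (row_mxKl _ (tco (tv e) (tagged b))) fg.
by apply: filterS => w [_ /= ->].
Qed.

Lemma is_tangent_fext (f g : bspace -> R) b X : is_tangent b X -> smooth_near f b ->
  (\forall x \near (tag b : mtop M), forall u : B x, f (Tagged B u) = g (Tagged B u)) ->
  X f = X g.
Proof.
move=> [c [t [sc cb ->]]] sf fg; subst b.
rewrite !velocityE //; last exact: smooth_near_fext sf.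
rewrite !derive1E; apply: near_eq_derive.
have := smooth_curve_near (smooth_curve_tag sc) fg.
by apply: filterS => s; case: (c s) => x u; apply.
Qed.

Lemma smooth_near_tco e i (b : bspace) : adm_triv e -> tdom e (tag b) ->
  smooth_near (fun q : bspace => tco e (tagged q) 0 i) b.
Proof.
move=> ae eb; have [k ck kb] := matlas_cover (tag b).
have := @smooth_near_coord R bspace _ b (rshift m i) (adm_bchart ck ae) (conj kb eb).
by rewrite (_ : chart_coord _ _ = fun q : bspace => tco e (tagged q) 0 i) //;
  apply/funext => q; rewrite bchart_rcoord.
Qed.

(** In coordinates the section is the graph map z |-> (z, components of s), with which f is
    composed. *)
Lemma smooth_near_section (f : bspace -> R) e (s : forall x, B x) x :
  adm_triv e -> tdom e x ->
  (forall i, smooth_near (S := M) (fun x' => tco e (s x') 0 i) x) ->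
  smooth_near f (Tagged B (s x)) ->
  smooth_near (S := M) (fun x' => f (Tagged B (s x'))) x.
Proof.
move=> ae ex ss sf k ck kx.
have [[oe eK _] _] := ae.
have := (smooth_near_chart good_bspace f (adm_bchart ck ae)
  (conj kx ex : cdom (bchart k e) (Tagged B (s x)))).1 sf.
pose g z := row_mx z (tco e (s (cinv k z))) : 'rV[R]_(m + r).
have gx : cmap (bchart k e) (Tagged B (s x)) = g (cmap k x).
  by rewrite /g /= (matlas_inv ck kx).
rewrite gx => sfg.
have := @smooth_at_comp_row R _ _ (fun z => f (cinv (bchart k e) z)) g (cmap k x) _ sfg.
have sg i : smooth_at (fun z => g z 0 i) (cmap k x).
  rewrite /g; case: (splitP i) => j ij.
    have -> : i = lshift r j by exact/val_inj.
    by under eq_fun do rewrite row_mxEl; exact: smooth_at_coord.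
  have -> : i = rshift m j by exact/val_inj.
  by under eq_fun do rewrite row_mxEr; exact: ss.
move=> /(_ sg); apply: smooth_at_ext.
have : \forall z \near cmap k x, tdom e (cinv k z).
  apply: (continuous_near (matlas_cinv ck kx)).
  by rewrite (matlas_inv ck kx); exact: open_nbhs_nbhs.
by apply: filterS => z ez; rewrite /= /g row_mxKl row_mxKr eK.
Qed.

Lemma smooth_curve_fibre k e (c : R -> bspace) t : @matlas R M k -> adm_triv e ->
  cdom k (tag (c t)) -> tdom e (tag (c t)) ->
  smooth_curve_at c t <->
  smooth_curve_at (S := M) (fun s => tag (c s)) t /\
  forall i, smooth_at (fun s => tco e (tagged (c s)) 0 i) t.
Proof.
move=> ck ae kt et.
have cE := smooth_curve_chart good_bspace c (adm_bchart ck ae)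
  (conj kt et : cdom (bchart k e) (c t)).
split=> [sc|[sc st]].
  split=> [|i]; first exact: smooth_curve_tag.
  by have := (cE.1 sc).2 (rshift m i); under eq_fun do rewrite bchart_rcoord.
apply/cE; have [kc sk] := sc _ ck kt.
have ec : \forall s \near t, tdom e (tag (c s)).
  by apply: (smooth_curve_near sc); have [[oe _ _] _] := ae; exact: open_nbhs_nbhs.
split; first exact: filterS2 kc ec.
move=> i; case: (splitP i) => j ij.
  have -> : i = lshift r j by exact/val_inj.
  by under eq_fun do rewrite bchart_lcoord.
have -> : i = rshift m j by exact/val_inj.
by under eq_fun do rewrite bchart_rcoord.
Qed.

End FibreSpaces.

(** * The bundles A, V and V^* *)

Lemma scalar_ext (R : comNzRingType) (V : lmodType R) (f g : {scalar V}) :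
  f =1 g -> f = g.
Proof.
move: f g => [f [[fa] [fs]]] [g [[ga] [gs]]] /= fg.
have {}fg : f = g by exact/funext.
subst g; by rewrite (Prop_irrelevance fa ga) (Prop_irrelevance fs gs).
Qed.

Section AffineBundles.
Variables (R : realType) (M : manifold R) (A : affine_bundle M).
Notation m := (mdim M).
Notation rk := (rank A).
Notation frameA := (frame (afib A) (vfib A) rk).
Implicit Types (e : frameA) (x : M).

Lemma asubD x (a b : afib A x) v : asub (aadd a v) b = asub a b + v.
Proof. by rewrite -{1}(asubK b a) aaddA aaddK. Qed.

Lemma asubvv x (a : afib A x) : asub a a = 0.
Proof. by rewrite -{1}(aadd0 a) aaddK. Qed.

Lemma asubN x (a b : afib A x) : asub a b = - asub b a.
Proof. by apply/eqP; rewrite -addr_eq0 -asubD asubK asubvv. Qed.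

Definition trivA e : triv (afib A) rk :=
  Triv (fdom e) (fun x a => fcoord e x (asub a (forg e x)))
    (fun x y => aadd (forg e x) (fvec e x y)).

Definition trivV e : triv (fun x => vfib A x : Type) rk :=
  @Triv _ _ (fun x => vfib A x : Type) rk (fdom e) (fun x => fcoord e x) (fun x => fvec e x).

Definition trivVd e : triv (@dual_fib R M A) rk :=
  Triv (fdom e)
    (fun x (al : dual_fib A x) => \row_i (al : {scalar _}) (basis_vec e i x))
    (fun x y => dual_vec e x y : {scalar vfib A x}).

Definition frame_compat e e' := forall x, fdom e x -> fdom e' x ->
  (forall i j, smooth_near (S := M) (fun x' => fcoord e' x' (basis_vec e i x') 0 j) x) /\
  (forall i, smooth_near (S := M)
     (fun x' => fcoord e' x' (asub (forg e x') (forg e' x')) 0 i) x).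

(** Coordinates may be computed in such a frame even if it lies outside [frames A]; the frames
    coming from local data are the ones in view. *)
Definition adm_frame e := [/\ @open (mtop M) (fdom e),
  (forall x, fdom e x -> cancel (fvec e x) (fcoord e x)),
  (forall x, fdom e x -> cancel (fcoord e x) (fvec e x)) &
  forall e', frames A e' -> frame_compat e e' /\ frame_compat e' e].

Lemma frames_adm e : frames A e -> adm_frame e.
Proof.
move=> ee; split.
- exact: frames_open.
- by move=> x; exact: frames_vecK.
- by move=> x; exact: frames_coordK.
- move=> e' ee'; split=> x ex e'x; split=> *;
    by [exact: frames_compat_vec|exact: frames_compat_org].
Qed.

Lemma fvec_sum e x (y : 'rV[R]_rk) : fvec e x y = \sum_i y 0 i *: basis_vec e i x.
Proof.
rewrite {1}[y]row_sum_delta linear_sum; apply: eq_bigr => i _.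
by rewrite linearZ.
Qed.

Lemma fcoord_basis e x i j : adm_frame e -> fdom e x ->
  fcoord e x (basis_vec e i x) 0 j = (i == j)%:R.
Proof. by move=> [_ eK _ _] ex; rewrite /basis_vec eK // mxE eqxx eq_sym. Qed.

Lemma fcoord_fvec e e' x (y : 'rV[R]_rk) i :
  fcoord e' x (fvec e x y) 0 i = \sum_j fcoord e' x (basis_vec e j x) 0 i * y 0 j.
Proof.
rewrite fvec_sum linear_sum summxE; apply: eq_bigr => j _.
by rewrite linearZ mxE mulrC.
Qed.

Lemma scalar_coord e x (al : {scalar vfib A x}) u : adm_frame e -> fdom e x ->
  al u = \sum_i fcoord e x u 0 i * al (basis_vec e i x).
Proof.
move=> [_ _ eK _] ex; rewrite -{1}(eK _ ex u) fvec_sum linear_sum.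
by apply: eq_bigr => i _; rewrite linearZ.
Qed.

Lemma trivA_proper e : adm_frame e -> proper_triv (trivA e).
Proof.
move=> [oe eK eK' _]; split=> //= x ex a.
  by rewrite eK' // asubK.
by rewrite asubD asubvv add0r eK.
Qed.

Lemma trivV_proper e : adm_frame e -> proper_triv (trivV e).
Proof. by move=> [oe eK eK' _]; split. Qed.

Lemma trivVd_proper e : adm_frame e -> proper_triv (trivVd e).
Proof.
move=> ae; have [oe eK eK' _] := ae; split=> //= x ex a.
  apply: scalar_ext => u.
  rewrite (scalar_coord (a : {scalar _}) u ae ex) /= /dual_vec.
  by apply: eq_bigr => i _; rewrite mxE mulrC.
apply/rowP => i; rewrite mxE /= /dual_vec (bigD1 i) //= fcoord_basis // eqxx mulr1.
by rewrite big1 ?addr0 // => j ji; rewrite fcoord_basis // eq_sym (negbTE ji) mulr0.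
Qed.

Lemma trivA_affine e e' : frame_compat e e' ->
  affine_transition (trivA e) (trivA e').
Proof.
move=> ee' x ex e'x; have [sv so] := ee' _ ex e'x.
exists (fun i x' => fcoord e' x' (asub (forg e x') (forg e' x')) 0 i).
exists (fun i j x' => fcoord e' x' (basis_vec e j x') 0 i); split=> //.
apply: nearW => x' y i /=.
by rewrite asubD linearD mxE fcoord_fvec.
Qed.

Lemma trivV_affine e e' : frame_compat e e' ->
  affine_transition (trivV e) (trivV e').
Proof.
move=> ee' x ex e'x; have [sv so] := ee' _ ex e'x.
exists (fun i x' => 0).
exists (fun i j x' => fcoord e' x' (basis_vec e j x') 0 i); split=> //.
  by move=> i; exact: smooth_near_cst.
by apply: nearW => x' y i /=; rewrite add0r fcoord_fvec.
Qed.

(** The value of a form on e'_i is a combination of its values on the e_j, with the e-coordinates of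
    e'_i as coefficients; hence the exchanged order of the frames in the hypothesis. *)
Lemma trivVd_affine e e' : frame_compat e' e ->
  affine_transition (trivVd e) (trivVd e').
Proof.
move=> ee' x ex e'x; have [sv so] := ee' _ e'x ex.
exists (fun i x' => 0).
exists (fun i j x' => fcoord e x' (basis_vec e' i x') 0 j); split=> //.
  by move=> i; exact: smooth_near_cst.
apply: nearW => x' y i /=; rewrite add0r mxE /= /dual_vec.
by apply: eq_bigr => j _; rewrite mulrC.
Qed.

Let trivA_cover x : exists2 e, frames A e & tdom (trivA e) x := frames_cover A x.

Lemma good_totA : good_space (totA A).
Proof.
apply: (good_bspace (tv := trivA) trivA_cover).
  by move=> e /frames_adm/trivA_proper.
by move=> e e' /frames_adm ae ee'; apply: trivA_affine => //; have [_ _ _ /(_ _ ee')[]] := ae.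
Qed.

Lemma good_totV : good_space (totV A).
Proof.
apply: (good_bspace (tv := trivV) trivA_cover).
  by move=> e /frames_adm/trivV_proper.
by move=> e e' /frames_adm ae ee'; apply: trivV_affine => //; have [_ _ _ /(_ _ ee')[]] := ae.
Qed.

Lemma good_totVd : good_space (totVd A).
Proof.
apply: (good_bspace (tv := trivVd) trivA_cover).
  by move=> e /frames_adm/trivVd_proper.
by move=> e e' /frames_adm ae ee'; apply: trivVd_affine => //; have [_ _ _ /(_ _ ee')[]] := ae.
Qed.

Lemma adm_trivA e : adm_frame e -> adm_triv (frames A) trivA (trivA e).
Proof.
move=> ae; split; first exact: trivA_proper.
have [_ _ _ ee'] := ae.
by move=> e' e'A; have [] := ee' _ e'A; split; apply: trivA_affine => //; exact: frames_adm.
Qed.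

Lemma adm_trivV e : adm_frame e -> adm_triv (frames A) trivV (trivV e).
Proof.
move=> ae; split; first exact: trivV_proper.
have [_ _ _ ee'] := ae.
by move=> e' e'A; have [] := ee' _ e'A; split; apply: trivV_affine => //; exact: frames_adm.
Qed.

Lemma adm_trivVd e : adm_frame e -> adm_triv (frames A) trivVd (trivVd e).
Proof.
move=> ae; split; first exact: trivVd_proper.
have [_ _ _ ee'] := ae.
by move=> e' e'A; have [] := ee' _ e'A; split; apply: trivVd_affine => //; exact: frames_adm.
Qed.

Lemma adm_totA k e : @matlas R M k -> adm_frame e ->
  adm_chart (S := totA A) (totA_chart k e).
Proof.
move=> ck ae; apply: (adm_bchart (tv := trivA) _ ck (adm_trivA ae)).
by move=> e' /frames_adm/trivA_proper.
Qed.

Lemma adm_totV k e : @matlas R M k -> adm_frame e ->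
  adm_chart (S := totV A) (totV_chart k e).
Proof.
move=> ck ae; apply: (adm_bchart (tv := trivV) _ ck (adm_trivV ae)).
by move=> e' /frames_adm/trivV_proper.
Qed.

Lemma adm_totVd k e : @matlas R M k -> adm_frame e ->
  adm_chart (S := totVd A) (totVd_chart k e).
Proof.
move=> ck ae; apply: (adm_bchart (tv := trivVd) _ ck (adm_trivVd ae)).
by move=> e' /frames_adm/trivVd_proper.
Qed.

Lemma smooth_near_det (n : nat) (P : M -> 'M[R]_n) x :
  (forall i j, smooth_near (S := M) (fun x' => P x' i j) x) ->
  smooth_near (S := M) (fun x' => \det (P x')) x.
Proof.
move=> sP; apply: smooth_near_sum => s; apply: smooth_nearM.
  exact: smooth_near_cst.
by apply: smooth_near_prod => i.
Qed.

(** Cramer's rule: the entries of the inverse are cofactors divided by the determinant, all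
    polynomial in the entries of P apart from the division. *)
Lemma smooth_near_invmx (n : nat) (P : M -> 'M[R]_n) x i j :
  (forall i j, smooth_near (S := M) (fun x' => P x' i j) x) ->
  (\forall x' \near (x : mtop M), P x' \in unitmx) ->
  smooth_near (S := M) (fun x' => invmx (P x') i j) x.
Proof.
move=> sP uP; apply: (@smooth_near_ext _ _ (fun x' => (\det (P x'))^-1 * \adj (P x') i j)).
  by apply: filterS uP => x' ux'; rewrite /invmx ux' [RHS]mxE.
apply: smooth_nearM.
  apply: (smooth_nearV (@good_manifold R M)); [|exact: smooth_near_det].
  by have := nbhs_singleton uP; rewrite unitmxE unitfE.
case: n P sP uP i j => [|n] P sP uP i j; first by case: i.
rewrite (_ : (fun x' => \adj (P x') i j) =
  fun x' => (-1) ^+ (j + i) * \det (row' j (col' i (P x')))); last first.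
  by apply/funext => x'; rewrite mxE.
apply: smooth_nearM; first exact: smooth_near_cst.
apply: smooth_near_det => i' j'.
rewrite (_ : (fun x' => _) = fun x' => P x' (lift j i') (lift i j')) //.
by apply/funext => x'; rewrite !mxE.
Qed.

End AffineBundles.

(** * Bump functions and global sections *)

Section SmoothStep.
Variable R : realType.

(* The derivative of t^(-n) exp(-1/t) is a combination of functions of the
   same family. *)
Definition flat (n : nat) (t : R) : R :=
  if 0 < t then t^-1 ^+ n * expR (- t^-1) else 0.

Let is_derive_inv (t : R) : 0 < t -> is_derive t 1 (fun s : R => s^-1) (- t^-1 ^+ 2).
Proof.
move=> t0; apply: DeriveDef.
  by apply: (@derivableV _ _ (@id R)); [rewrite /= gt_eqF|exact: derivable_id].
rewrite (@deriveV _ _ (@id R)) /= ?gt_eqF //.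
by rewrite derive_id exprVn; exact: mulr1.
Qed.

Let is_derive_invX n (t : R) : 0 < t ->
  is_derive t 1 (fun s : R => s^-1 ^+ n) (- (n%:R * t^-1 ^+ n.+1)).
Proof.
move=> t0; have dinv := is_derive_inv t0.
elim: n => [|n IH].
  by rewrite mul0r oppr0; exact: is_derive_cst.
have := is_deriveM dinv IH.
rewrite (_ : (fun s : R => s^-1 ^+ n.+1) = (fun s => s^-1) * (fun s => s^-1 ^+ n)).
  move=> H; apply: is_derive_eq H _; rewrite /GRing.scale /= !exprS -natr1; ring.
by apply/funext => s; rewrite exprS.
Qed.

Lemma is_derive_flat_pos n (t : R) : 0 < t ->
  is_derive t 1 (flat n) (flat n.+2 t - n%:R * flat n.+1 t).
Proof.
move=> t0; have dinv := is_derive_inv t0.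
have dNinv : is_derive t 1 (fun s : R => - s^-1) (t^-1 ^+ 2).
  by have := is_deriveN dinv; rewrite opprK.
have dexp := @is_derive1_comp R expR (fun s => - s^-1) t _ _ (is_derive_expR _) dNinv.
have dprod := is_deriveM (is_derive_invX n t0) dexp.
apply: (@near_eq_is_derive _ _ _ ((fun s => s^-1 ^+ n) * (expR \o (fun s => - s^-1)))).
  near=> s; rewrite /flat ifT //; near: s; exact: lt_nbhsr.
apply: is_derive_eq dprod _.
rewrite /flat t0 /GRing.scale /= !exprS; ring.
Unshelve. all: by end_near. Qed.

Lemma is_derive_flat_neg n (t : R) : t < 0 -> is_derive t 1 (flat n) 0.
Proof.
move=> t0; apply: (@near_eq_is_derive _ _ _ (cst 0)).
  near=> s; rewrite /flat ifF // lt_gtF //; near: s; exact: lt_nbhsl.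
Unshelve. all: by end_near. Qed.

(** For h > 0 and y = 1/h, the single term y^(n+2)/(n+2)! of the exponential series is at most exp
    y, so y^(n+1) exp(-y) <= (n+2)!/y. The left side is the difference quotient of [flat n] at 0. *)
Lemma flat_bound n (h : R) : `|h^-1 * flat n h| <= n.+2`!%:R * `|h|.
Proof.
rewrite /flat; case: ifPn => [h0|_]; last by rewrite mulr0 normr0 mulr_ge0.
have y0 : 0 < h^-1 by rewrite invr_gt0.
rewrite !ger0_norm ?(ltW h0) //; last first.
  by rewrite !mulr_ge0 ?expR_ge0 ?exprn_ge0 // ltW.
rewrite expRN mulrA -exprS ler_pdivrMr ?expR_gt0 //.
have := expR_ge1Dxn n.+1 (ltW y0); rewrite -lerBrDl => H.
have {}H : h^-1 ^+ n.+2 / n.+2`!%:R <= expR h^-1.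
  by apply: le_trans H _; rewrite gerBl.
rewrite ler_pdivrMr ?ltr0n ?fact_gt0 // mulrC in H.
have := ler_wpM2l (ltW h0) H.
by rewrite exprS mulrA divff ?gt_eqF // mul1r mulrCA mulrA.
Qed.

Lemma is_derive_flat0 n : is_derive (0 : R) 1 (flat n) 0.
Proof.
have lim0 : h^-1 *: (flat n (h *: 1 + 0) - flat n 0) @[h --> (0 : R)^'] --> (0 : R).
  have fE (h : R) : h^-1 *: (flat n (h *: 1 + 0) - flat n 0) = h^-1 * flat n h.
    by rewrite {2}/flat ltxx subr0 addr0 /GRing.scale /= mulr1.
  under eq_fun do rewrite fE.
  apply/norm_cvg0P.
  apply: (@squeeze_cvgr _ _ _ _ (cst 0) (fun h => n.+2`!%:R * `|h|)).
  - by apply: nearW => h; rewrite normr_ge0 flat_bound.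
  - exact: cvg_cst.
  - rewrite -[X in _ --> X](mulr0 (n.+2`!%:R : R)); apply: cvgMl_tmp.
    apply: cvg_within_filter.
    by have := @norm_continuous _ R (0 : R); rewrite /continuous_at normr0.
apply: DeriveDef; first by apply/cvg_ex; exists 0.
exact/cvg_lim.
Qed.

Lemma is_derive_flat n (t : R) :
  is_derive t 1 (flat n) (flat n.+2 t - n%:R * flat n.+1 t).
Proof.
case: (ltgtP t 0) => [t0|t0|->].
- apply: is_derive_eq (is_derive_flat_neg n t0) _.
  by rewrite /flat lt_gtF // mulr0 subr0.
- exact: is_derive_flat_pos.
- by apply: is_derive_eq (is_derive_flat0 n) _; rewrite /flat ltxx mulr0 subr0.
Qed.

Lemma Ck_flat n k : Ck k setT (flat n).
Proof.
have df m t : differentiable (flat m) t.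
  by apply/derivable1_diffP; have [] := is_derive_flat m t.
elim: k n => [|k IH] n.
  by move=> t _; exact: differentiable_continuous.
split=> [t _|v]; first exact: df.
have := CkM openT (Ck_cst k setT v)
  (CkD openT (IH n.+2) (CkM openT (Ck_cst k setT (- n%:R)) (IH n.+1))).
apply: Ck_ext openT _ => t _.
have [dt dE] := is_derive_flat n t.
have -> : 'd (flat n) t v = v * 'd (flat n) t 1.
  by rewrite -[in LHS](mulr1 v) -[v * 1]/(v *: (1 : R)) linearZ.
by rewrite -deriveE // dE mulNr.
Qed.


Lemma flat_smooth (t : R) : smooth_at (flat 0) t.
Proof. by exists setT; split; [exact: openT|by []|exact: Ck_flat]. Qed.

Lemma flat_ge0 (t : R) : 0 <= flat 0 t.
Proof. by rewrite /flat; case: ifP; rewrite // expr0 mul1r expR_ge0. Qed.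

Lemma flat_gt0 (t : R) : 0 < t -> 0 < flat 0 t.
Proof. by rewrite /flat => ->; rewrite expr0 mul1r expR_gt0. Qed.

Lemma flat_le0 (t : R) : t <= 0 -> flat 0 t = 0.
Proof. by rewrite /flat ltNge => ->. Qed.

Definition step (t : R) : R := flat 0 t / (flat 0 t + flat 0 (1 - t)).

(** One of t and 1 - t is always positive, so the denominator never vanishes. *)
Lemma step_smooth (t : R) : smooth_at step t.
Proof.
have s1 : smooth_at (fun t : R => 1 - t) t.
  by apply: smooth_atB; [exact: smooth_at_cst|exact: smooth_at_id].
have s2 := smooth_at_comp s1 (flat_smooth (1 - t)).
apply: smooth_atM; first exact: flat_smooth.
apply: smooth_atV; last by apply: smooth_atD => //; exact: flat_smooth.
rewrite gt_eqF //; case: (ltrP 0 t) => t0.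
  by apply: ltr_wpDr; [exact: flat_ge0|exact: flat_gt0].
apply: ltr_wpDl; first exact: flat_ge0.
by apply: flat_gt0; lra.
Qed.

Lemma step1 (t : R) : 1 <= t -> step t = 1.
Proof.
move=> t1; have t0 : 0 < flat 0 t by apply: flat_gt0; lra.
by rewrite /step (@flat_le0 (1 - t)) ?subr_le0 // addr0 divff ?gt_eqF.
Qed.

Lemma step0 (t : R) : t <= 0 -> step t = 0.
Proof. by move=> t0; rewrite /step flat_le0 // mul0r. Qed.

Definition plateau (t : R) : R := step (2 - t) * step (2 + t).

Lemma plateau_smooth (t : R) : smooth_at plateau t.
Proof.
have s1 : smooth_at (fun t : R => 2 - t) t.
  by apply: smooth_atB; [exact: smooth_at_cst|exact: smooth_at_id].
have s2 : smooth_at (fun t : R => 2 + t) t.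
  by apply: smooth_atD; [exact: smooth_at_cst|exact: smooth_at_id].
exact: (smooth_atM (smooth_at_comp s1 (step_smooth _)) (smooth_at_comp s2 (step_smooth _))).
Qed.

Lemma plateau1 (t : R) : `|t| <= 1 -> plateau t = 1.
Proof.
rewrite ler_norml => /andP[t1 t2].
by rewrite /plateau !step1 ?mul1r //; lra.
Qed.

Lemma plateau0 (t : R) : 2 <= `|t| -> plateau t = 0.
Proof.
rewrite ler_normr => /orP[] t2; rewrite /plateau.
  by rewrite step0 ?mul0r //; lra.
by rewrite [step (2 + t)]step0 ?mulr0 //; lra.
Qed.

(** A product over the coordinates suits the norm on row vectors, which is the sup norm and has
    boxes for balls. *)
Definition box_bump (n : nat) (c : 'rV[R]_n) (eps : R) (z : 'rV[R]_n) : R :=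
  \prod_i plateau ((z 0 i - c 0 i) / eps).

Lemma box_bump_smooth n (c : 'rV[R]_n) (eps : R) z : smooth_at (box_bump c eps) z.
Proof.
apply: smooth_at_prod => i.
have s1 : smooth_at (fun z : 'rV[R]_n => (z 0 i - c 0 i) / eps) z.
  apply: smooth_atM; last exact: smooth_at_cst.
  by apply: smooth_atB; [exact: smooth_at_coord|exact: smooth_at_cst].
exact: (smooth_at_comp s1 (plateau_smooth _)).
Qed.

Lemma box_bump1 n (c : 'rV[R]_n) (eps : R) : 0 < eps ->
  \forall z \near c, box_bump c eps z = 1.
Proof.
move=> e0; apply/nbhs_ballP; exists eps => //= z [_ cz].
rewrite /box_bump big1 // => i _; apply: plateau1.
rewrite normrM normfV (gtr0_norm e0) ler_pdivrMr // mul1r distrC.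
by apply: ltW; have := cz 0 i; rewrite -ball_normE.
Qed.

Lemma box_bump_neq0 n (c : 'rV[R]_n) (eps : R) z i : 0 < eps -> box_bump c eps z != 0 ->
  `|z 0 i - c 0 i| <= 2 * eps.
Proof.
move=> e0; apply: contraNT; rewrite -ltNge => ei.
rewrite /box_bump (bigD1 i) //= plateau0 ?mul0r //.
by rewrite normrM normfV (gtr0_norm e0) ler_pdivlMr // ltW.
Qed.

Lemma box_compact n (c : 'rV[R]_n) (eps : R) :
  compact [set z : 'rV[R]_n | forall i, `|z 0 i - c 0 i| <= eps].
Proof.
have := @rV_compact R n (fun i => [set` `[c 0 i - eps, c 0 i + eps]])
  (fun i => @segment_compact _ _ _).
rewrite (_ : [set v | _] = [set z : 'rV[R]_n | forall i, `|z 0 i - c 0 i| <= eps]) //.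
by apply/seteqP; split=> z /= zi i; have := zi i; rewrite /= in_itv /= ler_distl.
Qed.

End SmoothStep.

(** * Bump functions on the manifold *)

Section BumpFunctions.
Variables (R : realType) (M : manifold R).

(** A box bump is carried over by a chart and extended by 0. The last clause says that the support
    lies in O, in the form needed to multiply by functions that are smooth on O only. *)
Lemma bump_exists (x : mtop M) (O : set M) : @open (mtop M) O -> O x ->
  exists chi : M -> R, [/\ smooth_fun chi, \forall y \near x, chi y = 1 &
    forall y : mtop M, O y \/ \forall y' \near y, chi y' = 0].
Proof.
move=> oO Ox; have [k ck kx] := matlas_cover x.
set c := cmap k x.
have imO : \forall z \near c, (cmap k @` cdom k) z /\ O (cinv k z).
  apply: filterI; first by apply: open_nbhs_nbhs; split; [exact: matlas_img|exists x].
  apply: (continuous_near (matlas_cinv ck kx)); rewrite (matlas_inv ck kx).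
  exact: open_nbhs_nbhs.
have /nbhs_ballP[e /= e0 eO] : nbhs c [set z | (cmap k @` cdom k) z /\ O (cinv k z)] := imO.
(* The bump vanishes outside the box of radius 2 eps, which has to fit in the ball of radius e. *)
pose eps := e / 3; have eps0 : 0 < eps by rewrite divr_gt0.
pose Q := [set z : 'rV[R]_(mdim M) | forall i, `|z 0 i - c 0 i| <= 2 * eps].
have QO z : Q z -> (cmap k @` cdom k) z /\ O (cinv k z).
  move=> Qz; apply: eO; split=> // i j; rewrite (ord1 i) -ball_normE /= distrC.
  by apply: le_lt_trans (Qz j) _; rewrite /eps; lra.
(* Smoothness of the extension by 0 rests on this: the support is compact, hence closed in the
   Hausdorff space M, and the chart domain and the complement of the support are open sets covering
   M. *)
have Kc : closed ((cinv k : _ -> mtop M) @` Q).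
  apply: (compact_closed (@mhausdorff _ M)); apply: continuous_compact; last exact: box_compact.
  apply: continuous_in_subspaceT => z; rewrite inE => /QO[[q kq <-] _].
  exact: (matlas_cinv ck kq).
pose chi (y : M) := if `[< cdom k y >] then box_bump c eps (cmap k y) else 0.
have chiK (y : mtop M) : ~ (cinv k @` Q) y -> \forall y' \near y, chi y' = 0.
  move=> nKy; have : \forall y' \near y, ~ (cinv k @` Q) y'.
    by apply: (@open_nbhs_nbhs _ y (~` (cinv k @` Q))); split=> //; exact: closed_openC.
  apply: filterS => y' nKy'; rewrite /chi; case: ifPn => // /asboolP ky'.
  apply/eqP; apply: contra_notT nKy' => bn0; exists (cmap k y').
    by move=> i; exact: box_bump_neq0.
  exact: matlas_inv.
have chi_dom (y : mtop M) : cdom k y -> \forall y' \near y, box_bump c eps (cmap k y') = chi y'.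
  move=> ky; have : \forall y' \near y, cdom k y'.
    by apply: open_nbhs_nbhs; split=> //; exact: matlas_dom.
  by apply: filterS => y' ky'; rewrite /chi asboolT.
have Kdom y : (cinv k @` Q) y -> cdom k y /\ O y.
  by move=> [z /QO[[q kq <-] Oq] <-]; rewrite (matlas_inv ck kq) in Oq *.
exists chi; split.
- move=> y; have [ky|nky] := pselect (cdom k y).
    apply: (smooth_near_ext (chi_dom _ ky)).
    apply/(smooth_near_chart (@good_manifold R M) _ (matlas_adm ck) ky).
    apply: smooth_at_ext (box_bump_smooth c eps (cmap k y)).
    have : \forall z \near cmap k y, (cmap k @` cdom k) z.
      by apply: open_nbhs_nbhs; split; [exact: matlas_img|exists y].
    by apply: filterS => _ [q kq <-]; rewrite (matlas_inv ck kq).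
  apply: (@smooth_near_ext _ _ (fun=> 0)); last exact: smooth_near_cst.
  have := chiK y; move=> H; have {}H := H (fun Ky => nky (Kdom _ Ky).1).
  by apply: filterS H => y' ->.
- have b1 := continuous_near (matlas_cmap ck kx) (box_bump1 c eps0).
  by apply: filterS2 b1 (chi_dom _ kx) => y b1 <-.
- move=> y; have [Ky|nKy] := pselect ((cinv k @` Q) y).
    by left; exact: (Kdom _ Ky).2.
  by right; exact: chiK.
Qed.

End BumpFunctions.

(** * Global sections and the existence of local data *)

Section GlobalSections.
Variables (R : realType) (M : manifold R) (A : affine_bundle M).
Notation rk := (rank A).
Notation frameA := (frame (afib A) (vfib A) rk).
Implicit Types (e : frameA) (x y : mtop M) (s t : sectionA A) (f chi : M -> R).

Lemma smooth_cutoff (O : set M) chi f : smooth_fun (S := M) chi ->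
  (forall y, O y \/ \forall y' \near y, chi y' = 0) ->
  forall y, (O y -> smooth_near (S := M) f y) ->
  smooth_near (S := M) (fun y => chi y * f y) y.
Proof.
move=> schi Ochi y sf; have [/sf{}sf|chi0] := Ochi y.
  by apply: smooth_nearM.
apply: (@smooth_near_ext _ _ (fun=> 0)); last exact: smooth_near_cst.
by apply: filterS chi0 => y' ->; rewrite mul0r.
Qed.

Definition smoothA_at s x := forall e, frames A e -> fdom e x -> forall i,
  smooth_near (S := M) (fun x' : M => fcoord e x' (asub (s x') (forg e x')) 0 i) x.

Definition smoothV_at (s : sectionV A) x := forall e, frames A e -> fdom e x ->
  forall i, smooth_near (S := M) (fun x' : M => fcoord e x' (s x') 0 i) x.

Lemma smoothA_forg e x : adm_frame e -> fdom e x -> smoothA_at (forg e) x.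
Proof.
by move=> [_ _ _ ae] ex e' ee' e'x i; have [/(_ _ ex e'x)[_]] := ae _ ee'.
Qed.

Lemma smoothV_basis e x i : adm_frame e -> fdom e x -> smoothV_at (basis_vec e i) x.
Proof.
by move=> [_ _ _ ae] ex e' ee' e'x j; have [/(_ _ ex e'x)[sv _] _] := ae _ ee'; exact: sv.
Qed.

(** A weight together with a section that is smooth wherever the weight is not locally zero. *)
Definition piece (us : (M -> R) * sectionA A) := smooth_fun (S := M) us.1 /\
  forall y, smoothA_at us.2 y \/ \forall y' \near y, us.1 y' = 0.

Lemma piece_near x : exists2 us, piece us & \forall y \near x, us.1 y = 1.
Proof.
have [e ee ex] := frames_cover A x.
have [chi [schi chi1 chi0]] := bump_exists (frames_open ee) ex.
exists (chi, forg e) => //; split=> // y.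
have [ey|] := chi0 y; last by right.
by left; apply: smoothA_forg => //; exact: frames_adm.
Qed.

(** This section is chosen pointwise and has no smoothness; it only provides origins in the affine
    fibres. *)
Lemma default_section : exists s : sectionA A, True.
Proof.
by exists (fun x => forg (sval (cid2 (frames_cover A x))) x).
Qed.

(** Second countability turns a piece around each point into a sequence: a basic open set b,
    numbered by an injection f, receives a piece with weight 1 on b if there is one. Numbers that no
    such b uses receive the weight 0. *)
Lemma pieces_exist : exists us : nat -> (M -> R) * sectionA A,
  (forall n, piece (us n)) /\
  forall x, exists n, \forall y \near x, (us n).1 y = 1.
Proof.
have [B cB [oB bB]] := @mcountable _ M.
have /countable_injP[f finj] := cB.
have [s0 _] := default_section.
pose good b us := piece us /\ forall y, b y -> us.1 y = 1.
have /choice[us Hus] : forall n, exists us, piece us /\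
    forall b, B b -> f b = n -> (exists us', good b us') -> good b us.
  move=> n; have [[b [Bb fb [us gus]]]|nb] :=
    pselect (exists b, [/\ B b, f b = n & exists us, good b us]).
    exists us; split; first by case: gus.
    move=> b' Bb' fb' _; suff -> : b' = b by [].
    by apply: finj; rewrite ?inE // fb fb'.
  exists (fun=> 0, s0); split; last by move=> b Bb fb gb; case: nb; exists b.
  by split=> [y|y]; [exact: smooth_near_cst|right; exact: nearW].
exists us; split=> [n|x]; first by case: (Hus n).
have [us' pus' us1] := piece_near x.
have [b [Bb bx] bus] := bB x _ us1.
have [_ /(_ b Bb erefl)[]] := Hus (f b); first by exists us'; split.
move=> _ us1b; exists (f b).
have : \forall y \near x, b y by apply: open_nbhs_nbhs; split=> //; exact: oB.
by apply: filterS => y /us1b.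
Qed.

(* If the smooth u_n are such that near each point some u_N is 1, the functions
   phi_n = u_n prod_(j < n) (1 - u_j) form a locally finite partition of unity:
   sum_(n <= N) phi_n = 1 - prod_(j <= N) (1 - u_j), and phi_n = 0 for n > N. *)
Lemma global_sectionA : exists X : sectionA A, smooth_sectionA X.
Proof.
have [us [pus us1]] := pieces_exist.
have [s0 _] := default_section.
pose u n x := (us n).1 x; pose s n := (us n).2.
pose phi n x := u n x * \prod_(j < n) (1 - u j x).
have sum_phi N x : \sum_(n < N) phi n x = 1 - \prod_(j < N) (1 - u j x).
  elim: N => [|N IH]; first by rewrite !big_ord0 subrr.
  by rewrite big_ord_recr big_ord_recr /= IH /phi; ring.
have prod0 n N x : (N < n)%N -> u N x = 1 -> \prod_(j < n) (1 - u j x) = 0.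
  by move=> Nn uN; rewrite (bigD1 (Ordinal Nn)) //= uN subrr mul0r.
have /choice[K K1] : forall x, exists n, u n x = 1.
  by move=> x; have [n /nbhs_singleton] := us1 x; exists n.
pose S N x := \sum_(n < N) phi n x *: asub (s n x) (s0 x).
(* Beyond an index where the weight is 1 all terms vanish, so truncating after any such index gives
   the same sum. The choice of [K x] therefore need not vary regularly with x. *)
have SE N N' x : (N < N')%N -> u N x = 1 -> S N' x = S N.+1 x.
  move=> NN' uN; rewrite /S -(big_mkord xpredT (fun n => phi n x *: asub (s n x) (s0 x))).
  rewrite (@big_cat_nat _ _ _ N.+1) //= big_mkord big_nat_cond [X in _ + X]big1 ?addr0 //.
  by move=> n /andP[/andP[Nn _] _]; rewrite /phi (prod0 n N) // mulr0 scale0r.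
have SK N x : u N x = 1 -> S (K x).+1 x = S N.+1 x.
  move=> uN; have [KN|NK|->//] := ltngtP (K x) N.
    by rewrite (SE (K x) N.+1) // ltnS ltnW.
  by rewrite (SE N (K x).+1) // ltnS ltnW.
exists (fun x => aadd (s0 x) (S (K x).+1 x)) => e x ee ex i.
have [N uN] := us1 x.
apply: (@smooth_near_ext _ _ (fun x' =>
  \sum_(n < N.+1) phi n x' * fcoord e x' (asub (s n x') (forg e x')) 0 i)).
  apply: filterS uN => x' uN.
  rewrite (SK N) // asubD.
  (* The functions [phi n] with n <= N add up to 1 at x', which makes the non-smooth origin [s0]
     drop out. *)
  have -> : S N.+1 x' = \sum_(n < N.+1) phi n x' *: asub (s n x') (forg e x') -
      asub (s0 x') (forg e x').
    transitivity (\sum_(n < N.+1) (phi n x' *: asub (s n x') (forg e x') -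
      phi n x' *: asub (s0 x') (forg e x'))).
      apply: eq_bigr => n _; rewrite -scalerBr; congr (_ *: _).
      by rewrite -{2}(asubK (s0 x') (s n x')) asubD addrAC subrr add0r.
    by rewrite sumrB -scaler_suml sum_phi (prod0 _ N) // subr0 scale1r.
  rewrite addrC subrK linear_sum summxE; apply: eq_bigr => n _.
  by rewrite linearZ mxE.
apply: smooth_near_sum => n; rewrite /phi.
have [sn|un0] := (pus n).2 x.
  apply: smooth_nearM; last exact: sn.
  apply: smooth_nearM; first exact: (pus n).1.
  apply: smooth_near_prod => j; apply: smooth_nearB; first exact: smooth_near_cst.
  exact: (pus j).1.
apply: (@smooth_near_ext _ _ (fun=> 0)); last exact: smooth_near_cst.
by apply: filterS un0 => x' un0; rewrite /u un0 !mul0r.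
Qed.

Lemma smooth_sectionV_sum (I : finType) (a : I -> R) (s : I -> sectionV A) :
  (forall i, smooth_sectionV (s i)) ->
  smooth_sectionV (fun x => \sum_i a i *: s i x).
Proof.
move=> ss e x ee ex j.
apply: (@smooth_near_ext _ _ (fun x' => \sum_i a i * fcoord e x' (s i x') 0 j)).
  apply: nearW => x'; rewrite linear_sum summxE; apply: eq_bigr => i _.
  by rewrite linearZ mxE.
apply: smooth_near_sum => i; apply: smooth_nearM; first exact: smooth_near_cst.
exact: ss.
Qed.

Lemma smooth_addS (s t : sectionV A) : smooth_sectionV s -> smooth_sectionV t ->
  smooth_sectionV (addS s t).
Proof.
move=> ss st e x ee ex j.
apply: (@smooth_near_ext _ _ (fun x' => fcoord e x' (s x') 0 j + fcoord e x' (t x') 0 j)).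
  by apply: nearW => x'; rewrite /addS linearD mxE.
by apply: smooth_nearD; [exact: ss|exact: st].
Qed.

Lemma smooth_scaleS f (s : sectionV A) : smooth_fun (S := M) f ->
  smooth_sectionV s -> smooth_sectionV (scaleS f s).
Proof.
move=> sf ss e x ee ex j.
apply: (@smooth_near_ext _ _ (fun x' => f x' * fcoord e x' (s x') 0 j)).
  by apply: nearW => x'; rewrite /scaleS linearZ mxE.
by apply: smooth_nearM; [exact: sf|exact: ss].
Qed.

Lemma smooth_shiftS (X : sectionA A) (s : sectionV A) : smooth_sectionA X ->
  smooth_sectionV s -> smooth_sectionA (shiftS X s).
Proof.
move=> sX ss e x ee ex j.
apply: (@smooth_near_ext _ _ (fun x' => fcoord e x' (asub (X x') (forg e x')) 0 j
   + fcoord e x' (s x') 0 j)).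
  by apply: nearW => x'; rewrite /shiftS asubD linearD mxE.
by apply: smooth_nearD; [exact: sX|exact: ss].
Qed.

Lemma smooth_asubS (X Y : sectionA A) : smooth_sectionA X -> smooth_sectionA Y ->
  smooth_sectionV (fun x => asub (X x) (Y x)).
Proof.
move=> sX sY e x ee ex j.
apply: (@smooth_near_ext _ _ (fun x' => fcoord e x' (asub (X x') (forg e x')) 0 j
   - fcoord e x' (asub (Y x') (forg e x')) 0 j)).
  apply: nearW => x'; rewrite -{1}(asubK (Y x') (X x')) asubD linearD !mxE.
  by rewrite addrAC subrr add0r.
by apply: smooth_nearB; [exact: sX|exact: sY].
Qed.

Lemma cutoff_sectionV (O : set M) chi (s : sectionV A) : smooth_fun (S := M) chi ->
  (forall y, O y \/ \forall y' \near y, chi y' = 0) ->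
  (forall y, O y -> smoothV_at s y) -> smooth_sectionV (scaleS chi s).
Proof.
move=> schi Ochi ss e x ee ex j.
apply: (@smooth_near_ext _ _ (fun x' => chi x' * fcoord e x' (s x') 0 j)).
  by apply: nearW => x'; rewrite /scaleS linearZ mxE.
by apply: smooth_cutoff Ochi _ _ => // /ss; exact.
Qed.

(** An affine fibre has no zero to fade into: the result moves from s, where [chi] is 1, to the
    global section X, where [chi] is 0. *)
Lemma cutoff_sectionA (O : set M) chi (X s : sectionA A) : smooth_fun (S := M) chi ->
  (forall y, O y \/ \forall y' \near y, chi y' = 0) -> smooth_sectionA X ->
  (forall y, O y -> smoothA_at s y) ->
  smooth_sectionA (fun x => aadd (X x) (chi x *: asub (s x) (X x))).
Proof.
move=> schi Ochi sX ss.
apply: (@smooth_shiftS X (scaleS chi (fun x => asub (s x) (X x)))) => //.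
apply: cutoff_sectionV Ochi _ => // y Oy e ee ey j.
apply: (@smooth_near_ext _ _ (fun x' => fcoord e x' (asub (s x') (forg e x')) 0 j
   - fcoord e x' (asub (X x') (forg e x')) 0 j)).
  apply: nearW => x'; rewrite -{1}(asubK (X x') (s x')) asubD linearD !mxE.
  by rewrite addrAC subrr add0r.
by apply: smooth_nearB; [exact: ss|exact: sX].
Qed.

Variable G : lie_affgebroid A.

(** A frame around x is cut off to global sections, which still coincide with it on the open set
    where the bump is 1; the structure functions are the coordinates of the brackets there. *)
Lemma local_data_exists x : exists l : local_data G, ld_dom l x.
Proof.
have [X sX] := global_sectionA.
have [k ck kx] := matlas_cover x.
have [e ee ex] := frames_cover A x.
have ae := frames_adm ee.
have [chi [schi chi1 chi0]] := bump_exists (frames_open ee) ex.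
have [U oU [Ux U1]] : exists2 U : set M, @open (mtop M) U & U x /\ forall y, U y -> chi y = 1.
  have : nbhs x [set y | chi y = 1] := chi1.
  by rewrite nbhsE => -[U [oU Ux] U1]; exists U.
pose dom := U `&` cdom k `&` fdom e.
have odom : @open (mtop M) dom.
  by apply: openI; [apply: openI => //; exact: matlas_dom|exact: frames_open].
pose e0 : sectionA A := fun y => aadd (X y) (chi y *: asub (forg e y) (X y)).
pose ev i : sectionV A := scaleS chi (basis_vec e i).
have se0 : smooth_sectionA e0.
  by apply: cutoff_sectionA chi0 _ _ => // y ey; exact: smoothA_forg.
have sev i : smooth_sectionV (ev i).
  by apply: cutoff_sectionV chi0 _ => // y ey; exact: smoothV_basis.
have evE i y : dom y -> ev i y = basis_vec e i y.
  by move=> [[/U1 y1 _] _]; rewrite /ev /scaleS y1 scale1r.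
have vE y (v : vfib A y) : dom y -> v = \sum_i fcoord e y v 0 i *: ev i y.
  move=> dy; rewrite -{1}(frames_coordK ee dy.2 v) fvec_sum.
  by apply: eq_bigr => i _; rewrite evE.
pose C0 i j y := fcoord e y (D G e0 (ev i) y) 0 j.
pose C i j g y := fcoord e y (br G (ev i) (ev j) y) 0 g.
have basis y : dom y -> forall v : vfib A y,
    exists! c : 'rV[R]_rk, v = \sum_i c 0 i *: ev i y.
  move=> dy v; exists (fcoord e y v); split; first exact: vE.
  move=> c ->; have -> : \sum_i c 0 i *: ev i y = fvec e y c.
    by rewrite fvec_sum; apply: eq_bigr => i _; rewrite evE.
  by rewrite (frames_vecK ee dy.2).
have dsub : dom `<=` cdom k by move=> y [[]].
exists (@LocalData R M A G k dom e0 ev C0 C ck odom dsub se0 sev basis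
  (fun y al dy => vE y _ dy) (fun y al be dy => vE y _ dy)).
by [].
Qed.

End GlobalSections.

(** * Frames given by local data *)

Section LinearCombination.
Variables (R : realType) (V : lmodType R) (n : nat) (b : 'I_n -> V).

Definition lincomb (y : 'rV[R]_n) : V := \sum_i y 0 i *: b i.

Lemma lincomb_is_linear : linear lincomb.
Proof.
move=> c u v; rewrite /lincomb scaler_sumr -big_split; apply: eq_bigr => i _ /=.
by rewrite !mxE scalerDl scalerA.
Qed.

HB.instance Definition _ := GRing.isLinear.Build R 'rV[R]_n V *:%R lincomb lincomb_is_linear.

Lemma lincomb_delta i : lincomb (delta_mx 0 i) = b i.
Proof.
rewrite /lincomb (bigD1 i) //= mxE !eqxx scale1r big1 ?addr0 // => j ji.
by rewrite mxE (negbTE ji) andbF scale0r.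
Qed.

Lemma lincomb_inverse : (forall v : V, exists! y : 'rV[R]_n, v = lincomb y) ->
  exists f : {linear V -> 'rV[R]_n}, cancel lincomb f /\ cancel f lincomb.
Proof.
move=> bb; have /choice[f fE] : forall v, exists y, v = lincomb y.
  by move=> v; have [y [? _]] := bb v; exists y.
have fK : cancel f lincomb by move=> v; rewrite -fE.
have inj : injective lincomb.
  move=> y y' yy'; have [z [_ zu]] := bb (lincomb y).
  by rewrite -(zu y) // -(zu y').
have flin : linear f.
  by move=> c u v; apply: inj; rewrite fK linearP /= !fK.
pose F : {linear V -> 'rV[R]_n} := HB.pack f (GRing.isLinear.Build R V 'rV[R]_n *:%R f flin).
exists F; split=> [y|v]; last exact: fK.
by apply: inj; exact: fK.
Qed.

End LinearCombination.

Section LocalFrame.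
Variables (R : realType) (M : manifold R) (A : affine_bundle M).
Variables (G : lie_affgebroid A) (l : local_data G).
Notation rk := (rank A).

(** A frame needs a coordinate map in every fibre; outside the domain of the local data the zero map
    is taken. *)
Lemma ld_coord_exists (x : M) : exists f : {linear vfib A x -> 'rV[R]_rk},
  ld_dom l x -> cancel (lincomb (fun i => ld_e l i x)) f /\
                cancel f (lincomb (fun i => ld_e l i x)).
Proof.
have [dx|ndx] := pselect (ld_dom l x); last by exists (\0 : {linear _ -> _}) => /ndx.
by have [f fK] := lincomb_inverse (ld_basis dx); exists f.
Qed.

Definition ld_coord (x : M) : {linear vfib A x -> 'rV[R]_rk} :=
  sval (cid (ld_coord_exists x)).

Definition ld_frame : frame (afib A) (vfib A) rk :=
  @Frame R M (afib A) (vfib A) rk (ld_dom l) (ld_e0 l)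
    (fun x => lincomb (fun i => ld_e l i x)) ld_coord.

Lemma ld_basis_vec i (x : M) : basis_vec ld_frame i x = ld_e l i x.
Proof. exact: lincomb_delta. Qed.

(** The transition matrix P to a given frame is smooth because the e_alpha are smooth sections; the
    transition in the other direction uses its inverse, smooth by [smooth_near_invmx]. *)
Lemma ld_frame_adm : adm_frame ld_frame.
Proof.
have vK x : ld_dom l x -> cancel (fvec ld_frame x) (fcoord ld_frame x).
  by move=> dx; have [] := svalP (cid (ld_coord_exists x)) dx.
have cK x : ld_dom l x -> cancel (fcoord ld_frame x) (fvec ld_frame x).
  by move=> dx; have [] := svalP (cid (ld_coord_exists x)) dx.
split=> //; first exact: ld_open.
move=> e' ee'; have ae' := frames_adm ee'.
have [oe' eK' eK _] := ae'.
have sP x i j : ld_dom l x -> fdom e' x ->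
    smooth_near (S := M) (fun x' => fcoord e' x' (ld_e l i x') 0 j) x.
  by move=> dx e'x; exact: (@ld_e_smooth _ _ _ _ l).
have sO x i : ld_dom l x -> fdom e' x ->
    smooth_near (S := M) (fun x' => fcoord e' x' (asub (ld_e0 l x') (forg e' x')) 0 i) x.
  by move=> dx e'x; exact: (@ld_e0_smooth _ _ _ _ l).
pose P x := \matrix_(i, j) fcoord e' x (ld_e l i x) 0 j : 'M[R]_rk.
have PE x (v : vfib A x) : ld_dom l x -> fdom e' x ->
    fcoord e' x v = fcoord ld_frame x v *m P x.
  move=> dx e'x; rewrite -{1}(cK _ dx v) /= /lincomb linear_sum.
  apply/rowP => j; rewrite mxE summxE; apply: eq_bigr => i _.
  by rewrite linearZ !mxE.
have uP x : ld_dom l x -> fdom e' x -> P x \in unitmx.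
  move=> dx e'x.
  (* A one-sided inverse suffices for a square matrix; its rows are the coordinates of the given
     basis in the frame of the local data. *)
  suff /mulmx1_unit[] : (\matrix_i fcoord ld_frame x (basis_vec e' i x)) *m P x = 1%:M by [].
  apply/row_matrixP => i; rewrite row_mul rowK -PE // row1.
  by rewrite /basis_vec eK'.
have PV x (v : vfib A x) : ld_dom l x -> fdom e' x ->
    fcoord ld_frame x v = fcoord e' x v *m invmx (P x).
  by move=> dx e'x; rewrite PE // mulmxK // uP.
have near_dom (x : mtop M) : ld_dom l x -> fdom e' x ->
    \forall x' \near x, ld_dom l x' /\ fdom e' x'.
  move=> dx e'x; apply: filterI; apply: open_nbhs_nbhs; split=> //.
  exact: ld_open.
have sV x i j : ld_dom l x -> fdom e' x ->
    smooth_near (S := M) (fun x' => invmx (P x') i j) x.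
  move=> dx e'x; apply: smooth_near_invmx.
    move=> i' j'; apply: (@smooth_near_ext _ _ (fun x' => fcoord e' x' (ld_e l i' x') 0 j'));
      last exact: sP.
    by apply: nearW => x'; rewrite mxE.
  by apply: filterS (near_dom _ dx e'x) => x' [? ?]; exact: uP.
split=> x; [move=> dx e'x|move=> e'x dx]; split.
- move=> i j.
  apply: (@smooth_near_ext _ _ (fun x' => fcoord e' x' (ld_e l i x') 0 j)).
    by apply: nearW => x'; rewrite ld_basis_vec.
  exact: sP.
- by move=> i; exact: sO.
- move=> i j.
  apply: (@smooth_near_ext _ _ (fun x' => invmx (P x') i j)); last exact: sV.
  have := near_dom _ dx e'x; apply: filterS => x' [dx' e'x'].
  by rewrite PV // /basis_vec eK' // -rowE mxE.
- move=> j.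
  apply: (@smooth_near_ext _ _ (fun x' =>
    \sum_i - fcoord e' x' (asub (ld_e0 l x') (forg e' x')) 0 i * invmx (P x') i j)).
    have := near_dom _ dx e'x; apply: filterS => x' [dx' e'x'].
    rewrite PV // [asub (forg e' x') _]asubN linearN [RHS]mxE.
    by apply: eq_bigr => i _; rewrite mxE.
  apply: smooth_near_sum => i; apply: smooth_nearM; last exact: sV.
  by apply: smooth_nearN; exact: sO.
Qed.

End LocalFrame.

(** * The differential on the bidual *)

Section Affgebroid.
Variables (R : realType) (M : manifold R) (A : affine_bundle M).
Variable G : lie_affgebroid A.
Notation rk := (rank A).
Implicit Types (s t : sectionV A) (X : sectionA A) (f : M -> R).
Implicit Type th : forall x : M, aff_form A x.

Lemma rhoV_Z (x : M) (c : R) (u : vfib A x) f : rhoV G (c *: u) f = c * rhoV G u f.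
Proof.
have rhoV0 : rhoV G (0 : vfib A x) f = 0.
  have := rhoV_linear G 1 (0 : vfib A x) 0 f; rewrite scaler0 addr0 mul1r.
  by move=> /eqP; rewrite -subr_eq0 opprD addNKr oppr_eq0 => /eqP.
by have := rhoV_linear G c u 0 f; rewrite addr0 rhoV0 addr0.
Qed.

Lemma rhoV_D (x : M) (u v : vfib A x) f : rhoV G (u + v) f = rhoV G u f + rhoV G v f.
Proof. by have := rhoV_linear G 1 u v f; rewrite scale1r mul1r. Qed.

Lemma rhoV_sum (x : M) (I : finType) (u : I -> vfib A x) f :
  rhoV G (\sum_i u i) f = \sum_i rhoV G (u i) f.
Proof.
apply: (big_morph (fun u : vfib A x => rhoV G u f) (fun u v => rhoV_D u v f)).
by rewrite -(scale0r (0 : vfib A x)) rhoV_Z mul0r.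
Qed.

(** The bracket with s is the difference of D along X + s and along X. Each obeys a Leibniz rule,
    and the difference of their anchors is [rhoV] of s. *)
Lemma br_leibniz s f t : smooth_sectionV s -> smooth_fun (S := M) f ->
  smooth_sectionV t ->
  br G s (scaleS f t) =
  addS (scaleS f (br G s t)) (scaleS (fun x => rhoV G (s x) f) t).
Proof.
move=> ss sf st; have [X sX] := global_sectionA A.
have sXs := smooth_shiftS sX ss.
have := D_leibniz G sXs sf st.
rewrite (D_shift G sX ss (smooth_scaleS sf st)) (D_shift G sX ss st).
rewrite (D_leibniz G sX sf st) => H.
apply: functional_extensionality_dep => x; have := congr1 (fun h : sectionV A => h x) H.
rewrite /addS /scaleS /shiftS rhoA_affine scalerDr scalerDl.
rewrite -!addrA => {}H.
apply: (addrI (rhoA G (X x) f *: t x)); apply: (addrI (f x *: D G X t x)).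
by rewrite H; congr (_ + _); exact: addrCA.
Qed.

Lemma br_leibniz_l s f t : smooth_sectionV s -> smooth_fun (S := M) f ->
  smooth_sectionV t ->
  br G (scaleS f s) t =
  addS (scaleS f (br G s t)) (scaleS (fun x => - rhoV G (t x) f) s).
Proof.
move=> ss sf st; rewrite br_antisym //; last exact: smooth_scaleS.
rewrite br_leibniz // (br_antisym G ss st).
apply: functional_extensionality_dep => x.
by rewrite /addS /scaleS !scaleN1r opprD scalerN scaleNr.
Qed.

Lemma br_additive_l s s' t : smooth_sectionV s -> smooth_sectionV s' ->
  smooth_sectionV t -> br G (addS s s') t = addS (br G s t) (br G s' t).
Proof.
move=> ss ss' st; have := br_linear G 1 ss ss' st.
have E (u : sectionV A) : scaleS (fun=> 1) u = u.
  by apply: functional_extensionality_dep => x; rewrite /scaleS scale1r.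
by rewrite !E.
Qed.

Lemma D_additive X s t : smooth_sectionA X -> smooth_sectionV s ->
  smooth_sectionV t -> D G X (addS s t) = addS (D G X s) (D G X t).
Proof.
move=> sX ss st; have := D_linear G 1 sX ss st.
have E (u : sectionV A) : scaleS (fun=> 1) u = u.
  by apply: functional_extensionality_dep => x; rewrite /scaleS scale1r.
by rewrite !E.
Qed.

(** The coordinates of an admissible frame are smooth functions on V, and s pulls them back to
    smooth functions on M. *)
Lemma smooth_section_coord (e : frame (afib A) (vfib A) rk) s (x : mtop M) i :
  adm_frame e -> fdom e x -> smooth_sectionV s ->
  smooth_near (S := M) (fun y => fcoord e y (s y) 0 i) x.
Proof.
move=> ae ex ss; have [e' ee' e'x] := frames_cover A x.
have st : smooth_near (S := totV A)
    (fun q : totV A => fcoord e (tag q) (tagged q) 0 i) (ptV (s x)).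
  apply: (smooth_near_tco (tv := trivV (A := A)) _ i (adm_trivV ae)) => //.
  by move=> e1 /frames_adm/trivV_proper.
apply: (@smooth_near_section _ M (fun x => vfib A x : Type) rk _ (frames A) (trivV (A := A)) _ _ _
  (fun q : totV A => fcoord e (tag q) (tagged q) 0 i) (trivV e') s x _ _ _ st) => //.
- exact: frames_cover.
- by move=> e1 /frames_adm/trivV_proper.
- move=> e1 e2 /frames_adm ae1 ee2; apply: trivV_affine => //.
  by have [_ _ _ /(_ _ ee2)[]] := ae1.
- exact/adm_trivV/frames_adm.
- by move=> j; exact: ss.
Qed.

Lemma smooth_near_sectionA (f : totA A -> R) X (x : mtop M) : smooth_sectionA X ->
  smooth_near f (ptA (X x)) -> smooth_near (S := M) (fun y => f (ptA (X y))) x.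
Proof.
move=> sX sf; have [e ee ex] := frames_cover A x.
apply: (@smooth_near_section _ M (afib A) rk _ (frames A) (trivA (A := A)) _ _ _
    f (trivA e) X x _ _ _ sf) => //.
- exact: frames_cover.
- by move=> e' /frames_adm/trivA_proper.
- move=> e1 e2 /frames_adm ae1 ee2; apply: trivA_affine => //.
  by have [_ _ _ /(_ _ ee2)[]] := ae1.
- exact/adm_trivA/frames_adm.
- by move=> j; exact: sX.
Qed.

(* A C^oo(M)-linear functional on sections of V only depends on the value of
   the section at the point. *)
Lemma tensorial_coord (l : local_data G) (x : mtop M) (F : sectionV A -> R) :
  ld_dom l x ->
  (forall s t, smooth_sectionV s -> smooth_sectionV t -> F (addS s t) = F s + F t) ->
  (forall f s, smooth_fun (S := M) f -> smooth_sectionV s -> F (scaleS f s) = f x * F s) ->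
  forall s, smooth_sectionV s ->
    F s = \sum_i fcoord (ld_frame l) x (s x) 0 i * F (ld_e l i).
Proof.
move=> dx FD FZ s ss.
have [chi [schi chi1 chi0]] := bump_exists (ld_open l) dx.
have chix : chi x = 1 := nbhs_singleton chi1.
have ae := ld_frame_adm l; have [_ _ eK _] := ae.
(* The cut-off makes the components of s global functions, so that chi s = sum f_i e_i on all of M,
   while F(chi s) = F(s) because chi x = 1. *)
pose f i y := chi y * fcoord (ld_frame l) y (s y) 0 i.
have sf i : smooth_fun (S := M) (f i).
  move=> y; apply: smooth_cutoff chi0 _ _ => // dy.
  exact: smooth_section_coord.
have F0 : F (fun=> 0) = 0.
  have := FZ (fun=> 0) s (fun y => @smooth_near_cst R M 0 y) ss.
  rewrite mul0r => <-; congr F.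
  by apply: functional_extensionality_dep => y; rewrite /scaleS scale0r.
have Fsum (r : seq 'I_rk) : smooth_sectionV (fun y => \sum_(i <- r) f i y *: ld_e l i y) /\
    F (fun y => \sum_(i <- r) f i y *: ld_e l i y) = \sum_(i <- r) f i x * F (ld_e l i).
  elim: r => [|i r [sr IH]].
    have -> : (fun y => \sum_(i <- [::]) f i y *: ld_e l i y) = (fun=> 0) :> sectionV A.
      by apply: functional_extensionality_dep => y; rewrite big_nil.
    split; last by rewrite big_nil.
    move=> e y ee ey j; apply: (@smooth_near_ext _ _ (fun=> 0)); last exact: smooth_near_cst.
    by apply: nearW => y'; rewrite linear0 mxE.
  have -> : (fun y => \sum_(j <- i :: r) f j y *: ld_e l j y) =
      addS (scaleS (f i) (ld_e l i)) (fun y => \sum_(j <- r) f j y *: ld_e l j y).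
    by apply: functional_extensionality_dep => y; rewrite big_cons.
  have si : smooth_sectionV (scaleS (f i) (ld_e l i)).
    by apply: smooth_scaleS => //; exact: ld_e_smooth.
  split; first exact: smooth_addS.
  by rewrite FD // IH FZ ?big_cons //; exact: ld_e_smooth.
have [_ FS] := Fsum (index_enum 'I_rk).
have sE : scaleS chi s = (fun y => \sum_i f i y *: ld_e l i y).
  apply: functional_extensionality_dep => y; rewrite /scaleS /f.
  have [dy|/nbhs_singleton ->] := chi0 y; last first.
    by rewrite scale0r big1 // => i _; rewrite mul0r scale0r.
  rewrite -[in LHS](eK _ dy (s y)) fvec_sum scaler_sumr; apply: eq_bigr => i _.
  by rewrite scalerA ld_basis_vec.
have := FZ chi s schi ss; rewrite chix mul1r => <-.
by rewrite sE FS; apply: eq_bigr => i _; rewrite /f chix mul1r.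
Qed.

Lemma smooth_aff_section th X : smooth_aff th -> smooth_sectionA X ->
  smooth_fun (S := M) (fun x => th x (X x)).
Proof.
by move=> sth sX x; apply: (smooth_near_sectionA (f := aff_fun th)) => //; exact: sth.
Qed.

(** The linear part on s is the difference of the affine form at X + s and at X, for any global
    section X. *)
Lemma smooth_aff_lin_section th s : smooth_aff th -> smooth_sectionV s ->
  smooth_fun (S := M) (fun x => aff_lin (th x) (s x)).
Proof.
move=> sth ss x; have [X sX] := global_sectionA A.
apply: (@smooth_near_ext _ _ (fun x => th x (shiftS X s x) - th x (X x))).
  by apply: nearW => y; rewrite /shiftS aff_valD addrAC subrr add0r.
apply: smooth_nearB; last exact: smooth_aff_section.
by apply: smooth_aff_section => //; exact: smooth_shiftS.
Qed.

Section Differential.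
Variables (th : forall x : M, aff_form A x) (sth : smooth_aff th).

Definition dbidual_sec X s (x : M) : R :=
  rhoA G (X x) (fun x' => aff_lin (th x') (s x'))
  - rhoV G (s x) (fun x' => th x' (X x')) - aff_lin (th x) (D G X s x).

(** The differential, in the Lie algebroid V, of the linear part of [th]; it measures how
    [dbidual_sec] changes when X is shifted by t. *)
Definition dV_sec t s (x : M) : R :=
  rhoV G (t x) (fun x' => aff_lin (th x') (s x'))
  - rhoV G (s x) (fun x' => aff_lin (th x') (t x')) - aff_lin (th x) (br G t s x).

Let gM := @good_manifold R M.

Lemma dbidual_sec_shift X t s x : smooth_sectionA X -> smooth_sectionV t ->
  smooth_sectionV s ->
  dbidual_sec (shiftS X t) s x = dbidual_sec X s x + dV_sec t s x.
Proof.
move=> sX st ss; rewrite /dbidual_sec /dV_sec D_shift // {1}/shiftS rhoA_affine.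
have -> : (fun x' => th x' (shiftS X t x')) =
    (fun x' => th x' (X x') + aff_lin (th x') (t x')).
  by apply/funext => y; rewrite /shiftS aff_valD.
rewrite (is_tangentD gM (is_tangent_tangent (rhoV G (s x)))).
- by rewrite /addS (linearD (aff_lin (th x))); ring.
- exact: smooth_aff_section.
- exact: smooth_aff_lin_section.
Qed.

(** Tensoriality in s: the term [rhoA (X x) f] times the linear part on s, produced by the
    derivation, is cancelled by the one from the Leibniz rule of D. *)
Lemma dbidual_sec_coord (l : local_data G) X s x : ld_dom l x ->
  smooth_sectionA X -> smooth_sectionV s ->
  dbidual_sec X s x =
  \sum_i fcoord (ld_frame l) x (s x) 0 i * dbidual_sec X (ld_e l i) x.
Proof.
move=> dx sX ss.
apply: (tensorial_coord (F := fun s => dbidual_sec X s x) dx) => //.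
- move=> u v su sv; rewrite /dbidual_sec D_additive // {2}/addS rhoV_D.
  have -> : (fun x' => aff_lin (th x') (addS u v x')) =
    (fun x' => aff_lin (th x') (u x') + aff_lin (th x') (v x')).
    by apply/funext => y; rewrite linearD.
  rewrite (is_tangentD gM (is_tangent_tangent (rhoA G (X x)))).
  + by rewrite /addS (linearD (aff_lin (th x))); ring.
  + exact: smooth_aff_lin_section.
  + exact: smooth_aff_lin_section.
- move=> f u sf su; rewrite /dbidual_sec D_leibniz // {2}/scaleS rhoV_Z.
  have -> : (fun x' => aff_lin (th x') (scaleS f u x')) =
    (fun x' => f x' * aff_lin (th x') (u x')).
    by apply/funext => y; rewrite linearZ.
  rewrite (is_tangentM gM (is_tangent_tangent (rhoA G (X x)))).
  + by rewrite /addS /scaleS (linearD (aff_lin (th x))) !(linearZ_LR (aff_lin (th x))) /=; ring.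
  + exact: sf.
  + exact: smooth_aff_lin_section.
Qed.

Lemma dV_sec_coord (l : local_data G) t s x : ld_dom l x ->
  smooth_sectionV t -> smooth_sectionV s ->
  dV_sec t s x =
  \sum_i fcoord (ld_frame l) x (t x) 0 i * dV_sec (ld_e l i) s x.
Proof.
move=> dx st ss.
apply: (tensorial_coord (F := fun t => dV_sec t s x) dx) => //.
- move=> u v su sv; rewrite /dV_sec br_additive_l // {1}/addS rhoV_D.
  have -> : (fun x' => aff_lin (th x') (addS u v x')) =
    (fun x' => aff_lin (th x') (u x') + aff_lin (th x') (v x')).
    by apply/funext => y; rewrite linearD.
  rewrite (is_tangentD gM (is_tangent_tangent (rhoV G (s x)))).
  + by rewrite /addS (linearD (aff_lin (th x))); ring.
  + exact: smooth_aff_lin_section.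
  + exact: smooth_aff_lin_section.
- move=> f u sf su; rewrite /dV_sec br_leibniz_l // {1}/scaleS rhoV_Z.
  have -> : (fun x' => aff_lin (th x') (scaleS f u x')) =
    (fun x' => f x' * aff_lin (th x') (u x')).
    by apply/funext => y; rewrite linearZ.
  rewrite (is_tangentM gM (is_tangent_tangent (rhoV G (s x)))).
  + by rewrite /addS /scaleS (linearD (aff_lin (th x))) !(linearZ_LR (aff_lin (th x))) /=; ring.
  + exact: sf.
  + exact: smooth_aff_lin_section.
Qed.

End Differential.
End Affgebroid.

(** * Coordinates on A, V and V^* given by local data *)

Section LocalCoordinates.
Variables (R : realType) (M : manifold R) (A : affine_bundle M).
Variables (G : lie_affgebroid A) (l : local_data G).
Notation rk := (rank A).
Notation m := (mdim M).
Notation e := (ld_frame l).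
Notation k := (ld_chart l).
Implicit Type x : mtop M.
Implicit Type th : forall x : M, aff_form A x.

Let ae := ld_frame_adm l.


Definition coordA (q : totA A) : 'rV[R]_rk :=
  fcoord e (tag q) (asub (tagged q) (ld_e0 l (tag q))).
Definition coordV (q : totV A) : 'rV[R]_rk := fcoord e (tag q) (tagged q).
Definition coordVd (q : totVd A) : 'rV[R]_rk :=
  \row_i (tagged q : {scalar _}) (ld_e l i (tag q)).

Definition chartA := totA_chart k e.
Definition chartV := totV_chart k e.
Definition chartVd := totVd_chart k e.

Lemma chartA_adm : adm_chart (S := totA A) chartA.
Proof. exact: adm_totA (ld_atlas l) ae. Qed.
Lemma chartV_adm : adm_chart (S := totV A) chartV.
Proof. exact: adm_totV (ld_atlas l) ae. Qed.
Lemma chartVd_adm : adm_chart (S := totVd A) chartVd.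
Proof. exact: adm_totVd (ld_atlas l) ae. Qed.

Lemma chartA_dom (q : totA A) : ld_dom l (tag q) -> cdom chartA q.
Proof. by move=> dq; split=> //; exact: ld_sub. Qed.
Lemma chartV_dom (q : totV A) : ld_dom l (tag q) -> cdom chartV q.
Proof. by move=> dq; split=> //; exact: ld_sub. Qed.
Lemma chartVd_dom (q : totVd A) : ld_dom l (tag q) -> cdom chartVd q.
Proof. by move=> dq; split=> //; exact: ld_sub. Qed.

Lemma chartA_l i : chart_coord chartA (lshift rk i) = fun q => chart_coord k i (tag q).
Proof. by apply/funext => q; rewrite /chart_coord /= row_mxEl. Qed.
Lemma chartA_r i : chart_coord chartA (rshift m i) = fun q => coordA q 0 i.
Proof. by apply/funext => q; rewrite /chart_coord /= row_mxEr. Qed.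
Lemma chartV_l i : chart_coord chartV (lshift rk i) = fun q => chart_coord k i (tag q).
Proof. by apply/funext => q; rewrite /chart_coord /= row_mxEl. Qed.
Lemma chartV_r i : chart_coord chartV (rshift m i) = fun q => coordV q 0 i.
Proof. by apply/funext => q; rewrite /chart_coord /= row_mxEr. Qed.
Lemma chartVd_l i : chart_coord chartVd (lshift rk i) = fun q => chart_coord k i (tag q).
Proof. by apply/funext => q; rewrite /chart_coord /= row_mxEl. Qed.
Lemma chartVd_r i : chart_coord chartVd (rshift m i) = fun q => coordVd q 0 i.
Proof. by apply/funext => q; rewrite /chart_coord /= row_mxEr !mxE ld_basis_vec. Qed.

Lemma coordA_smooth (q : totA A) i : ld_dom l (tag q) ->
  smooth_near (fun q => coordA q 0 i) q.
Proof.
move=> dq; have := @smooth_near_coord R (totA A) _ q (rshift m i) chartA_adm (chartA_dom dq).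
by rewrite chartA_r.
Qed.
Lemma coordV_smooth (q : totV A) i : ld_dom l (tag q) ->
  smooth_near (fun q => coordV q 0 i) q.
Proof.
move=> dq; have := @smooth_near_coord R (totV A) _ q (rshift m i) chartV_adm (chartV_dom dq).
by rewrite chartV_r.
Qed.
Lemma coordVd_smooth (q : totVd A) i : ld_dom l (tag q) ->
  smooth_near (fun q => coordVd q 0 i) q.
Proof.
move=> dq; have := @smooth_near_coord R (totVd A) _ q (rshift m i) chartVd_adm (chartVd_dom dq).
by rewrite chartVd_r.
Qed.

Lemma ld_dom_near x : ld_dom l x -> \forall y \near x, ld_dom l y.
Proof. by move=> dx; apply: open_nbhs_nbhs; split=> //; exact: ld_open. Qed.

Lemma coordAK (q : totA A) : ld_dom l (tag q) ->
  q = ld_point l (tag q) (coordA q).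
Proof.
case: q => x a /= dx; rewrite /ld_point /coordA /=.
have [_ _ eK _] := ae; have := eK _ dx (asub a (ld_e0 l x)).
by rewrite /= /lincomb => ->; rewrite asubK.
Qed.

Lemma coordA_ld_point x y : ld_dom l x -> coordA (ld_point l x y) = y.
Proof.
move=> dx; have [_ eK _ _] := ae; rewrite /coordA /ld_point /= asubD asubvv add0r.
exact: (eK x dx y).
Qed.

Lemma coordVE x (u : vfib A x) : ld_dom l x ->
  u = \sum_i coordV (ptV u) 0 i *: ld_e l i x.
Proof. by move=> dx; have [_ _ eK _] := ae; rewrite -{1}(eK _ dx u). Qed.

Lemma coordAE x (a : afib A x) : ld_dom l x ->
  a = aadd (ld_e0 l x) (\sum_i coordA (ptA a) 0 i *: ld_e l i x).
Proof.
move=> dx; have [_ _ eK _] := ae; have := eK _ dx (asub a (ld_e0 l x)).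
by rewrite /= /lincomb /coordA => ->; rewrite asubK.
Qed.

Lemma pairing_coord x (al : {scalar vfib A x}) (u : vfib A x) : ld_dom l x ->
  al u = \sum_i coordV (ptV u) 0 i * coordVd (ptVd (al : dual_fib A x)) 0 i.
Proof.
move=> dx; rewrite {1}(coordVE u dx) linear_sum; apply: eq_bigr => i _.
by rewrite linearZ mxE.
Qed.

(** For constant y this is the e_j component of [e_0 + y^b e_b, e_i]. *)
Definition ldK (y : 'rV[R]_rk) (i j : 'I_rk) (x : M) : R :=
  ld_C0 l i j x + \sum_b ld_C l b i j x * y 0 b.

Lemma rhoA_coord x (a : afib A x) f : ld_dom l x ->
  rhoA G a f = rhoA G (ld_e0 l x) f + \sum_i coordA (ptA a) 0 i * rhoV G (ld_e l i x) f.
Proof.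
move=> dx; rewrite {1}(coordAE a dx) rhoA_affine rhoV_sum; congr (_ + _).
by apply: eq_bigr => i _; rewrite rhoV_Z.
Qed.

Lemma rhoV_coord x (u : vfib A x) f : ld_dom l x ->
  rhoV G u f = \sum_i coordV (ptV u) 0 i * rhoV G (ld_e l i x) f.
Proof.
move=> dx; rewrite {1}(coordVE u dx) rhoV_sum.
by apply: eq_bigr => i _; rewrite rhoV_Z.
Qed.

Definition aff0 th (x : M) : R := th x (ld_e0 l x).
Definition aff1 th i (x : M) : R := aff_lin (th x) (ld_e l i x).

Lemma aff0_smooth th : smooth_aff th -> smooth_fun (S := M) (aff0 th).
Proof. by move=> sth; apply: smooth_aff_section => //; exact: ld_e0_smooth. Qed.

Lemma aff1_smooth th i : smooth_aff th -> smooth_fun (S := M) (aff1 th i).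
Proof. by move=> sth; apply: smooth_aff_lin_section => //; exact: ld_e_smooth. Qed.

(** Every pair of sections through b and u yields the right-hand side, by tensoriality; combinations
    of the local basis with constant coefficients show that such a pair exists, so that the chosen
    value is not the default. *)
Lemma dbidualE th x (b : afib A x) (u : vfib A x) : smooth_aff th -> ld_dom l x ->
  dbidual G th b u =
  \sum_i coordV (ptV u) 0 i * (rhoA G b (aff1 th i) - rhoV G (ld_e l i x) (aff0 th)
    - \sum_j coordA (ptA b) 0 j * rhoV G (ld_e l i x) (aff1 th j)
    - \sum_j ldK (coordA (ptA b)) i j x * aff1 th j x).
Proof.
move=> sth dx; set rhs := RHS.
have secE X s : smooth_sectionA X -> smooth_sectionV s -> X x = b -> s x = u ->
    dbidual_sec G th X s x = rhs.
  move=> sX ss Xb su.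
  have se0 : smooth_sectionA (ld_e0 l) by exact: ld_e0_smooth.
  have se i : smooth_sectionV (ld_e l i) by exact: ld_e_smooth.
  pose t : sectionV A := fun x => asub (X x) (ld_e0 l x).
  have st : smooth_sectionV t by exact: smooth_asubS.
  (* Writing X = e_0 + t reduces its contribution to the known brackets of e_0 and of the e_j with
     e_i. *)
  have XE : X = shiftS (ld_e0 l) t.
    by apply: functional_extensionality_dep => y; rewrite /shiftS /t asubK.
  rewrite (dbidual_sec_coord sth dx) //; apply: eq_bigr => i _.
  rewrite su; congr (_ * _).
  rewrite XE dbidual_sec_shift // (dV_sec_coord sth dx) //.
  have tx j : fcoord e x (t x) 0 j = coordA (ptA b) 0 j by rewrite /t Xb.
  under eq_bigr do rewrite tx /dV_sec ld_CE //.
  rewrite /dbidual_sec ld_C0E // (rhoA_coord b (aff1 th i) dx).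
  have lin (c : 'I_rk -> R) : aff_lin (th x) (\sum_j c j *: ld_e l j x) =
      \sum_j c j * aff1 th j x.
    by rewrite linear_sum; apply: eq_bigr => j _; rewrite linearZ.
  rewrite lin; under eq_bigr do rewrite lin.
  have -> : \sum_j ldK (coordA (ptA b)) i j x * aff1 th j x =
    \sum_j ld_C0 l i j x * aff1 th j x +
    \sum_b0 coordA (ptA b) 0 b0 * \sum_j ld_C l b0 i j x * aff1 th j x.
    under [X in _ + X]eq_bigr do rewrite mulr_sumr.
    rewrite exchange_big -big_split; apply: eq_bigr => j _ /=.
    rewrite /ldK mulrDl mulr_suml; congr (_ + _); apply: eq_bigr => b0 _; ring.
  under eq_bigr do rewrite !mulrBr.
  rewrite !sumrB /aff0 /aff1; ring.
have : [set r | exists X s, [/\ smooth_sectionA X, smooth_sectionV s, X x = b, s x = u &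
        r = rhoA G b (fun x' => aff_lin (th x') (s x'))
            - rhoV G u (fun x' => th x' (X x'))
            - aff_lin (th x) (D G X s x)]] (dbidual G th b u).
  rewrite /dbidual; apply: xgetPex.
  pose t : sectionV A := fun x => \sum_i coordA (ptA b) 0 i *: ld_e l i x.
  pose s : sectionV A := fun x => \sum_i coordV (ptV u) 0 i *: ld_e l i x.
  have st : smooth_sectionV t by apply: smooth_sectionV_sum => i; exact: ld_e_smooth.
  have ss : smooth_sectionV s by apply: smooth_sectionV_sum => i; exact: ld_e_smooth.
  have Xx : shiftS (ld_e0 l) t x = b by rewrite [RHS](coordAE b dx).
  have sx : s x = u by rewrite [RHS](coordVE u dx).
  eexists; exists (shiftS (ld_e0 l) t), s; split=> //.
  by apply: smooth_shiftS => //; exact: ld_e0_smooth.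
move=> [X [s [sX ss Xb su ->]]].
by have := secE X s sX ss Xb su; rewrite /dbidual_sec Xb su.
Qed.

End LocalCoordinates.

(** * The isomorphism A_A in coordinates *)

Section FibreTangent.
Variables (R : realType) (M : manifold R) (B : M -> Type) (r : nat).
Variables (F : Type) (TT : set F) (tv : F -> triv B r).
Notation S := (bspace TT tv).
Hypothesis TT_cover : forall x, exists2 e, TT e & tdom (tv e) x.
Hypothesis gS : good_space S.

(** A Leibniz rule in which the coefficients come from the base, where X acts through its
    projection. It covers affine functions on A and linear functions on V alike. *)
Lemma tangent_fibre_affine (n : nat) (f : S -> R) (b : S) (X : tangent b)
    (y : 'I_n -> S -> R) (g0 : M -> R) (g : 'I_n -> M -> R) :
  (forall i, smooth_near (y i) b) -> smooth_near (S := M) g0 (tag b) ->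
  (forall i, smooth_near (S := M) (g i) (tag b)) ->
  (\forall x \near (tag b : mtop M), forall u : B x,
     f (Tagged B u) = g0 x + \sum_i y i (Tagged B u) * g i x) ->
  X f = push (fun q : S => tag q : M) X g0 +
    \sum_i (X (y i) * g i (tag b) + y i b * push (fun q : S => tag q : M) X (g i)).
Proof.
move=> sy sg0 sg fE; have tX := is_tangent_tangent X.
have sg0' : smooth_near (S := S) (fun q : S => g0 (tag q)) b by exact: smooth_near_tag.
have sg' i : smooth_near (S := S) (fun q : S => g i (tag q)) b by exact: smooth_near_tag.
have syg i : smooth_near (S := S) (fun q : S => y i q * g i (tag q)) b.
  by apply: smooth_nearM.
have sh : smooth_near (S := S) (fun q : S => g0 (tag q) + \sum_i y i q * g i (tag q)) b.
  by apply: smooth_nearD => //; exact: smooth_near_sum.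
rewrite -(is_tangent_fext TT_cover tX sh); last first.
  by apply: filterS fE => x fE u; rewrite fE.
rewrite (is_tangentD gS tX) //; last exact: smooth_near_sum.
rewrite (is_tangent_sum gS tX) // push_tagE //; congr (_ + _).
apply: eq_bigr => i _; rewrite (is_tangentM gS tX) // push_tagE //.
Qed.

End FibreTangent.

(** * The vector U_u in coordinates *)

Section AffineDifferential.
Variables (R : realType) (M : manifold R) (A : affine_bundle M).
Variables (G : lie_affgebroid A) (l : local_data G).
Notation rk := (rank A).
Notation m := (mdim M).
Notation e := (ld_frame l).
Notation k := (ld_chart l).
Implicit Type x : mtop M.
Implicit Type th : forall x : M, aff_form A x.

Let ae := ld_frame_adm l.
Let gM := @good_manifold R M.

Lemma pushA_tangent (q : totA A) (Y : tangent q) :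
  is_tangent (S := M) (tag q) (push (@tauA R M A) Y).
Proof.
by apply: (@is_tangent_push_tag _ _ _ _ _ (frames A) (@trivA R M A)); exact: frames_cover.
Qed.

Lemma pushV_tangent (q : totV A) (Y : tangent q) :
  is_tangent (S := M) (tag q) (push (@tauV R M A) Y).
Proof.
by apply: (@is_tangent_push_tag _ _ _ _ _ (frames A) (@trivV R M A)); exact: frames_cover.
Qed.

Lemma pushVd_tangent (q : totVd A) (Y : tangent q) :
  is_tangent (S := M) (tag q) (push (@tauVd R M A) Y).
Proof.
by apply: (@is_tangent_push_tag _ _ _ _ _ (frames A) (@trivVd R M A)); exact: frames_cover.
Qed.

Lemma ld_coord_smooth x i : ld_dom l x -> smooth_near (S := M) (chart_coord k i) x.
Proof.
by move=> dx; apply: smooth_near_coord; [exact/matlas_adm/ld_atlas|exact: ld_sub].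
Qed.

Lemma pushA_coord (q : totA A) (Y : tangent q) i : ld_dom l (tag q) ->
  push (@tauA R M A) Y (chart_coord k i) = Y (chart_coord (chartA l) (lshift rk i)).
Proof.
by move=> dq; rewrite chartA_l /push asboolT //; exact: ld_coord_smooth.
Qed.

Lemma pushV_coord (q : totV A) (Y : tangent q) i : ld_dom l (tag q) ->
  push (@tauV R M A) Y (chart_coord k i) = Y (chart_coord (chartV l) (lshift rk i)).
Proof.
by move=> dq; rewrite chartV_l /push asboolT //; exact: ld_coord_smooth.
Qed.

Lemma pushVd_coord (q : totVd A) (Y : tangent q) i : ld_dom l (tag q) ->
  push (@tauVd R M A) Y (chart_coord k i) = Y (chart_coord (chartVd l) (lshift rk i)).
Proof.
by move=> dq; rewrite chartVd_l /push asboolT //; exact: ld_coord_smooth.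
Qed.

Lemma tangentM_ext x X Y : ld_dom l x -> is_tangent (S := M) x X ->
  is_tangent (S := M) x Y -> (forall i, X (chart_coord k i) = Y (chart_coord k i)) ->
  X = Y.
Proof.
by move=> dx; apply: (is_tangent_ext gM); [exact/matlas_adm/ld_atlas|exact: ld_sub].
Qed.

Lemma aff_fun_coord th x (a : afib A x) : ld_dom l x ->
  th x a = aff0 l th x + \sum_i coordA l (ptA a) 0 i * aff1 l th i x.
Proof.
move=> dx; rewrite {1}(coordAE a dx) aff_valD linear_sum; congr (_ + _).
by apply: eq_bigr => i _; rewrite linearZ.
Qed.

Lemma aff_lin_coord th x (u : vfib A x) : ld_dom l x ->
  aff_lin (th x) u = \sum_i coordV l (ptV u) 0 i * aff1 l th i x.
Proof.
move=> dx; rewrite {1}(coordVE u dx) linear_sum.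
by apply: eq_bigr => i _; rewrite linearZ.
Qed.

Lemma tangent_aff_fun th (q : totA A) (Y : tangent q) : smooth_aff th ->
  ld_dom l (tag q) ->
  Y (aff_fun th) = push (@tauA R M A) Y (aff0 l th) +
    \sum_i (Y (fun q => coordA l q 0 i) * aff1 l th i (tag q)
            + coordA l q 0 i * push (@tauA R M A) Y (aff1 l th i)).
Proof.
move=> sth dq.
apply: (@tangent_fibre_affine _ _ _ _ _ (frames A) (@trivA R M A) (@frames_cover _ _ A)
  (good_totA A) rk (aff_fun th) q Y (fun i q => coordA l q 0 i)).
- by move=> i; exact: coordA_smooth.
- exact: aff0_smooth.
- by move=> i; exact: aff1_smooth.
- by apply: filterS (ld_dom_near dq) => x dx a; rewrite /aff_fun /= aff_fun_coord.
Qed.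

Lemma tangent_aff_lin_fun th (q : totV A) (Y : tangent q) : smooth_aff th ->
  ld_dom l (tag q) ->
  Y (aff_lin_fun th) =
    \sum_i (Y (fun q => coordV l q 0 i) * aff1 l th i (tag q)
            + coordV l q 0 i * push (@tauV R M A) Y (aff1 l th i)).
Proof.
move=> sth dq.
rewrite (@tangent_fibre_affine _ _ _ _ _ (frames A) (@trivV R M A) (@frames_cover _ _ A)
  (good_totV A) rk (aff_lin_fun th) q Y (fun i q => coordV l q 0 i) (fun=> 0) (aff1 l th)).
- by rewrite (is_tangent_cst (S := M) _ (pushV_tangent Y)) add0r.
- by move=> i; exact: coordV_smooth.
- exact: smooth_near_cst.
- by move=> i; exact: aff1_smooth.
- by apply: filterS (ld_dom_near dq) => x dx a; rewrite /aff_lin_fun /= add0r aff_lin_coord.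
Qed.

(** The condition [is_sigma] only tests globally smooth functions; this supplies a global function
    with the germ of a coordinate. *)
Lemma cutoff_function x (f : M -> R) : ld_dom l x ->
  (forall y, ld_dom l y -> smooth_near (S := M) f y) ->
  exists2 g : M -> R, smooth_fun (S := M) g & \forall y \near x, g y = f y.
Proof.
move=> dx sf; have [chi [schi chi1 chi0]] := bump_exists (ld_open l) dx.
exists (fun y => chi y * f y).
  by move=> y; apply: smooth_cutoff chi0 _ _ => //; exact: sf.
by apply: filterS chi1 => y ->; rewrite mul1r.
Qed.

(** A global affine form with the germ of the fibre coordinate y^i, used as a test form to isolate
    one component of U. *)
Lemma aff_coord_exists x i : ld_dom l x ->
  exists2 th : forall x : M, aff_form A x, smooth_aff th &
    \forall y \near x, aff0 l th y = 0 /\ forall j, aff1 l th j y = (j == i)%:R.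
Proof.
move=> dx; have [chi [schi chi1 chi0]] := bump_exists (ld_open l) dx.
pose val (y : M) (a : afib A y) : R := chi y * fcoord e y (asub a (ld_e0 l y)) 0 i.
pose lin (y : M) (u : vfib A y) : R := chi y * fcoord e y u 0 i.
have linP (y : M) : scalar (@lin y).
  by move=> c u v; rewrite /lin linearP !mxE mulrDr mulrCA.
pose linF y : {scalar vfib A y} :=
  HB.pack (@lin y) (GRing.isLinear.Build R (vfib A y) R *%R (@lin y) (linP y)).
have valD (y : M) (a : afib A y) v : val y (aadd a v) = val y a + linF y v.
  by rewrite /val /= /lin asubD linearD mxE mulrDr.
exists (fun y => AffForm (valD y)).
  move=> q; have [dq|chiq] := chi0 (tag q).
    apply: smooth_nearM; last exact: coordA_smooth.
    by apply: (@smooth_near_tag _ _ _ _ _ (frames A) (@trivA R M A) chi q); exact: schi.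
  apply: (@smooth_near_fext _ _ _ _ _ (frames A) (@trivA R M A) (fun=> 0) _ q).
    by apply: filterS chiq => y chiy a; rewrite /aff_fun /= /val chiy mul0r.
  exact: smooth_near_cst.
apply: filterS2 (ld_dom_near dx) chi1 => y dy chiy.
have [_ eK _ _] := ae; split.
  by rewrite /aff0 /= /val asubvv linear0 mxE mulr0.
move=> j; rewrite /aff1 /= /lin chiy mul1r -ld_basis_vec.
by rewrite fcoord_basis.
Qed.

Lemma is_sigmaP x (b : afib A x) (w : prolV G (ptA b))
    (U : tangent (ptV (prol_vec w : vfib A x))) : ld_dom l x ->
  let u := coordV l (ptV (prol_vec w : vfib A x)) in
  is_sigma U <->
  push (@tauV R M A) U = tan_fun (rhoA G b) /\
  forall j, U (fun q => coordV l q 0 j) =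
    prol_tan w (fun q => coordA l q 0 j) -
    \sum_i u 0 i * ldK l (coordA l (ptA b)) i j x.
Proof.
move=> dx u.
have tb : is_tangent (S := M) x (rhoA G b) by exact: is_tangent_tangent.
have tU : is_tangent (S := M) x (push (@tauV R M A) U) by exact: (pushV_tangent U).
(* Once U and b have the same projection to M, all terms differentiating the coefficients of theta
   cancel, with the help of [prol_eq] for Y. The remaining defect is linear in the components of
   theta, its coefficients being the defects of the coordinate equations. *)
have affE th : smooth_aff th -> push (@tauV R M A) U = tan_fun (rhoA G b) ->
  U (aff_lin_fun th) - (prol_tan w (aff_fun th) + dbidual G th b (prol_vec w)) =
  \sum_j (U (fun q => coordV l q 0 j) - (prol_tan w (fun q => coordA l q 0 j) -
    \sum_i u 0 i * ldK l (coordA l (ptA b)) i j x)) * aff1 l th j x.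
  move=> sth pU; rewrite tangent_aff_lin_fun // tangent_aff_fun // (dbidualE b _ sth dx).
  rewrite pU -(prol_eq w) /=.
  rewrite (rhoV_coord (prol_vec w) (aff0 l th) dx).
  under [X in _ - (_ + X + _)]eq_bigr do rewrite (rhoV_coord (prol_vec w) (aff1 l th _) dx).
  rewrite -/u.
  under [X in _ - (_ + _ + X)]eq_bigr do rewrite !mulrBr !mulr_sumr.
  rewrite !sumrB !big_split /=.
  have -> : \sum_i coordA l (ptA b) 0 i * (\sum_j u 0 j * rhoV G (ld_e l j x) (aff1 l th i)) =
    \sum_j \sum_i u 0 j * (coordA l (ptA b) 0 i * rhoV G (ld_e l j x) (aff1 l th i)).
    rewrite exchange_big; apply: eq_bigr => i _; rewrite mulr_sumr.
    by apply: eq_bigr => j _; ring.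
  have -> : \sum_j (U (fun q => coordV l q 0 j) - (prol_tan w (fun q => coordA l q 0 j) -
    \sum_i u 0 i * ldK l (coordA l (ptA b)) i j x)) * aff1 l th j x =
    \sum_j U (fun q => coordV l q 0 j) * aff1 l th j x -
    \sum_j prol_tan w (fun q => coordA l q 0 j) * aff1 l th j x +
    \sum_i \sum_j u 0 i * (ldK l (coordA l (ptA b)) i j x * aff1 l th j x).
    rewrite [X in _ = _ + X]exchange_big -sumrB -big_split; apply: eq_bigr => j _ /=.
    have -> : \sum_i u 0 i * (ldK l (coordA l (ptA b)) i j x * aff1 l th j x) =
        (\sum_i u 0 i * ldK l (coordA l (ptA b)) i j x) * aff1 l th j x.
      by rewrite mulr_suml; apply: eq_bigr => i _; rewrite mulrA.
    ring.
  ring.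
split=> [[sig1 sig2]|[pU UE]].
  have pU : push (@tauV R M A) U = tan_fun (rhoA G b).
    apply: (tangentM_ext dx) => // i.
    have [g sg gE] := cutoff_function dx (fun y => @ld_coord_smooth y i).
    rewrite -(is_tangent_near_eq tU (sg _) gE) -(is_tangent_near_eq tb (sg _) gE).
    by rewrite -sig1 // /push asboolT //; exact: sg.
  split=> // j; apply/eqP; rewrite -subr_eq0.
  have [th sth /nbhs_singleton[_ thE]] := aff_coord_exists j dx.
  have := affE th sth pU; rewrite sig2 // subrr.
  rewrite (bigD1 j) //= thE eqxx mulr1 [X in _ = _ + X]big1 ?addr0 => [<- //|i ij].
  by rewrite thE (negbTE ij) mulr0.
split=> [f sf|th sth].
  by rewrite -pU /push asboolT //; exact: sf.
apply/eqP; rewrite -subr_eq0 affE //; apply/eqP; apply: big1 => j _.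
by rewrite UE subrr mul0r.
Qed.

End AffineDifferential.

(** * Derivatives of pairings and along blocks of coordinates *)

Section Derivatives.
Variable R : realType.

Lemma derive1_near_eq (f g : R -> R) t :
  (\forall s \near t, f s = g s) -> derive1 f t = derive1 g t.
Proof. by move=> fg; rewrite !derive1E; exact: near_eq_derive. Qed.

Lemma derive1_pairing n (f g : 'I_n -> R -> R) t :
  (forall i, derivable (f i) t 1) -> (forall i, derivable (g i) t 1) ->
  derive1 (fun s => \sum_i f i s * g i s) t =
  \sum_i (derive1 (f i) t * g i t + f i t * derive1 (g i) t).
Proof.
move=> df dg.
have -> : (fun s => \sum_i f i s * g i s) = \sum_i (f i * g i).
  by apply/funext => s; rewrite fct_sumE.
rewrite derive1E derive_sum => [|i]; last exact: derivableM.
apply: eq_bigr => i _; rewrite deriveM // !derive1E [LHS]addrC; congr (_ + _).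
by rewrite -[LHS]/(g i t * _) mulrC.
Qed.

Lemma sum_delta n (F : 'I_n -> R) j : \sum_i (i == j)%:R * F i = F j.
Proof.
rewrite (bigD1 j) //= eqxx mul1r big1 ?addr0 // => i ij.
by rewrite (negbTE ij) mul0r.
Qed.

Lemma delta_lshift m r (i : 'I_m) :
  delta_mx 0 (lshift r i) = row_mx (delta_mx 0 i) 0 :> 'rV[R]_(m + r).
Proof.
apply/rowP => j; case: (split_ordP j) => j' ->.
  by rewrite row_mxEl !mxE eq_lshift.
by rewrite row_mxEr !mxE eq_rlshift andbF.
Qed.

Lemma delta_rshift m r (i : 'I_r) :
  delta_mx 0 (rshift m i) = row_mx 0 (delta_mx 0 i) :> 'rV[R]_(m + r).
Proof.
apply/rowP => j; case: (split_ordP j) => j' ->.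
  by rewrite row_mxEl !mxE eq_lrshift andbF.
by rewrite row_mxEr !mxE eq_rshift.
Qed.

(** Freezing the other block leaves the difference quotient unchanged. This relates the partial
    derivatives in the Euler-Lagrange equations to the differential of L in a chart of A. *)
Lemma derive_row_mxl m r (F : 'rV[R]_(m + r) -> R) v z y :
  'D_(row_mx v 0) F (row_mx z y) = 'D_v (fun z' => F (row_mx z' y)) z.
Proof.
have FE : (fun h : R => h^-1 *: (F (h *: row_mx v 0 + row_mx z y) - F (row_mx z y))) =
    (fun h : R => h^-1 *: (F (row_mx (h *: v + z) y) - F (row_mx z y))).
  by apply/funext => h; rewrite scale_row_mx add_row_mx scaler0 add0r.
by rewrite /derive FE.
Qed.

Lemma derive_row_mxr m r (F : 'rV[R]_(m + r) -> R) v z y :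
  'D_(row_mx 0 v) F (row_mx z y) = 'D_v (fun y' => F (row_mx z y')) y.
Proof.
have FE : (fun h : R => h^-1 *: (F (h *: row_mx 0 v + row_mx z y) - F (row_mx z y))) =
    (fun h : R => h^-1 *: (F (row_mx z (h *: v + y)) - F (row_mx z y))).
  by apply/funext => h; rewrite scale_row_mx add_row_mx scaler0 add0r.
by rewrite /derive FE.
Qed.

End Derivatives.

(** * The isomorphism A_A and the submanifold S_L in coordinates *)

Section Isomorphism.
Variables (R : realType) (M : manifold R) (A : affine_bundle M).
Variables (G : lie_affgebroid A) (l : local_data G).
Notation rk := (rank A).
Notation m := (mdim M).
Notation e := (ld_frame l).
Notation k := (ld_chart l).
Implicit Type x : mtop M.

(** A curve realizing U and X exists since their projections agree: straight lines in the
    coordinates of V and V^* can share their base line. For any such curve the product rule applied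
    to the pairing written in coordinates gives the value. *)
Lemma tpairingE x (u : vfib A x) (al : dual_fib A x) (U : tangent (ptV u))
    (X : tangent (ptVd al)) : ld_dom l x ->
  push (@tauV R M A) U = push (@tauVd R M A) X ->
  tpairing U X = \sum_i (U (fun q => coordV l q 0 i) * coordVd l (ptVd al) 0 i
                         + coordV l (ptV u) 0 i * X (fun q => coordVd l q 0 i)).
Proof.
move=> dx UX.
have : [set r | exists w : R -> {x : M & (vfib A x * dual_fib A x)%type},
    let wV := fun s => ptV (tagged (w s)).1 in
    let wVd := fun s => ptVd (tagged (w s)).2 in
    [/\ smooth_curve_at wV 0 /\ smooth_curve_at wVd 0,
        wV 0 = ptV u /\ wVd 0 = ptVd al,
        tan_fun U = velocity wV 0 /\ tan_fun X = velocity wVd 0 &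
        r = derive1 (fun s : R => ((tagged (w s)).2 : {scalar _}) (tagged (w s)).1) 0]]
    (tpairing U X).
  apply: xgetPex.
  (* The base direction is read off U; by [UX] it is also that of X. *)
  pose zeta := \row_i U (chart_coord (chartV l) (lshift rk i)) : 'rV[R]_m.
  pose om := \row_i U (fun q => coordV l q 0 i) : 'rV[R]_rk.
  pose xi := \row_i X (fun q => coordVd l q 0 i) : 'rV[R]_rk.
  pose w (s : R) : {x : M & (vfib A x * dual_fib A x)%type} :=
    let y := cinv k (cmap k x + s *: zeta) in
    Tagged (fun x => (vfib A x * dual_fib A x)%type)
      (fvec e y (coordV l (ptV u) + s *: om),
       dual_vec e y (coordVd l (ptVd al) + s *: xi) : {scalar vfib A y}).
  pose zV := line_coord (S := totV A) (chartV l) (ptV u) (row_mx zeta om).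
  pose zVd := line_coord (S := totVd A) (chartVd l) (ptVd al) (row_mx zeta xi).
  have cV : cmap (chartV l) (ptV u) = row_mx (cmap k x) (coordV l (ptV u)) by [].
  have cVd : cmap (chartVd l) (ptVd al) = row_mx (cmap k x) (coordVd l (ptVd al)).
    by rewrite /=; congr row_mx; apply/rowP => i; rewrite !mxE ld_basis_vec.
  have wVE : (fun s => ptV (tagged (w s)).1) = (fun s => cinv (chartV l) (zV s)).
    apply/funext => s; rewrite /zV /line_coord cV scale_row_mx add_row_mx.
    by rewrite /= row_mxKl row_mxKr.
  have wVdE : (fun s => ptVd (tagged (w s)).2) = (fun s => cinv (chartVd l) (zVd s)).
    apply/funext => s; rewrite /zVd /line_coord cVd scale_row_mx add_row_mx.
    by rewrite /= row_mxKl row_mxKr.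
  have dV := chartV_dom (q := ptV u) dx; have dVd := chartVd_dom (q := ptVd al) dx.
  have szV i : smooth_at (fun s => zV s 0 i) 0 by exact: line_coord_smooth.
  have szVd i : smooth_at (fun s => zVd s 0 i) 0 by exact: line_coord_smooth.
  have zV0 : zV 0 = cmap (chartV l) (ptV u) by rewrite /zV /line_coord scale0r addr0.
  have zVd0 : zVd 0 = cmap (chartVd l) (ptVd al) by rewrite /zVd /line_coord scale0r addr0.
  have [sV V0 _] := coord_curve (good_totV A) (chartV_adm l) dV szV zV0.
  have [sVd Vd0 _] := coord_curve (good_totVd A) (chartVd_adm l) dVd szVd zVd0.
  have UE : tan_fun U = velocity (fun s => cinv (chartV l) (zV s) : totV A) 0.
    apply: (is_tangent_ext (good_totV A) (chartV_adm l) dV (is_tangent_tangent U)).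
      by rewrite -V0; exact: is_tangent_velocity.
    move=> i; rewrite (coord_curve_velocity (good_totV A) i (chartV_adm l) dV szV zV0).
    rewrite line_coord_derive; case: (split_ordP i) => j ->.
      by rewrite row_mxEl mxE.
    by rewrite row_mxEr mxE chartV_r.
  have XE : tan_fun X = velocity (fun s => cinv (chartVd l) (zVd s) : totVd A) 0.
    apply: (is_tangent_ext (good_totVd A) (chartVd_adm l) dVd (is_tangent_tangent X)).
      by rewrite -Vd0; exact: is_tangent_velocity.
    move=> i; rewrite (coord_curve_velocity (good_totVd A) i (chartVd_adm l) dVd szVd zVd0).
    rewrite line_coord_derive; case: (split_ordP i) => j ->.
      by rewrite row_mxEl mxE -pushV_coord // UX pushVd_coord.
    by rewrite row_mxEr mxE chartVd_r.
  have sV' : smooth_curve_at (S := totV A) (fun s => ptV (tagged (w s)).1) 0 by rewrite wVE.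
  have sVd' : smooth_curve_at (S := totVd A) (fun s => ptVd (tagged (w s)).2) 0 by rewrite wVdE.
  have V0' : ptV (tagged (w 0)).1 = ptV u := etrans (congr1 (fun c => c 0) wVE) V0.
  have Vd0' : ptVd (tagged (w 0)).2 = ptVd al := etrans (congr1 (fun c => c 0) wVdE) Vd0.
  rewrite -wVE in UE; rewrite -wVdE in XE.
  by eexists; exists w; split; [split|split|split|reflexivity].
move=> [w /= [[sV sVd] [V0 Vd0] [UE XE] ->]].
set wV := fun s => ptV (tagged (w s)).1 in sV UE V0.
set wVd := fun s => ptVd (tagged (w s)).2 in sVd XE Vd0.
have wV0 : wV 0 = ptV u := V0.
have wVd0 : wVd 0 = ptVd al := Vd0.
have dV : ld_dom l (tag (wV 0)) by rewrite wV0.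
have dVd : ld_dom l (tag (wVd 0)) by rewrite wVd0.
have dw : \forall s \near (0 : R), ld_dom l (tag (w s)).
  have st := @smooth_curve_tag _ _ _ _ _ (frames A) (@trivV R M A) (@frames_cover _ _ A) _ _ sV.
  exact: (smooth_curve_near st (ld_dom_near dV)).
have scV i : smooth_near (fun q => coordV l q 0 i) (wV 0) by exact: coordV_smooth.
have scVd i : smooth_near (fun q => coordVd l q 0 i) (wVd 0) by exact: coordVd_smooth.
transitivity (derive1 (fun s => \sum_i coordV l (wV s) 0 i * coordVd l (wVd s) 0 i) 0).
  apply: derive1_near_eq; apply: filterS dw => s dws.
  by rewrite (pairing_coord (tagged (w s)).2 (tagged (w s)).1 dws).
rewrite derive1_pairing => [|i|i]; last 2 first.
- by apply: smooth_at_derivable; exact: (smooth_near_curve (good_totV A) sV (scV i)).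
- by apply: smooth_at_derivable; exact: (smooth_near_curve (good_totVd A) sVd (scVd i)).
apply: eq_bigr => i _; rewrite UE XE !velocityE //.
by rewrite wV0 wVd0.
Qed.

(** The coordinate description of [is_sigma] prescribes all components of U, so a suitable U exists,
    and the pairing takes the same value on every such U. *)
Lemma A_A_coord (p : rhoTVd G) (w : prolV G (rt_pr1 p)) : ld_dom l (rt_base p) ->
  let u := coordV l (ptV (prol_vec w : vfib A (rt_base p))) in
  projT2 (A_A p) w = \sum_j
    ((prol_tan w (fun q => coordA l q 0 j)
      - \sum_i u 0 i * ldK l (coordA l (rt_pr1 p)) i j (rt_base p))
     * coordVd l (ptVd (rt_al p)) 0 j
     + u 0 j * rt_X p (fun q => coordVd l q 0 j)).
Proof.
move=> dx u; set x := rt_base p.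
have tb : is_tangent (S := M) x (rhoA G (rt_a p)) by exact: is_tangent_tangent.
have : [set r | exists U, is_sigma (b := rt_a p) (w := w) U /\ r = tpairing U (rt_X p)]
    (projT2 (A_A p) w).
  apply: xgetPex.
  pose v := row_mx (\row_i rhoA G (rt_a p) (chart_coord k i))
    (\row_j (prol_tan w (fun q => coordA l q 0 j)
      - \sum_i u 0 i * ldK l (coordA l (rt_pr1 p)) i j x)) : 'rV[R]_(m + rk).
  have dV : cdom (chartV l) (ptV (prol_vec w : vfib A x)) by exact: chartV_dom.
  have [U UE] := tangent_exists (good_totV A) v (chartV_adm l) dV.
  exists (tpairing U (rt_X p)), U; split=> //; apply/(is_sigmaP (l := l)) => //.
  split=> [|j]; last by rewrite -chartV_r UE row_mxEr mxE.
  apply: (tangentM_ext dx) => //; first exact: (pushV_tangent U).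
  by move=> i; rewrite pushV_coord // UE row_mxEl mxE.
move=> [U [/(is_sigmaP (l := l) U dx)[pU UE] ->]].
rewrite tpairingE //; last by rewrite pU; exact: rt_eq.
by apply: eq_bigr => j _; rewrite UE.
Qed.

(** The anchor fixes the base components of Y only, so u and the fibre components can be prescribed
    independently; such vectors serve to compare two forms. *)
Lemma prolV_exists (q : totA A) (u : vfib A (tag q)) (om : 'rV[R]_rk) :
  ld_dom l (tag q) -> exists w : prolV G q, prol_vec w = u /\
    forall j, prol_tan w (fun q => coordA l q 0 j) = om 0 j.
Proof.
move=> dq.
pose v := row_mx (\row_i rhoV G u (chart_coord k i)) om : 'rV[R]_(m + rk).
have [Y YE] := tangent_exists (good_totA A) v (chartA_adm l) (chartA_dom dq).
have pY : tan_fun (rhoV G u) = push (@tauA R M A) Y.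
  apply: (tangentM_ext dq); [exact: is_tangent_tangent|exact: pushA_tangent|].
  by move=> i; rewrite pushA_coord // YE row_mxEl mxE.
by exists (ProlV pY); split=> // j; rewrite -chartA_r YE row_mxEr.
Qed.

Variable L : totA A -> R.
Hypothesis hL : smooth_fun L.

Lemma S_LP (p : rhoTVd G) :
  S_L L p <-> forall w : prolV G (rt_pr1 p), projT2 (A_A p) w = prol_tan w L.
Proof.
split=> [[b]|Lp].
  (* The equality is one of dependent pairs; generalizing its left side lets it be substituted as a
     whole, which also identifies b with [rt_pr1 p]. *)
  have H (z : prolV_dual G) : z = dprol G L b ->
      forall w : prolV G (projT1 z), projT2 z w = prol_tan w L by move=> ->.
  exact: H.
exists (rt_pr1 p); rewrite /A_A /dprol; congr existT.
by apply/funext => w; have := Lp w.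
Qed.

Lemma chartA_inv z y : cinv (chartA l) (row_mx z y) = ld_point l (cinv k z) y.
Proof. by rewrite /chartA /= row_mxKl row_mxKr. Qed.

Lemma dLdxE i z y : dLdx l L i z y =
  'D_(delta_mx 0 (lshift rk i)) (fun w => L (cinv (chartA l) w)) (row_mx z y).
Proof.
have LE : (fun z' => L (cinv (chartA l) (row_mx z' y))) = (fun z' => L (ld_point l (cinv k z') y)).
  by apply/funext => z'; rewrite chartA_inv.
by rewrite delta_lshift derive_row_mxl LE.
Qed.

Lemma dLdyE i z y : dLdy l L i z y =
  'D_(delta_mx 0 (rshift m i)) (fun w => L (cinv (chartA l) w)) (row_mx z y).
Proof.
have LE : (fun y' => L (cinv (chartA l) (row_mx z y'))) = (fun y' => L (ld_point l (cinv k z) y')).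
  by apply/funext => y'; rewrite chartA_inv.
by rewrite delta_rshift derive_row_mxr LE.
Qed.

Lemma L_chart_smooth (q : totA A) : ld_dom l (tag q) ->
  smooth_at (fun w => L (cinv (chartA l) w)) (row_mx (cmap k (tag q)) (coordA l q)).
Proof.
move=> dq.
exact: ((smooth_near_chart (good_totA A) L (chartA_adm l) (chartA_dom dq)).1 (@hL q)).
Qed.

Lemma tangent_L (q : totA A) (Y : tangent q) : ld_dom l (tag q) ->
  Y L = \sum_i dLdx l L i (cmap k (tag q)) (coordA l q) * push (@tauA R M A) Y (chart_coord k i)
      + \sum_j dLdy l L j (cmap k (tag q)) (coordA l q) * Y (fun q => coordA l q 0 j).
Proof.
move=> dq; have sL := smooth_at_differentiable (L_chart_smooth dq).
rewrite (is_tangent_coord (good_totA A) (chartA_adm l) (chartA_dom dq)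
  (is_tangent_tangent Y) (@hL q)) big_split_ord /=; congr (_ + _); apply: eq_bigr => i _.
  by rewrite dLdxE deriveE // pushA_coord.
by rewrite dLdyE deriveE // chartA_r.
Qed.

Lemma S_L_coord (p : rhoTVd G) : ld_dom l (rt_base p) ->
  let z := cmap k (rt_base p) in let y := coordA l (rt_pr1 p) in
  S_L L p <->
  (forall j, coordVd l (ptVd (rt_al p)) 0 j = dLdy l L j z y) /\
  (forall j, rt_X p (fun q => coordVd l q 0 j) =
     \sum_i ld_rho l j i (rt_base p) * dLdx l L i z y +
     \sum_i ldK l y j i (rt_base p) * dLdy l L i z y).
Proof.
move=> dx z y; set x := rt_base p.
pose eta j := coordVd l (ptVd (rt_al p)) 0 j.
pose Xeta j := rt_X p (fun q => coordVd l q 0 j).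
have AE (w : prolV G (rt_pr1 p)) : projT2 (A_A p) w =
   \sum_j (prol_tan w (fun q => coordA l q 0 j) * eta j) +
   \sum_i coordV l (ptV (prol_vec w : vfib A x)) 0 i *
      (Xeta i - \sum_j ldK l y i j x * eta j).
  rewrite (A_A_coord w dx).
  under [X in _ = _ + X]eq_bigr do rewrite mulrBr mulr_sumr.
  rewrite sumrB exchange_big.
  rewrite addrCA -sumrB -big_split; apply: eq_bigr => j _ /=.
  have -> : \sum_i coordV l (ptV (prol_vec w : vfib A x)) 0 i * (ldK l y i j x * eta j) =
    (\sum_i coordV l (ptV (prol_vec w : vfib A x)) 0 i * ldK l y i j x) * eta j.
    by rewrite mulr_suml; apply: eq_bigr => i _; rewrite mulrA.
  by rewrite /eta /Xeta; ring.
have LE (w : prolV G (rt_pr1 p)) : prol_tan w L =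
   \sum_j (prol_tan w (fun q => coordA l q 0 j) * dLdy l L j z y) +
   \sum_i coordV l (ptV (prol_vec w : vfib A x)) 0 i *
      (\sum_j ld_rho l i j x * dLdx l L j z y).
  rewrite tangent_L // addrC; congr (_ + _); first by apply: eq_bigr => j _; rewrite mulrC.
  under eq_bigr do rewrite -(prol_eq w) (rhoV_coord (prol_vec w : vfib A x) _ dx) mulr_sumr.
  rewrite exchange_big; apply: eq_bigr => i _ /=.
  by rewrite mulr_sumr; apply: eq_bigr => j _; rewrite /ld_rho; ring.
rewrite S_LP; split=> [AL|[etaE XE] w]; last first.
  rewrite AE LE; congr (_ + _); apply: eq_bigr => j _; first by rewrite /eta etaE.
  rewrite /Xeta XE; congr (_ * _); rewrite -addrA.
  rewrite [X in _ + X](_ : _ = 0) ?addr0 //; apply/eqP; rewrite subr_eq0; apply/eqP.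
  by apply: eq_bigr => i _; rewrite /eta etaE.
have etaE j : eta j = dLdy l L j z y.
  (* The vertical vector along y^j isolates the component eta_j. *)
  have [w [wu wy]] := @prolV_exists (rt_pr1 p) 0 (delta_mx 0 j) dx.
  have := AL w; rewrite AE LE wu.
  have z0 : coordV l (ptV (0 : vfib A x)) = 0 by rewrite /coordV /= linear0.
  have wyE i : prol_tan w (fun q => coordA l q 0 i) = (i == j)%:R by rewrite wy mxE.
  rewrite z0; under eq_bigr do rewrite wyE.
  under [X in _ = X + _ -> _]eq_bigr do rewrite wyE.
  rewrite !sum_delta [X in _ + X = _]big1 => [|i _]; last by rewrite mxE mul0r.
  by rewrite [X in _ = _ + X]big1 => [|i _]; rewrite ?addr0 // mxE mul0r.
split=> // j.
(* A vector over e_j without fibre component isolates the velocity of eta_j. *)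
have [w [wu wy]] := @prolV_exists (rt_pr1 p) (ld_e l j x) 0 dx.
have := AL w; rewrite AE LE wu.
have uE i : coordV l (ptV (ld_e l j x)) 0 i = (i == j)%:R.
  by rewrite /coordV /= -ld_basis_vec (fcoord_basis _ _ (ld_frame_adm l)) // eq_sym.
under [X in _ + X = _ -> _]eq_bigr do rewrite uE.
under [X in _ = _ + X -> _]eq_bigr do rewrite uE.
rewrite !sum_delta [X in X + _ = _]big1 => [|i _]; last by rewrite wy mxE mul0r.
rewrite [X in _ = X + _]big1 => [|i _]; last by rewrite wy mxE mul0r.
rewrite !add0r => /eqP; rewrite subr_eq => /eqP; rewrite -/(Xeta j) => ->.
by congr (_ + _); apply: eq_bigr => i _; rewrite etaE.
Qed.

End Isomorphism.

(** * Curves in S_L *)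

(** Proofs of equality of the first components are unique by proof irrelevance, so the transport
    between the fibres is the identity. *)
Lemma existT_inj2 (T : Type) (P : T -> Type) x (a b : P x) :
  existT P x a = existT P x b -> a = b.
Proof.
by move=> E; have := projT2_eq E; rewrite (Prop_irrelevance (projT1_eq E) erefl).
Qed.

Section LagrangianCurves.
Variables (R : realType) (M : manifold R) (A : affine_bundle M).
Variables (G : lie_affgebroid A) (L : totA A -> R).
Hypothesis hL : smooth_fun L.
Notation rk := (rank A).
Notation m := (mdim M).
Implicit Type x : mtop M.

Let gM := @good_manifold R M.

Lemma S_L_inj (p p' : rhoTVd G) : S_L L p -> S_L L p' -> rt_pr1 p = rt_pr1 p' -> p = p'.
Proof.
case: p => x a al X aX; case: p' => x' a' al' X' aX' Sp Sp' E.
have xx' : x = x' := congr1 (@projT1 _ _) E.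
subst x'; have aa' : a = a' := existT_inj2 E.
subst a'; clear E.
have [l dx] := local_data_exists G x.
have [/= eE XE] := (S_L_coord hL (p := RhoTVd aX) dx).1 Sp.
have [/= eE' XE'] := (S_L_coord hL (p := RhoTVd aX') dx).1 Sp'.
have alal' : al = al'.
  apply: scalar_ext => u; rewrite (pairing_coord al u dx) (pairing_coord al' u dx).
  by apply: eq_bigr => i _; rewrite eE eE'.
subst al'; have XX' : X = X'.
  apply: tangent_eq.
  apply: (is_tangent_ext (good_totVd A) (chartVd_adm l) (chartVd_dom (q := ptVd al) dx));
    [exact: is_tangent_tangent|exact: is_tangent_tangent|].
  move=> i; case: (split_ordP i) => j ->.
    by rewrite -!pushVd_coord // -aX -aX'.
  by rewrite chartVd_r XE XE'.
by subst X'; rewrite (Prop_irrelevance aX aX').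
Qed.

(** The equations of [S_L_coord] and the anchor condition prescribe the coordinates of the covector
    and of X, which can be chosen freely. *)
Lemma S_L_surj (q : totA A) : exists p : rhoTVd G, S_L L p /\ rt_pr1 p = q.
Proof.
case: q => x a; have [l dx] := local_data_exists G x.
pose z := cmap (ld_chart l) x; pose y := coordA l (ptA a).
pose eta := \row_j dLdy l L j z y : 'rV[R]_rk.
pose al : dual_fib A x := dual_vec (ld_frame l) x eta : {scalar vfib A x}.
pose v := row_mx (\row_i rhoA G a (chart_coord (ld_chart l) i))
  (\row_j (\sum_i ld_rho l j i x * dLdx l L i z y +
     \sum_i ldK l y j i x * dLdy l L i z y)) : 'rV[R]_(m + rk).
have [X XE] := tangent_exists (good_totVd A) v (chartVd_adm l) (chartVd_dom (q := ptVd al) dx).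
have aX : tan_fun (rhoA G a) = push (@tauVd R M A) X.
  apply: (tangentM_ext dx); [exact: is_tangent_tangent|exact: (pushVd_tangent X)|].
  by move=> i; rewrite pushVd_coord // XE row_mxEl mxE.
exists (RhoTVd aX); split=> //; apply/(S_L_coord hL (p := RhoTVd aX) dx); split=> j /=.
  have [_ _ vK] := trivVd_proper (ld_frame_adm l).
  have := vK x dx eta; rewrite /= => /rowP/(_ j).
  by rewrite !mxE ld_basis_vec.
by rewrite -chartVd_r XE row_mxEr mxE.
Qed.

Section AlongCurve.
Variables (l : local_data G) (c : R -> totA A) (t : R).
Hypotheses (sc : smooth_curve_at c t) (dt : ld_dom l (tag (c t))).

Let z s := cmap (ld_chart l) (tag (c s)).
Let y s := coordA l (c s).

Lemma base_curve : smooth_curve_at (S := M) (fun s => tag (c s)) t.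
Proof.
exact: (@smooth_curve_tag _ _ _ _ _ (frames A) (@trivA R M A) (@frames_cover _ _ A)).
Qed.

Lemma curve_dom : \forall s \near t, ld_dom l (tag (c s)).
Proof. exact: (smooth_curve_near base_curve (ld_dom_near dt)). Qed.

Lemma coord_curve_smooth i : smooth_at (fun s => y s 0 i) t.
Proof. exact: (smooth_near_curve (good_totA A) sc (coordA_smooth i dt)). Qed.

Lemma base_function_smooth f : smooth_near (S := M) f (tag (c t)) ->
  smooth_at (fun s => f (tag (c s))) t.
Proof. exact: (smooth_near_curve gM base_curve). Qed.

Lemma chart_derivative_smooth v :
  smooth_at (fun s => 'D_v (fun w => L (cinv (chartA l) w)) (row_mx (z s) (y s))) t.
Proof.
have [_ scoord] := (smooth_curve_chart (good_totA A) c (chartA_adm l) (chartA_dom dt)).1 sc.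
have := @smooth_at_comp_row R _ _ ('D_v (fun w => L (cinv (chartA l) w)))
  (fun s => row_mx (z s) (y s)) t scoord.
by apply; apply: smooth_at_derive; exact: L_chart_smooth.
Qed.

Lemma dLdx_curve_smooth i : smooth_at (fun s => dLdx l L i (z s) (y s)) t.
Proof.
have -> : (fun s => dLdx l L i (z s) (y s)) =
    (fun s => 'D_(delta_mx 0 (lshift rk i)) (fun w => L (cinv (chartA l) w)) (row_mx (z s) (y s))).
  by apply/funext => s; exact: dLdxE.
exact: chart_derivative_smooth.
Qed.

Lemma dLdy_curve_smooth i : smooth_at (fun s => dLdy l L i (z s) (y s)) t.
Proof.
have -> : (fun s => dLdy l L i (z s) (y s)) =
    (fun s => 'D_(delta_mx 0 (rshift m i)) (fun w => L (cinv (chartA l) w)) (row_mx (z s) (y s))).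
  by apply/funext => s; exact: dLdyE.
exact: chart_derivative_smooth.
Qed.

Lemma rhoA_curve_smooth i :
  smooth_at (fun s => rhoA G (tagged (c s)) (chart_coord (ld_chart l) i)) t.
Proof.
apply: (smooth_near_curve (good_totA A) (f := fun a : totA A =>
  rhoA G (tagged a) (chart_coord (ld_chart l) i)) sc).
by apply: rhoA_smooth; [exact: ld_atlas|exact: ld_sub].
Qed.

(** Smoothness is part of the structure for [rhoA]; the linear part on e_j is the difference of
    [rhoA] at e_0 + e_j and at e_0. *)
Lemma ld_rho_smooth x j i : ld_dom l x -> smooth_near (S := M) (ld_rho l j i) x.
Proof.
move=> dx; have kx : cdom (ld_chart l) x by exact: ld_sub.
pose f (a : totA A) := rhoA G (tagged a) (chart_coord (ld_chart l) i).
have sf (a : afib A x) : smooth_near f (ptA a).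
  by apply: rhoA_smooth => //; exact: ld_atlas.
have s0 := ld_e0_smooth l; have sj := @ld_e_smooth _ _ _ _ l j.
apply: (@smooth_near_ext _ _ (fun x' => f (ptA (shiftS (ld_e0 l) (ld_e l j) x')) -
    f (ptA (ld_e0 l x')))).
  by apply: nearW => x'; rewrite /f /= /shiftS rhoA_affine addrAC subrr add0r.
apply: smooth_nearB; apply: smooth_near_sectionA => //.
exact: smooth_shiftS.
Qed.

(** The structure functions are coordinates of brackets of smooth sections on the domain of the
    local data, and this is where their smoothness comes from. *)
Lemma ldK_curve_smooth i j : smooth_at (fun s => ldK l (y s) i j (tag (c s))) t.
Proof.
have ae := ld_frame_adm l; have [_ eK _ _] := ae.
have coordE x (a : 'I_rk -> R) (v : vfib A x) : ld_dom l x ->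
    v = \sum_i a i *: ld_e l i x -> fcoord (ld_frame l) x v 0 j = a j.
  move=> dx ->; have -> : \sum_i a i *: ld_e l i x = fvec (ld_frame l) x (\row_i a i).
    by rewrite fvec_sum; apply: eq_bigr => i' _; rewrite mxE ld_basis_vec.
  by rewrite (eK x dx) mxE.
have s0 := ld_e0_smooth l.
apply: smooth_atD;
  last (apply: smooth_at_sum => b; apply: smooth_atM; last exact: coord_curve_smooth).
  apply: (base_function_smooth (f := ld_C0 l i j)).
  apply: (@smooth_near_ext _ _ (fun x' =>
    fcoord (ld_frame l) x' (D G (ld_e0 l) (ld_e l i) x') 0 j)).
    by apply: filterS (ld_dom_near dt) => x' dx'; rewrite (coordE _ _ _ dx' (ld_C0E i dx')).
  by apply: smooth_section_coord => //; apply: D_smooth => //; exact: ld_e_smooth.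
apply: (base_function_smooth (f := ld_C l b i j)).
apply: (@smooth_near_ext _ _ (fun x' =>
  fcoord (ld_frame l) x' (br G (ld_e l b) (ld_e l i) x') 0 j)).
  by apply: filterS (ld_dom_near dt) => x' dx'; rewrite (coordE _ _ _ dx' (ld_CE b i dx')).
by apply: smooth_section_coord => //; apply: br_smooth => //; exact: ld_e_smooth.
Qed.

End AlongCurve.

(** The lift is composed of a pointwise choice F of the point of S_L over each point of A; its
    smoothness is recovered from the explicit coordinates that [S_L_coord] forces on F. *)
Lemma curve_in_S_L_exists (I : set R) (c : R -> totA A) : smooth_curve I c ->
  exists g : R -> rhoTVd G, curve_in_S_L L I g /\ (forall t, I t -> Psi g t = c t).
Proof.
move=> sc; have /choice[F FE] := S_L_surj.
have SF q : S_L L (F q) by case: (FE q).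
have prF q : rt_pr1 (F q) = q by case: (FE q).
have baseF q : rt_base (F q) = tag q by rewrite -[in RHS](prF q).
exists (fun t => F (c t)); split=> [|t It]; last exact: prF.
split=> [|t It]; last exact: SF.
have pr1E : (fun t => rt_pr1 (F (c t))) = c by apply/funext => t; exact: prF.
have scVd : smooth_curve I (fun t => tag (rt_pr2 (F (c t)))).
  move=> t It; have [l dt] := local_data_exists G (tag (c t)).
  have dF : ld_dom l (rt_base (F (c t))) by rewrite baseF.
  apply/(@smooth_curve_fibre _ _ _ _ _ (frames A) (@trivVd R M A) _ _ _ (ld_chart l)
    (trivVd (ld_frame l)) (fun t => tag (rt_pr2 (F (c t))))) => //.
  - exact: frames_cover.
  - by move=> e' /frames_adm/trivVd_proper.
  - move=> e1 e2 /frames_adm ae1 ee2; apply: trivVd_affine => //.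
    by have [_ _ _ /(_ _ ee2)[]] := ae1.
  - exact: ld_atlas.
  - exact/adm_trivVd/ld_frame_adm.
  - exact: ld_sub.
  split.
    have := base_curve (sc _ It).
    by congr (smooth_curve_at _ t); apply/funext => s; rewrite /= baseF.
  move=> j; apply: smooth_at_ext (dLdy_curve_smooth (sc _ It) dt j).
  apply: filterS (curve_dom (sc _ It) dt) => s ds.
  have ds' : ld_dom l (rt_base (F (c s))) by rewrite baseF.
  have [/(_ j) + _] := (S_L_coord hL ds').1 (SF (c s)).
  have -> : cmap (ld_chart l) (rt_base (F (c s))) = cmap (ld_chart l) (tag (c s)) by rewrite baseF.
  by rewrite prF => <-; rewrite !mxE ld_basis_vec.
split; first by rewrite pr1E.
split=> // t It kappa ckappa kt i.
have [l dt] := local_data_exists G (tag (c t)).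
have dF : ld_dom l (rt_base (F (c t))) by rewrite baseF.
pose q s := tag (rt_pr2 (F (c s))) : totVd A.
have sq : smooth_curve_at q t := scVd _ It.
have akappa := adm_charts (good_totVd A) ckappa.
have dq : ld_dom l (tag (q t)) := dF.
have [_ scoord] := (smooth_curve_chart (good_totVd A) q (chartVd_adm l) (chartVd_dom dq)).1 sq.
have [near_kappa _] := (smooth_curve_chart (good_totVd A) q akappa kt).1 sq.
(* Smoothness is required in the given chart [kappa], whereas formulas are known in the chart of the
   local data: the components of X are converted by the Jacobian of the change of chart. *)
apply: (@smooth_at_ext _ _ (fun s => \sum_j
  partial (S := totVd A) (chartVd l) (chart_coord kappa i) j (q s) *
  rt_X (F (c s)) (chart_coord (chartVd l) j))).
  apply: filterS2 near_kappa (curve_dom (sc _ It) dt) => s ks ds.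
  have ds' : ld_dom l (tag (q s)) by rewrite /q /= baseF.
  rewrite (is_tangent_coord (good_totVd A) (chartVd_adm l) (chartVd_dom ds')
    (is_tangent_tangent (rt_X (F (c s))))) //.
  exact: (smooth_near_coord i akappa ks).
apply: smooth_at_sum => j; apply: smooth_atM.
  have := @smooth_at_comp_row R _ _ 
    (fun w => 'd (fun w => chart_coord kappa i (cinv (chartVd l) w)) w (delta_mx 0 j))
    (fun s => cmap (chartVd l) (q s)) t scoord.
  apply; apply: smooth_at_d.
  exact: ((smooth_near_chart (good_totVd A) _ (chartVd_adm l) (chartVd_dom dq)).1
    (smooth_near_coord i akappa kt)).
case: (split_ordP j) => j' ->.
  apply: smooth_at_ext (rhoA_curve_smooth (sc _ It) dt j').
  apply: filterS (curve_dom (sc _ It) dt) => s ds.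
  have ds' : ld_dom l (tag (q s)) by rewrite /q /= baseF.
  rewrite -(pushVd_coord (rt_X (F (c s))) j' ds') -rt_eq.
  by rewrite -[in LHS](prF (c s)).
rewrite chartVd_r.
apply: (@smooth_at_ext _ _ (fun s =>
  let z := cmap (ld_chart l) (tag (c s)) in let y := coordA l (c s) in
  \sum_i ld_rho l j' i (tag (c s)) * dLdx l L i z y +
  \sum_i ldK l y j' i (tag (c s)) * dLdy l L i z y)).
  apply: filterS (curve_dom (sc _ It) dt) => s ds /=.
  have ds' : ld_dom l (rt_base (F (c s))) by rewrite baseF.
  have [_ /(_ j') ->] := (S_L_coord hL ds').1 (SF (c s)).
  by rewrite prF baseF.
apply: smooth_atD; apply: smooth_at_sum => i'; apply: smooth_atM.
- exact: (base_function_smooth (sc _ It) (ld_rho_smooth j' i' dt)).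
- exact: (dLdx_curve_smooth (sc _ It) dt).
- exact: (ldK_curve_smooth (sc _ It) dt).
- exact: (dLdy_curve_smooth (sc _ It) dt).
Qed.

Lemma admissible_coord (I : set R) (g : R -> rhoTVd G) (l : local_data G) t :
  open I -> I t -> curve_in_S_L L I g -> ld_dom l (rt_base (g t)) ->
  let z s := cmap (ld_chart l) (rt_base (g s)) in
  let y s := coordA l (rt_pr1 (g s)) in
  tan_fun (rt_X (g t)) = velocity (fun s => tag (rt_pr2 (g s))) t <->
  (forall i, derive1 (fun s : R => z s 0 i) t =
     ld_rho0 l i (rt_base (g t)) + \sum_al ld_rho l al i (rt_base (g t)) * y t 0 al) /\
  (forall al, derive1 (fun s : R => dLdy l L al (z s) (y s)) t =
     \sum_i ld_rho l al i (rt_base (g t)) * dLdx l L i (z t) (y t) +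
     \sum_ga ldK l (y t) al ga (rt_base (g t)) * dLdy l L ga (z t) (y t)).
Proof.
move=> oI It [[sc [sVd _]] gS] dt z y.
pose q s := tag (rt_pr2 (g s)) : totVd A.
have sq : smooth_curve_at q t := sVd _ It.
have dq : ld_dom l (tag (q t)) := dt.
have dc := curve_dom (sc _ It) dt.
have XLE i : rt_X (g t) (chart_coord (chartVd l) (lshift rk i)) =
    ld_rho0 l i (rt_base (g t)) + \sum_al ld_rho l al i (rt_base (g t)) * y t 0 al.
  rewrite -(pushVd_coord (rt_X (g t)) i dq) -rt_eq (rhoA_coord _ _ dt).
  by congr (_ + _); apply: eq_bigr => j _; rewrite mulrC.
have XRE j : rt_X (g t) (chart_coord (chartVd l) (rshift m j)) =
     \sum_i ld_rho l j i (rt_base (g t)) * dLdx l L i (z t) (y t) +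
     \sum_ga ldK l (y t) j ga (rt_base (g t)) * dLdy l L ga (z t) (y t).
  by rewrite chartVd_r; exact: ((S_L_coord hL dt).1 (gS _ It)).2.
have velE i : velocity q t (chart_coord (chartVd l) i) =
    derive1 (fun s => chart_coord (chartVd l) i (q s)) t.
  by apply: velocityE; apply: smooth_near_coord; [exact: chartVd_adm|exact: chartVd_dom].
have vLE i : velocity q t (chart_coord (chartVd l) (lshift rk i)) =
    derive1 (fun s : R => z s 0 i) t.
  by rewrite velE chartVd_l.
have vRE j : velocity q t (chart_coord (chartVd l) (rshift m j)) =
    derive1 (fun s : R => dLdy l L j (z s) (y s)) t.
  rewrite velE chartVd_r; apply: derive1_near_eq.
  (* As I is open, the curve lies in S_L for all s near t, so the identity eta_j = dL/dy^j can be
     differentiated at t. *)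
  have nI : \forall s \near t, I s by exact: open_nbhs_nbhs.
  apply: filterS2 nI dc => s Is ds.
  exact: ((S_L_coord hL ds).1 (gS _ Is)).1.
split=> [XV|[EL1 EL2]].
  by split=> [i|j]; [rewrite -vLE -XLE XV|rewrite -vRE -XRE XV].
apply: (is_tangent_ext (good_totVd A) (chartVd_adm l) (chartVd_dom dq)).
- exact: is_tangent_tangent.
- exact: is_tangent_velocity.
- by move=> i; case: (split_ordP i) => j ->; [rewrite XLE vLE EL1|rewrite XRE vRE EL2].
Qed.

(** An equality of tangent vectors can be tested in any one system of local data: admissibility
    implies the equations in every system, and the equations in a single system around each point
    imply admissibility. *)
Lemma admissible_iff_EL (I : set R) (g : R -> rhoTVd G) : open I ->
  curve_in_S_L L I g -> admissible I g <-> EL_solution G L I (Psi g).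
Proof.
move=> oI gI; have [[sc _] _] := gI; split=> [adm t It l y x z dt yE|EL cstar t It].
  have [EL1 EL2] := (admissible_coord oI It gI dt).1 (adm _ It).
  (* The fibre coordinates y in [EL_solution] are given independently of [coordA]; they agree with
     it near t, which suffices for derivatives. *)
  have yc : \forall s \near t, coordA l (rt_pr1 (g s)) = y s.
    apply: filterS2 yE (curve_dom (sc _ It) dt) => s sE ds.
    by rewrite -[rt_pr1 (g s)]/(Psi g s) sE coordA_ld_point.
  have yt : coordA l (rt_pr1 (g t)) = y t := nbhs_singleton yc.
  split=> [i|al]; first by rewrite -yt; exact: EL1.
  rewrite -yt; have := EL2 al; rewrite /ldK => <-.
  by apply: derive1_near_eq; apply: filterS yc => s ->.
have [l dt] := local_data_exists G (rt_base (g t)).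
apply/(admissible_coord oI It gI dt).
apply: (EL t It l (fun s => coordA l (rt_pr1 (g s))) dt).
by apply: filterS (curve_dom (sc _ It) dt) => s ds; exact: coordAK.
Qed.

End LagrangianCurves.

(** Values of curves outside I carry no meaning, so the bijection is expressed by the existence of
    lifts and by their uniqueness on I rather than by equality of functions. *)
Theorem theorem8p5 (R : realType) (M : manifold R) (A : affine_bundle M)
    (G : lie_affgebroid A) (L : totA A -> R) (hL : smooth_fun L)
    (I : set R) (Iopen : open I) (Iitv : is_interval I) :
  (forall g : R -> rhoTVd G, curve_in_S_L L I g ->
     smooth_curve I (Psi g) /\
     (forall t, I t -> A_A (g t) = dprol G L (Psi g t))) /\
  (forall c : R -> totA A, smooth_curve I c ->
     exists g : R -> rhoTVd G, curve_in_S_L L I g /\ (forall t, I t -> Psi g t = c t)) /\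
  (forall g g' : R -> rhoTVd G, curve_in_S_L L I g -> curve_in_S_L L I g' ->
     (forall t, I t -> Psi g t = Psi g' t) -> forall t, I t -> g t = g' t) /\
  (forall g : R -> rhoTVd G, curve_in_S_L L I g ->
     (admissible I g <-> EL_solution G L I (Psi g))).
Proof.
split=> [g [[sc _] gS]|].
  (* An element of the dual carries its base point, so the b provided by membership in S_L is
     [Psi g t]. *)
  split=> // t It; have [b E] := gS _ It; rewrite E; congr dprol.
  exact/esym/(congr1 (@projT1 _ _) E).
split; first exact: curve_in_S_L_exists.
split=> [g g' [_ gS] [_ gS'] gg' t It|g gI]; last exact: admissible_iff_EL.
by apply: (S_L_inj hL); [exact: gS|exact: gS'|exact: gg'].
Qed.
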